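(* Let $n,m\ge 1$ be integers, let $\gamma\ge 0$ and $p\ge 1+\gamma$ be real numbers, and consider the metric probability measure space $(\mathbb{R}^n_x\times\mathbb{R}^m_y,\ \mu_{\gamma,p},\ d_\gamma)$, where $d_\gamma$ is the Carnot-Carathéodory metric of the Grushin space and $d\mu_{\gamma,p}=Z^{-1}\exp(-N_\gamma^p)\,dx\,dy$. For $K>0$ let $$A_K=\{(x,y)\in\mathbb{R}^n_x\times\mathbb{R}^m_y \mid (1+\gamma)|y|\ge |x|^{1+\gamma}+K\}.$$ Then the sets $A_K$ form a family of almost isoperimetric extremisers as $K\to\infty$. That is, there exist $K_0>0$, $t_0\in(0,1)$ and a constant $C>1$ (all allowed to depend on $n,m,\gamma,p$) such that $\{\mu_{\gamma,p}(A_K): K\ge K_0\}=(0,t_0]$ and, for all $K\ge K_0$, $$\frac{\mu_{\gamma,p}^+(A_K)}{\mathcal{I}_{\mu_{\gamma,p}}(\mu_{\gamma,p}(A_K))}\le C .$$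
   Context: Grushin space: on $\mathbb{R}^{n+m}=\mathbb{R}^n_x\times\mathbb{R}^m_y$ with $\gamma\ge 0$, the subgradient is $\nabla_\gamma=(\nabla_x,|x|^\gamma\nabla_y)$, where $|\cdot|$ is the euclidean norm. The Carnot-Carathéodory metric $d_\gamma$ induced by $\nabla_\gamma$ is defined by letting $d_\gamma(g,h)$ be the infimum of $\int_0^1\sqrt{|a(s)|^2+|b(s)|^2}\,ds$ over absolutely continuous curves $(x(s),y(s))$, $s\in[0,1]$, from $g$ to $h$ satisfying $\dot x(s)=a(s)\in\mathbb{R}^n$ and $\dot y(s)=|x(s)|^\gamma b(s)$, $b(s)\in\mathbb{R}^m$, for almost every $s$. Measure: $N_\gamma(x,y)=\big(|x|^{2(1+\gamma)}+(1+\gamma)^2|y|^2\big)^{1/(2(1+\gamma))}$, and $\mu_{\gamma,p}$ is the probability measure on $\mathbb{R}^{n+m}$ given by $d\mu_{\gamma,p}(x,y)=Z^{-1}\exp(-N_\gamma(x,y)^p)\,dx\,dy$, with $Z=Z_{\gamma,p}$ the normalisation constant. Perimeter and isoperimetric profile: for a metric probability measure space $(X,\mu,d)$ and a Borel set $A\subset X$, the perimeter of $A$ is the lower Minkowski content $$\mu^+(A)=\liminf_{\epsilon\to0^+}\frac{\mu(A_\epsilon)-\mu(A)}{\epsilon},\qquad A_\epsilon=\{x\in X\mid d(x,A)<\epsilon\},$$ where $A_\epsilon$ is the $\epsilon$-enlargement of $A$ with respect to $d$. The isoperimetric profile is $\mathcal{I}_\mu(t)=\inf\{\mu^+(A)\mid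 A\text{ Borel},\ \mu(A)=t\}$ for $t\in(0,1)$. Almost isoperimetric extremisers: a family of sets $(A_t)$ of sufficiently small measure $0<\mu(A_t)=t\le t_0<1$ for which there is a constant $C>1$ with $C\ge \mu^+(A_t)/\mathcal{I}_\mu(\mu(A_t))$ for all $0<t\le t_0$. *)

(* Defs.v *)
From HB Require Import structures.
From mathcomp Require Import all_boot all_order all_algebra.
From mathcomp Require Import all_classical all_reals all_analysis.

Set Implicit Arguments.
Unset Strict Implicit.
Unset Printing Implicit Defensive.

Import Order.TTheory GRing.Theory Num.Theory numFieldNormedType.Exports.

Local Open Scope classical_set_scope.
Local Open Scope ring_scope.

Section lebesgue_tuple.
Local Open Scope ereal_scope.
Context {R : realType}.

(* R^n is n.-tuple R; the sigma-algebra the library puts on it, generated by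
   the coordinates, is the Borel one. Lebesgue measure on R^n is built as an
   iterated product; lebesgue_tuple_box below is its defining property. *)
Fixpoint lebesgue_tuple (n : nat) : set (n.-tuple R) -> \bar R :=
  match n with
  | 0%N => \d_([tuple] : 0.-tuple R)
  | k.+1 => pushforward
      ((@lebesgue_measure R) \x (@lebesgue_tuple k))
      (fun z : R * k.-tuple R => [tuple of z.1 :: z.2])
  end.

Arguments lebesgue_tuple : clear implicits.

Let consT k (z : R * k.-tuple R) : k.+1.-tuple R := [tuple of z.1 :: z.2].

Let unconsT k (t : k.+1.-tuple R) : R * k.-tuple R :=
  (thead t, [tuple of behead t]).

Let measurable_consT k : measurable_fun [set: R * k.-tuple R] (@consT k).
Proof. exact: measurable_cons measurable_fst measurable_snd. Qed.

Let measurable_unconsT k : measurable_fun [set: k.+1.-tuple R] (@unconsT k).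
Proof.
apply: (measurable_fun_pair (f := @thead _ _)); first exact: measurable_tnth.
exact: measurable_behead.
Qed.

Let consTK k : cancel (@consT k) (@unconsT k).
Proof. by move=> [x t]; congr pair; exact/val_inj. Qed.

Let unconsTK k : cancel (@unconsT k) (@consT k).
Proof. by move=> t; rewrite /consT/= -tuple_eta. Qed.

Let lebesgue_tuple_ex n :
  exists mu : {sigma_finite_measure set (n.-tuple R) -> \bar R},
    lebesgue_tuple n = mu :> (set _ -> \bar R).
Proof.
elim: n => [|k [mu mukE]]; first by exists (\d_([tuple] : 0.-tuple R)).
pose leb := @lebesgue_measure R.
pose nu := pushforward (leb \x mu) (@consT k).
pose numeas := measure_function_pushforward__canonical__measure_function_Measure
  (leb \x mu) (@measurable_consT k).
have nu_sf : sigma_finite setT nu.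
  have /sigma_finiteP[F [TF ndF Foo]] := sigma_finiteT leb.
  have /sigma_finiteP[G [TG ndG Goo]] := sigma_finiteT mu.
  exists (fun i => @unconsT k @^-1` (F i `*` G i)).
    rewrite -preimage_bigcup (_ : \bigcup_i _ = setT) ?preimage_setT//.
    apply/seteqP; split=> // -[x y] _.
    have [i _ Fix] : (\bigcup_i F i) x by rewrite -TF.
    have [j _ Gjy] : (\bigcup_i G i) y by rewrite -TG.
    exists (maxn i j) => //; split.
      by move: x Fix; exact/subsetPset/ndF/leq_maxl.
    by move: y Gjy; exact/subsetPset/ndG/leq_maxr.
  move=> i; have [mF Fi] := Foo i; have [mG Gi] := Goo i; split.
    rewrite -[X in measurable X]setTI; apply: measurable_unconsT => //.
    exact: measurableX.
  rewrite /nu/= /pushforward -comp_preimage.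
  rewrite (_ : @unconsT k \o @consT k = id); last first.
    by apply/funext => z; exact: consTK.
  by rewrite preimage_id product_measure1E// lte_mul_pinfty// ge0_fin_numE.
pose nuS := HB.pack_for {sigma_finite_measure set (k.+1.-tuple R) -> \bar R}
  nu (Measure.class numeas) (Measure_isSigmaFinite.Build _ _ _ nu nu_sf).
have mc := @measurable_consT k.
by exists (nuS mc mc mc); rewrite /= mukE.
Qed.

Let lebesgue_tuple0 n : lebesgue_tuple n set0 = 0.
Proof. by have [mu ->] := lebesgue_tuple_ex n; rewrite measure0. Qed.

Let lebesgue_tuple_ge0 n A : 0 <= lebesgue_tuple n A.
Proof. by have [mu ->] := lebesgue_tuple_ex n. Qed.

Let lebesgue_tuple_sigma_additive n : semi_sigma_additive (lebesgue_tuple n).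
Proof.
have [mu ->] := lebesgue_tuple_ex n; exact: measure_semi_sigma_additive.
Qed.

HB.instance Definition _ n := isMeasure.Build _ _ _ (lebesgue_tuple n)
  (lebesgue_tuple0 n) (@lebesgue_tuple_ge0 n)
  (@lebesgue_tuple_sigma_additive n).

Let lebesgue_tuple_sigma_finite n : sigma_finite setT (lebesgue_tuple n).
Proof. by have [mu ->] := lebesgue_tuple_ex n; exact: sigma_finiteT. Qed.

HB.instance Definition _ n := Measure_isSigmaFinite.Build _ _ _
  (lebesgue_tuple n) (lebesgue_tuple_sigma_finite n).

Lemma lebesgue_tuple_box n (A : 'I_n -> set R) :
  (forall i, measurable (A i)) ->
  lebesgue_tuple n [set x | forall i, A i (tnth x i)] =
  \prod_(i < n) lebesgue_measure (A i).
Proof.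
elim: n A => [|n IH] A mA /=.
  rewrite big_ord0 /= diracE mem_set//= => -[].
  by case.
rewrite big_ord_recl -IH; last by move=> i; exact: mA.
have mB : measurable
    [set x : n.-tuple R | forall i, A (lift ord0 i) (tnth x i)].
  have -> : [set x : n.-tuple R | forall i, A (lift ord0 i) (tnth x i)] =
      \bigcap_(i in [set: 'I_n])
        (fun x : n.-tuple R => tnth x i) @^-1` A (lift ord0 i).
    by apply/seteqP; split=> x /= h i; [move=> _; exact: h|exact: (h i Logic.I)].
  apply: fin_bigcap_measurable => // i _; rewrite -[X in measurable X]setTI.
  by apply: measurable_tnth => //; exact: mA.
rewrite -product_measure1E//; last exact: (mA ord0).
rewrite /pushforward; congr (_ _); apply/seteqP; split=> [[a t]|[a t]] /= h.
  split; first exact: (h ord0).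
  by move=> i; have := h (lift ord0 i); rewrite tnthS.
move=> i; case: (unliftP ord0 i) => [j ->|->]; last exact: h.1.
by rewrite tnthS; exact: h.2.
Qed.

End lebesgue_tuple.
Arguments lebesgue_tuple {R} n _.

Section metric_measure.
Local Open Scope ereal_scope.
Context {R : realType} {disp : measure_display} {T : measurableType disp}.
Variables (mu : set T -> \bar R) (dist : T -> T -> \bar R).

(* +oo when A is empty, so that the enlargements of set0 are empty *)
Definition dist_set (z : T) (A : set T) : \bar R :=
  ereal_inf [set dist z w | w in A].

Definition enlargement (A : set T) (eps : R) : set T :=
  [set z | dist_set z A < eps%:E].

Definition perimeter (A : set T) : \bar R :=
  limf_einf (fun eps : R => (mu (enlargement A eps) - mu A) / eps%:E) 0%R^'+.

Definition isoperimetric_profile (t : \bar R) : \bar R :=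
  ereal_inf [set perimeter A | A in [set A | measurable A /\ mu A = t]].

End metric_measure.

Section absolutely_continuous.
Context {R : realType}.

Definition absolutely_continuous (a b : R) (f : R -> R) : Prop :=
  forall e : R, 0 < e -> exists2 d : R, 0 < d &
    forall (k : nat) (u v : 'I_k -> R),
      (forall i, a <= u i /\ u i <= v i /\ v i <= b) ->
      trivIset [set: 'I_k] (fun i => `]u i, v i[%classic) ->
      \sum_(i < k) (v i - u i) < d ->
      \sum_(i < k) `|f (v i) - f (u i)| < e.

End absolutely_continuous.

Section grushin.
Context {R : realType}.

(* the norm that the library puts on R^n is the sup norm *)
Definition eucl_norm (n : nat) (x : n.-tuple R) : R :=
  Num.sqrt (\sum_(i < n) tnth x i ^+ 2).

Variables (n m : nat) (gamma p : R).

Local Notation X := (n.-tuple R * m.-tuple R)%type.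

(* The derivatives are only required in ]0, 1[, since the curve is a function
   on R whose values outside [0, 1] are irrelevant. For gamma = 0 the factor
   |x|^gamma is 1 everywhere, as 0 `^ 0 = 1. *)
Definition horizontal_curve (g h : X) (x : R -> n.-tuple R)
    (y : R -> m.-tuple R) (a : R -> n.-tuple R) (b : R -> m.-tuple R) : Prop :=
  [/\ (x 0, y 0) = g /\ (x 1, y 1) = h,
      forall i, absolutely_continuous 0 1 (fun s => tnth (x s) i),
      forall j, absolutely_continuous 0 1 (fun s => tnth (y s) j),
      measurable_fun (`[0, 1] : set R) a /\ measurable_fun (`[0, 1] : set R) b
    & {ae lebesgue_measure, forall s : R, s \in `]0, 1[ ->
        (forall i, is_derive s 1 (fun r => tnth (x r) i) (tnth (a s) i)) /\
        (forall j, is_derive s 1 (fun r => tnth (y r) j)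
                     (eucl_norm (x s) `^ gamma * tnth (b s) j))}].

Definition curve_length (a : R -> n.-tuple R) (b : R -> m.-tuple R) : \bar R :=
  (\int[lebesgue_measure]_(s in `[0%R, 1%R])
     (Num.sqrt (eucl_norm (a s) ^+ 2 + eucl_norm (b s) ^+ 2))%:E)%E.

Definition cc_dist (g h : X) : \bar R :=
  ereal_inf [set l | exists x y a b,
    horizontal_curve g h x y a b /\ l = curve_length a b].

Definition grushin_gauge (z : X) : R :=
  (eucl_norm z.1 `^ (2 * (1 + gamma)) +
   (1 + gamma) ^+ 2 * eucl_norm z.2 ^+ 2) `^ (2 * (1 + gamma))^-1.

Definition grushin_density (z : X) : R := expR (- (grushin_gauge z `^ p)).

Definition grushin_Z : R :=
  \int[(lebesgue_tuple n \x lebesgue_tuple m)%E]_z grushin_density z.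

Definition grushin_measure (A : set X) : \bar R :=
  (\int[lebesgue_tuple n \x lebesgue_tuple m]_(z in A)
     (grushin_Z^-1 * grushin_density z)%:E)%E.

Definition extremiser (K : R) : set X :=
  [set z | eucl_norm z.1 `^ (1 + gamma) + K <= (1 + gamma) * eucl_norm z.2].

End grushin.

Arguments horizontal_curve {R n m} gamma g h x y a b.
Arguments cc_dist {R n m} gamma g h.
Arguments grushin_gauge {R n m} gamma z.
Arguments grushin_density {R n m} gamma p z.
Arguments grushin_Z {R} n m gamma p.
Arguments grushin_measure {R} n m gamma p A.
Arguments extremiser {R} n m gamma K.

(* Main.v *)
Require Import Defs.
From HB Require Import structures.
From mathcomp Require Import all_boot all_order all_algebra.
From mathcomp Require Import all_classical all_reals all_analysis.
From mathcomp Require Import measurable_realfun ring lra.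

Set Implicit Arguments.
Unset Strict Implicit.
Unset Printing Implicit Defensive.

Import Order.TTheory GRing.Theory Num.Theory numFieldNormedType.Exports.

Local Open Scope classical_set_scope.
Local Open Scope ring_scope.

(** Write X = |x|^(1+gamma), Y = (1+gamma)|y|, M = sqrt(X^2 + Y^2) and
    q = p/(1+gamma) >= 1. Then N^p = M^q, so that the density is exp(-M^q) up to
    normalisation, and the extremiser A_K is the set Y >= X + K. Most of its mass
    lies near its lowest points, x = 0 and Y = K. There the density changes by a
    bounded factor when y moves by yscale K = K^(1-q), and when x moves by
    xscale K = (yscale K)^(1/(1+gamma)). With t = mu(A_K), the perimeter of A_K is
    at most C t / xscale K, and the perimeter of any set of measure t is at least
    c t / xscale K.

    Upper bound. Along a curve of length eps each coordinate of x moves by at most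
    eps, hence each coordinate of y by at most eps (|x| + n eps)^gamma
    (horizontal_curve_displacement). So the eps-enlargement of A_K lies in a set
    Y >= X + K - theta(x), with theta of the order of eps (|x| + eps)^gamma
    (enlargement_sub_lowered). A dilation of y in each fibre maps this lowered set
    into A_K, and bounds the mass gained by the integral of theta M^q / (X + K)
    over the lowered set (wgt_lowered_le). This integral is at most a multiple of
    (eps / xscale K) times the mass: a contraction of the lowered set into itself
    increases the density by a large factor except near the lowest points, so the
    contribution of the other points can be absorbed (moment_bound).

    Lower bound. Let A have measure t, and let Delta be the mass that A gains when
    it is enlarged by eps. Suppose that a translation moves every point of a part
    P of A along a path of length l on which the density does not drop much. The
    points of P that end outside A have mass at most C (l / eps) Delta, since each
    path leaves A through the enlargement (crossing). The points that end in A
    have small mass if the translation multiplies the density by a large factor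
    (wgt_return_le), or if it is well chosen in a box in which A fills a
    negligible part (averaging_translation). Finitely many parts cover A:
    - M >= 2K has negligible mass (tail_small);
    - where M is comparable to K, a move towards 0 of the largest coordinate of x
      or of y by a multiple of yscale K multiplies the density by a large factor
      (xdom_piece, ydom_piece). Moving y by h costs |h| / |x|^gamma, so if |x| is
      less than xscale K it is first increased to that size;
    - where M is small compared to K the density is so much larger than t that A
      fills a negligible part of small boxes (near_origin_piece).
    All paths have length at most a multiple of xscale K, up to the factor lost on
    the density, so summing over the parts gives t <= C (xscale K / eps) Delta
    (outer_mass_lower).

    Finally mu(A_K) is a continuous decreasing function of K with limit 0, which
    gives the interval of measures that is reached (extremiser_mass_range). *)

(** * Affine changes of variables *)

Section affine.
Context {R : realType}.
Notation leb := (@lebesgue_measure R).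

Lemma integral_affine1 (al v : R) (f : R -> \bar R) : 0 < al ->
  measurable_fun [set: R] f -> (forall x, 0 <= f x)%E ->
  (al%:E * \int[leb]_x f (al * x + v)%R = \int[leb]_x f x)%E.
Proof.
move=> al0 mf f0.
pose phi (x : R) : measurableTypeR R := al * x + v.
have mphi : measurable_fun [set: R] phi.
  by apply: measurable_funD => //; exact: measurable_funM.
pose nu := measure_function_pushforward__canonical__measure_function_Measure
  leb mphi.
have al0' : (0 <= al)%R by exact: ltW.
pose s := NngNum al0'.
have -> : (\int[leb]_x f (al * x + v)%R = \int[nu]_x f x)%E.
  by rewrite /nu/= ge0_integral_pushforward.
rewrite -[al]/(s%:num) -ge0_integral_mscale//.
apply: eq_measure_integral => A mA _.
apply/esym; apply: (@lebesgue_measure_unique R (mscale s nu)) => //= _ [[a b]] _ <-.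
rewrite /mscale/= /pushforward.
have -> : phi @^-1` `]a, b] = `](a - v) / al, (b - v) / al]%classic.
  apply/seteqP; split => x/=; rewrite /phi !in_itv/= ltr_pdivrMr// ler_pdivlMr//;
   by rewrite ltrBlDr lerBrDr (mulrC x).
rewrite !lebesgue_measure_itv/= !lte_fin ltr_pM2r ?invr_gt0// ltrD2r.
case: ifPn => ab; last by rewrite mule0.
rewrite -EFinB -EFinM; congr EFin; field; lra.
Qed.

Lemma ge0_integral_cons k (f : k.+1.-tuple R -> \bar R) :
  measurable_fun [set: k.+1.-tuple R] f -> (forall x, 0 <= f x)%E ->
  (\int[lebesgue_tuple k.+1]_x f x =
   \int[leb]_a \int[lebesgue_tuple k]_t f [tuple of (a : R) :: t])%E.
Proof.
move=> mf f0.
have mc : measurable_fun [set: R * k.-tuple R]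
    (fun z : R * k.-tuple R => [tuple of z.1 :: z.2]).
  exact: measurable_cons measurable_fst measurable_snd.
transitivity (\int[(leb \x @lebesgue_tuple R k)%E]_z
    f [tuple of (z.1 : R) :: z.2])%E; last first.
  by rewrite fubini_tonelli1//; exact: measurableT_comp.
pose nu := measure_function_pushforward__canonical__measure_function_Measure
  (leb \x @lebesgue_tuple R k)%E mc.
transitivity (\int[nu]_x f x)%E; first exact: eq_measure_integral.
by rewrite /nu /= ge0_integral_pushforward.
Qed.

Lemma measurable_restrict_EFin d (T : measurableType d) (S : set T) (f : T -> R) :
  measurable S -> measurable_fun [set: T] f ->
  measurable_fun [set: T] ((fun z => (f z)%:E) \_ S).
Proof.
move=> mS mf; apply/(measurable_restrictT _ _).1 => //.
exact/measurable_EFinP/measurable_funTS.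
Qed.

Definition affine n (al : R) (v x : n.-tuple R) : n.-tuple R :=
  [tuple al * tnth x i + tnth v i | i < n].

Lemma measurable_affine n al (v : n.-tuple R) :
  measurable_fun [set: n.-tuple R] (affine al v).
Proof.
apply/measurable_fun_tnthP => i.
apply: (eq_measurable_fun (fun x : n.-tuple R => al * tnth x i + tnth v i)).
  by move=> x _ /=; rewrite tnth_mktuple.
apply: measurable_funD => //; apply: measurable_funM => //.
exact: measurable_tnth.
Qed.

Lemma integral_affine n (al : R) (v : n.-tuple R) (f : n.-tuple R -> \bar R) :
  0 < al -> measurable_fun [set: n.-tuple R] f -> (forall x, 0 <= f x)%E ->
  ((al ^+ n)%:E * \int[lebesgue_tuple n]_x f (affine al v x) =
   \int[lebesgue_tuple n]_x f x)%E.
Proof.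
move=> al0; elim: n v f => [|n IH] v f mf f0.
  by rewrite mul1e; apply: eq_integral => x _;
    rewrite [affine _ _ _]tuple0 [x in RHS]tuple0.
have mF : measurable_fun [set: R * n.-tuple R]
    (fun z : R * n.-tuple R => f [tuple of z.1 :: z.2]).
  apply: measurableT_comp => //.
  exact: measurable_cons measurable_fst measurable_snd.
have mcons (a : R) : measurable_fun [set: n.-tuple R]
    (fun t : n.-tuple R => [tuple of a :: t]) by exact: measurable_cons.
rewrite ge0_integral_cons//; last first.
  by apply: measurableT_comp => //; exact: measurable_affine.
rewrite [RHS]ge0_integral_cons//.
pose v' : n.-tuple R := [tuple of behead v].
have E (a : R) (t : n.-tuple R) : affine al v [tuple of a :: t] =
    [tuple of al * a + thead v :: affine al v' t].
  apply: eq_from_tnth => i; rewrite tnth_mktuple.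
  case: (unliftP ord0 i) => [j|] ->; last by [].
  rewrite !tnthS tnth_mktuple; congr (_ + _).
  rewrite tnth_behead; congr (tnth v _); apply/val_inj.
  by rewrite /= inordK// ltnS; exact: ltn_ord.
under eq_integral do under eq_integral do rewrite E.
have mG : measurable_fun [set: R]
    (fun a : R => \int[lebesgue_tuple n]_t f [tuple of a :: t])%E.
  by apply: (measurable_fun_fubini_tonelli_F (m2 := @lebesgue_tuple R n) _ mF).
rewrite -[RHS](integral_affine1 (thead v) al0 mG); last first.
  by move=> a; exact: integral_ge0.
rewrite exprS EFinM -muleA; congr (_ * _)%E.
rewrite -ge0_integralZl_EFin//.
- apply: eq_integral => a _.
  apply: (IH v' (fun t => f [tuple of al * (a : R) + thead v :: t])) => //.
  exact: measurableT_comp.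
- by move=> a _; exact: integral_ge0.
- apply: (measurable_fun_fubini_tonelli_F (m2 := @lebesgue_tuple R n)
    (fun z : R * n.-tuple R =>
       f [tuple of al * z.1 + thead v :: affine al v' z.2])) => //.
  apply: measurableT_comp => //.
  apply: measurable_cons.
    by apply: measurable_funD => //; exact: measurable_funM.
  by apply: measurableT_comp => //; exact: measurable_affine.
- by rewrite exprn_ge0// ltW.
Qed.

Section product.
Variables n m : nat.
Notation X := (n.-tuple R * m.-tuple R)%type.
Notation lam := (@lebesgue_tuple R n \x @lebesgue_tuple R m)%E.

Definition affine2 (al be : R) (w z : X) : X :=
  (affine al w.1 z.1, affine be w.2 z.2).

Lemma measurable_affine2 al be w : measurable_fun [set: X] (affine2 al be w).
Proof.
apply: measurable_fun_pair; apply: measurableT_comp => //; exact: measurable_affine.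
Qed.

Lemma integral_affine2 al be w (f : X -> \bar R) : 0 < al -> 0 < be ->
  measurable_fun [set: X] f -> (forall x, 0 <= f x)%E ->
  ((al ^+ n * be ^+ m)%:E * \int[lam]_z f (affine2 al be w z) =
   \int[lam]_z f z)%E.
Proof.
move=> al0 be0 mf f0.
have mfg : measurable_fun [set: X] (fun z => f (affine2 al be w z)).
  by apply: measurableT_comp => //; exact: measurable_affine2.
have mF : measurable_fun [set: n.-tuple R]
    (fun x => \int[lebesgue_tuple m]_y f (x, y))%E.
  by apply: (measurable_fun_fubini_tonelli_F (m2 := @lebesgue_tuple R m) _ mf).
rewrite !fubini_tonelli1//.
rewrite -[RHS](integral_affine w.1 al0 mF); last by move=> x; exact: integral_ge0.
rewrite EFinM -muleA; congr (_ * _)%E.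
rewrite -ge0_integralZl_EFin//.
- apply: eq_integral => x _.
  apply: (integral_affine w.2 be0 (f := fun y => f (affine al w.1 x, y))) => //.
  exact: measurableT_comp.
- by move=> x _; exact: integral_ge0.
- by apply: (measurable_fun_fubini_tonelli_F (m2 := @lebesgue_tuple R m) _ mfg).
- by rewrite exprn_ge0// ltW.
Qed.

(** The comparisons of masses below all have this form: an affine map sends P
    into Q, and f is bounded by g at the image point, up to the Jacobian. *)
Lemma integral_transport al be w c (P Q : set X) (f g : X -> R) :
  0 < al -> 0 < be -> 0 <= c -> measurable P -> measurable Q ->
  measurable_fun [set: X] f -> measurable_fun [set: X] g ->
  (forall z, 0 <= f z) -> (forall z, 0 <= g z) ->
  (forall z, P z -> Q (affine2 al be w z) /\
     al ^- n * be ^- m * f z <= c * g (affine2 al be w z)) ->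
  (\int[lam]_(z in P) (f z)%:E <= c%:E * \int[lam]_(z in Q) (g z)%:E)%E.
Proof.
move=> al0 be0 c0 mP mQ mf mg f0 g0 H.
have J0 : 0 < al ^+ n * be ^+ m by rewrite mulr_gt0// exprn_gt0.
have h0 z : (0 <= ((fun z => (g z)%:E) \_ Q) z)%E.
  by rewrite erestrict_ge0// => z' _; rewrite lee_fin.
have mh : measurable_fun [set: X] ((fun z => (g z)%:E) \_ Q).
  exact: measurable_restrict_EFin.
rewrite [X in (_ <= _ * X)%E]integral_mkcond.
rewrite -(integral_affine2 w al0 be0)//.
rewrite muleA -EFinM.
have mhg : measurable_fun [set: X] (fun z => (patch (fun=> 0) Q (fun z => (g z)%:E)
    (affine2 al be w z))%E).
  by apply: measurableT_comp => //; exact: measurable_affine2.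
rewrite -ge0_integralZl_EFin//; last by rewrite mulr_ge0// ltW.
rewrite [leLHS]integral_mkcond. apply: ge0_le_integral => //.
- by move=> z _; rewrite erestrict_ge0// => z' _; rewrite lee_fin.
- exact: measurable_restrict_EFin.
- by apply: emeasurable_funM => //; exact: measurable_cst.
move=> z _; rewrite {1}/patch; case: ifPn => [|_]; last first.
  by rewrite mule_ge0// lee_fin mulr_ge0// ltW.
rewrite inE => /H[Qz le]; rewrite patchE mem_set// -EFinM lee_fin.
rewrite mulrAC -ler_pdivrMr//.
apply: le_trans le; rewrite mulrC ler_wpM2r//.
by rewrite invfM.
Qed.

End product.
End affine.

(** * Increments of absolutely continuous functions *)

Section absolutely_continuous_increments.
Context {R : realType}.
Notation leb := (@lebesgue_measure R).

(** Increments are taken on either side of s so that they add up across s. *)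
Definition slope_le (phi : R -> R) (eta s : R) := exists2 d, 0 < d &
  forall z, `|z - s| < d -> (s <= z -> phi z - phi s <= eta * (z - s)) /\
                            (z <= s -> phi s - phi z <= eta * (s - z)).

Lemma is_derive_slope_le (phi : R -> R) (x a eta : R) :
  is_derive x 1 phi a -> a < eta -> slope_le phi eta x.
Proof.
move=> /is_derive1_caratheodory[g [gE gc gx]] aeta.
have : \forall z \near x, g z < eta.
  have gc' : g z @[z --> x] --> g x by exact: gc.
  by apply: (cvgr_lt _ gc'); rewrite gx.
move=> [d d0 /= H]; exists d => // z zx.
have gz : g z < eta by apply: H => /=; rewrite distrC.
split => h.
  by rewrite gE ler_wpM2r ?subr_ge0// ltW.
rewrite -opprB gE -[x - z]opprB mulrN lerN2 ler_wnM2r ?subr_le0//; exact: ltW.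
Qed.

(** The supremum of the points of S in [0, b] is in S, and could be passed if it
    were less than b. *)
Lemma interval_induction (S : set R) (b : R) : 0 <= b -> S 0 ->
  (forall c, 0 <= c <= b -> exists2 d, 0 < d & forall s r, S s -> 0 <= s ->
     c - d < s -> s <= c -> c <= r -> r < c + d -> r <= b -> S r) -> S b.
Proof.
move=> b0 S0 H; pose E := S `&` `[0, b].
have E0 : E !=set0 by exists 0; split => //=; rewrite in_itv/= lexx.
have Eb : ubound E b by move=> x [_ /=]; rewrite in_itv/= => /andP[].
have hb : has_ubound E by exists b.
have Es : has_sup E by split => //; exists b.
have cb : sup E <= b by exact: ge_sup.
have c0 : 0 <= sup E.
  by apply: (ub_le_sup hb); split => //=; rewrite in_itv/= lexx.
have [d d0 {}H] := H (sup E) (introT andP (conj c0 cb)).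
have [s [Ss /=]] := sup_adherent d0 Es; rewrite in_itv/= => /andP[s0 sb] sd.
have sc : s <= sup E.
  by apply: (ub_le_sup hb); split => //=; rewrite in_itv/= s0.
pose r := Num.min b (sup E + d / 2).
have cr : sup E <= r by rewrite le_min cb /= lerDl divr_ge0// ltW.
have Sr : S r.
  apply: (H s) => //; last by rewrite ge_min lexx.
  by rewrite gt_min ltrD2l; apply/orP; right; lra.
have : r <= sup E.
  apply: (ub_le_sup hb); split => //=; rewrite in_itv/= (le_trans c0 cr)/=.
  by rewrite ge_min lexx.
rewrite /r ge_min => /orP[bc|]; last lra.
have Eq : r = b by apply/le_anti; rewrite ge_min lexx/= (le_trans bc).
by rewrite -Eq.
Qed.

(** The variation of f on the exceptional set U; absolute continuity makes it
    small when U has small measure. *)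
Definition variation_in (U : set R) (f : R -> R) (s V : R) :=
  exists k (u v : 'I_k -> R),
    [/\ forall i, [/\ 0 <= u i, u i <= v i, v i <= s & `]u i, v i[ `<=` U],
        trivIset [set: 'I_k] (fun i => `]u i, v i[%classic) &
        V <= \sum_(i < k) `|f (v i) - f (u i)| ].

Lemma variation_in0 U f s : variation_in U f s 0.
Proof.
by exists 0%N, (fun=> 0), (fun=> 0); split; [case|case|rewrite big_ord0].
Qed.

Lemma variation_inS U f s V r : variation_in U f s V -> 0 <= s -> s <= r ->
  `]s, r[ `<=` U -> variation_in U f r (V + `|f r - f s|).
Proof.
move=> [k [u [v [H tr le]]]] s0 sr Usr.
pose ext (w : 'I_k -> R) (a : R) (i : 'I_k.+1) :=
  oapp w a (insub (i : nat) : option 'I_k).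
have extl w a (j : 'I_k) : ext w a (widen_ord (leqnSn k) j) = w j.
  by rewrite /ext /= valK.
have extr w a : ext w a ord_max = a by rewrite /ext /= insubF// ltnn.
have ord_case (i : 'I_k.+1) :
    (exists j, i = widen_ord (leqnSn k) j) \/ i = ord_max.
  have [ik|ik] := ltnP i k; first by left; exists (Ordinal ik); apply/val_inj.
  by right; apply/val_inj/eqP; rewrite eqn_leq ik -ltnS ltn_ord.
exists k.+1, (ext u s), (ext v r); split.
- move=> i; have [[j ->]| ->] := ord_case i; last by rewrite !extr.
  by rewrite !extl; have [? ? vs ?] := H j; split => //; exact: le_trans vs sr.
- move=> i j _ _.
  have sep l : `]u l, v l[ `&` `]s, r[ !=set0 -> False.
    have [_ _ vs _] := H l.
    by move=> [z []] /=; rewrite !in_itv/= => /andP[_ zv] /andP[sz _]; lra.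
  have [[i' ->]| ->] := ord_case i; have [[j' ->]| ->] := ord_case j;
    rewrite ?extl ?extr.
  + by move=> /tr -> //.
  + by move=> /sep.
  + by rewrite setIC => /sep.
  + by [].
- rewrite big_ord_recr /= !extr lerD2r; apply: le_trans le _.
  by under [leRHS]eq_bigr do rewrite !extl.
Qed.

Lemma variation_in_lt U f s V e d : open U -> variation_in U f s V -> s <= 1 ->
  (forall (k : nat) (u v : 'I_k -> R),
      (forall i, 0 <= u i /\ u i <= v i /\ v i <= 1) ->
      trivIset [set: 'I_k] (fun i => `]u i, v i[%classic) ->
      \sum_(i < k) (v i - u i) < d ->
      \sum_(i < k) `|f (v i) - f (u i)| < e) ->
   (leb U < d%:E)%E -> V < e.
Proof.
move=> oU [k [u [v [H tr le]]]] s1 ac Ud.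
apply: le_lt_trans le _; apply: ac => //.
  by move=> i; have [? ? vs _] := H i; do 2 split => //; exact: le_trans vs s1.
rewrite -lte_fin; apply: le_lt_trans Ud.
have mB : measurable (\big[setU/set0]_(i < k) `]u i, v i[%classic).
  by apply: bigsetU_measurable => i _; exact: measurable_itv.
have -> : ((\sum_(i < k) (v i - u i))%:E =
    leb (\big[setU/set0]_(i < k) `]u i, v i[%classic))%E.
  rewrite measure_semi_additive_ord//.
  rewrite -sumEFin; apply: eq_bigr => i _.
  have [_ uv _ _] := H i.
  transitivity (leb `]u i, v i[%classic); last by [].
  rewrite lebesgue_measure_itv/= lte_fin; case: ltP => // vu.
  by have -> : v i = u i by [apply/le_anti; rewrite uv vu]; rewrite subrr.
apply: le_measure; rewrite ?inE//; first exact: open_measurable.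
elim/big_ind: _ => [|A B AU BU|i _]; first exact: sub0set.
  by rewrite subUset.
by have [_ _ _] := H i.
Qed.

(** Cover the exceptional set N by an open set U so small that f varies by less
    than e/2 on it. Going from 0 to b, the points of N are passed inside U, where
    F only helps as it increases, and the other points with slope e/2. *)
Lemma ac_increment_le_monotone (f F : R -> R) (N : set R) (b : R) :
  absolutely_continuous 0 1 f -> 0 <= b <= 1 ->
  (forall s r, 0 <= s -> s <= r -> r <= 1 -> F s <= F r) ->
  measurable N -> leb N = 0%E ->
  (forall s eta, 0 <= s <= 1 -> ~ N s -> 0 < eta ->
     slope_le (fun x => f x - F x) eta s) ->
  f b - F b <= f 0 - F 0.
Proof.
move=> acf /andP[b0 b1] ndF mN N0 sl; pose phi x := f x - F x.
apply/ler_addgt0Pr => e e0.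
have e20 : 0 < e / 2 by rewrite divr_gt0.
have [d d0 ac] := acf _ e20.
have [U [oU NU Ud]] : exists U : set R, [/\ open U, N `<=` U & (leb U < d%:E)%E].
  have Noo : (leb N < +oo)%E by rewrite N0 ltry.
  have [U [oU NU Ud]] := lebesgue_regularity_outer mN Noo d0.
  exists U; split => //.
  have -> : leb U = leb (U `\` N); last exact: Ud.
  rewrite -[in LHS](setDUK NU) setUC measureU0//.
  by apply: measurableD => //; exact: open_measurable.
pose S s := exists2 V, variation_in U f s V & phi s - phi 0 <= e / 2 * s + V.
(* with the bound on the variation inside U, S b bounds the increment by e *)
suff : S b.
  move=> [V /(variation_in_lt oU)/(_ b1 ac Ud) Ve]; rewrite /phi; nra.
apply: (@interval_induction S) => //.
  by exists 0; [exact: variation_in0|rewrite mulr0 addr0 subrr].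
move=> c /andP[c0 cb].
have [Nc|Nc] := pselect (N c).
  have /(_ oU) : open U -> exists2 d, 0 < d & ball c d `<=` U.
    by rewrite openE => /(_ _ (NU _ Nc)) [r /= r0 h]; exists r.
  move=> [r0 r00 rU]; exists r0 => // s r [V vV le] s0 cs sc cr rc rb.
  exists (V + `|f r - f s|).
    apply: variation_inS => //; first exact: le_trans sc cr.
    move=> z /=; rewrite in_itv/= => /andP[sz zr]; apply: rU.
    by rewrite /ball/= ltr_norml; lra.
  have := ndF s r s0 (le_trans sc cr) (le_trans rb b1).
  have := ler_norm (f r - f s); move: le; rewrite /phi.
  have : s <= r by exact: le_trans sc cr.
  nra.
have [r0 r00 rsl] := sl c _ (introT andP (conj c0 (le_trans cb b1))) Nc e20.
exists r0 => // s r [V vV le] s0 cs sc cr rc rb.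
exists V.
  have [k [u [v [H tr leV]]]] := vV; exists k, u, v; split => // i.
  have [? ? vs ?] := H i; split => //.
  by apply: le_trans vs _; exact: le_trans sc cr.
have [|_ /(_ sc)] := rsl s; first by rewrite ltr_norml; lra.
have [|/(_ cr) + _] := rsl r; first by rewrite ltr_norml; lra.
by move: le; rewrite /phi; nra.
Qed.

(** Take for F the primitive of G: by Lebesgue differentiation its derivative is
    G almost everywhere, so f - F has nonpositive derivative off a null set. *)
Lemma ac_increment_le_integral (f G : R -> R) (b : R) :
  absolutely_continuous 0 1 f -> 0 <= b <= 1 ->
  (forall s, 0 <= G s) -> leb.-integrable `[0, 1] (EFin \o G) ->
  {ae leb, forall s : R, s \in `]0, 1[ ->
     exists2 a, is_derive s 1 f a & a <= G s} ->
  ((f b - f 0)%:E <= \int[leb]_(s in `[0%R, 1%R]) (G s)%:E)%E.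
Proof.
move=> acf /[dup] b01 /andP[b0 b1] G0 iG [N1 [mN1 N10 N1sub]].
pose G1 := G \_ `[0, 1].
have G1ge0 s : 0 <= G1 s by rewrite /G1 patchE; case: ifP.
have iG1 : leb.-integrable setT (EFin \o G1).
  rewrite /G1 -restrict_EFin; apply/integrable_restrict => //=.
  by rewrite setTI.
have [N2 [mN2 N20 N2sub]] := lebesgue_differentiation
  (integrable_locally (measurable_itv `[0, 1]) iG).
pose F x := (\int[leb]_(t in [set` `[0%R, x]]) G1 t)%R.
have iG1s (A : set R) : measurable A -> leb.-integrable A (EFin \o G1).
  by move=> mA; exact: integrableS iG1.
pose N := (N1 `|` N2) `|` ([set 0] `|` [set 1]).
have mN : measurable N by do 2 apply: measurableU => //.
have N0 : leb N = 0%E.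
  rewrite /N measureU0//; first by rewrite measureU0.
  - exact: measurableU.
  - exact: measurableU.
  - by rewrite measureU0//; exact: lebesgue_measure_set1.
have mFS s r : s <= r -> F s <= F r.
  move=> sr; rewrite /F /Rintegral fine_le//.
  - by apply: integrable_fin_num => //; exact: iG1s.
  - by apply: integrable_fin_num => //; exact: iG1s.
  - apply: ge0_subset_integral => //.
    + by case/integrableP: (iG1s _ (measurable_itv `[0, r])).
    + by move=> x _; rewrite lee_fin.
    + by apply: subset_itvl; rewrite bnd_simp.
have := ac_increment_le_monotone acf b01 _ mN N0.
move=> /(_ F (fun s r _ sr _ => mFS s r sr)) H.
have F00 : F 0 = 0.
  by rewrite /F /Rintegral set_itv1 integral_set1.
have Fb : (F b)%:E = (\int[leb]_(t in [set` `[0%R, b]]) (G1 t)%:E)%E.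
  by rewrite /F /Rintegral fineK//; apply: integrable_fin_num => //; exact: iG1s.
have le1 : (\int[leb]_(t in [set` `[0%R, b]]) (G1 t)%:E <=
            \int[leb]_(s in `[0%R, 1%R]) (G s)%:E)%E.
  have -> : (\int[leb]_(s in `[0%R, 1%R]) (G s)%:E =
             \int[leb]_(s in `[0%R, 1%R]) (G1 s)%:E)%E.
    by apply: eq_integral => s sI; rewrite /G1 patchE sI.
  apply: ge0_subset_integral => //.
  - by case/integrableP: (iG1s _ (measurable_itv `[0, 1])).
  - by move=> x _; rewrite lee_fin.
  - by apply: subset_itvl; rewrite bnd_simp.
apply: le_trans le1; rewrite -Fb lee_fin.
suff : f b - F b <= f 0 - F 0 by rewrite F00; lra.
apply: H => s eta /andP[s0 s1] Ns eta0.
have s0' : 0 < s.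
  by rewrite lt_neqAle s0 andbT; apply/eqP => s0'; apply: Ns; right; left.
have s1' : s < 1.
  by rewrite lt_neqAle s1 andbT; apply/eqP => s1'; apply: Ns; right; right.
have sI : s \in `]0, 1[ by rewrite in_itv/= s0'.
have [a fa aG] : exists2 a, is_derive s 1 f a & a <= G s.
  apply: contrapT => h; apply: Ns; left; left; apply: N1sub => /= /(_ sI).
  exact: h.
have lpt : lebesgue_pt G1 s.
  by apply: contrapT => h; apply: Ns; left; right; exact: N2sub.
have [|dF F'] := FTC1_lebesgue_pt s1' (iG1s _ (measurable_itv `[0, 1]))
  _ lpt.
  by rewrite (@lte_fin R).
have isF : is_derive s 1 F (G1 s).
  by rewrite -F' derive1E; exact: derivableP.
have G1s : G1 s = G s.
  by rewrite /G1 patchE mem_set//= in_itv/= s0 s1.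
apply: (is_derive_slope_le (a := a - G s)); last lra.
by rewrite -G1s; exact: is_deriveB.
Qed.

Lemma absolutely_continuousN (a b : R) (f : R -> R) :
  absolutely_continuous a b f -> absolutely_continuous a b (fun x => - f x).
Proof.
move=> acf e /acf[d d0 H]; exists d => // k u v h1 h2 h3.
rewrite (eq_bigr (fun i => `|f (v i) - f (u i)|)); first exact: H.
by move=> i _; rewrite -opprD normrN.
Qed.

Lemma ac_norm_increment_le_integral (f G : R -> R) (b : R) :
  absolutely_continuous 0 1 f -> 0 <= b <= 1 ->
  (forall s, 0 <= G s) -> measurable_fun (`[0, 1] : set R) G ->
  {ae leb, forall s : R, s \in `]0, 1[ ->
     exists2 a, is_derive s 1 f a & `|a| <= G s} ->
  (`|f b - f 0|%:E <= \int[leb]_(s in `[0%R, 1%R]) (G s)%:E)%E.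
Proof.
move=> acf b01 G0 mG ae.
have I0 : (0 <= \int[leb]_(s in `[0%R, 1%R]) (G s)%:E)%E.
  by apply: integral_ge0 => s _; rewrite lee_fin.
have [->|Ioo] := eqVneq (\int[leb]_(s in `[0%R, 1%R]) (G s)%:E)%E +oo%E.
  by rewrite leey.
have iG : leb.-integrable `[0, 1] (EFin \o G).
  apply/integrableP; split; first exact/measurable_EFinP.
  under eq_integral do rewrite /= ger0_norm//.
  by rewrite ltey.
have [h|h] := leP 0 (f b - f 0).
  rewrite ger0_norm//.
  apply: ac_increment_le_integral => //.
  move: ae; apply: filterS; first exact: (ae_filter_ringOfSetsType leb).
  move=> s /[apply] -[a fa aG]; exists a => //.
  exact: le_trans (ler_norm _) aG.
rewrite ltr0_norm//.
have -> : - (f b - f 0) = - f b - - f 0 by ring.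
apply: (@ac_increment_le_integral (fun x => - f x)) => //.
  exact: absolutely_continuousN.
move: ae; apply: filterS; first exact: (ae_filter_ringOfSetsType leb).
  move=> s /[apply] -[a fa aG]; exists (- a).
  exact: is_deriveN.
by apply: le_trans aG; rewrite -normrN ler_norm.
Qed.

End absolutely_continuous_increments.

(** * The euclidean norm *)

Section euclidean_norm.
Context {R : realType}.
Implicit Types n : nat.

Lemma eucl_norm_ge0 n (x : n.-tuple R) : 0 <= eucl_norm x.
Proof. exact: sqrtr_ge0. Qed.

Lemma sqr_eucl_norm n (x : n.-tuple R) :
  eucl_norm x ^+ 2 = \sum_(i < n) tnth x i ^+ 2.
Proof. by rewrite sqr_sqrtr// sumr_ge0// => i _; exact: sqr_ge0. Qed.

Lemma tnth_le_eucl_norm n (x : n.-tuple R) i : `|tnth x i| <= eucl_norm x.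
Proof.
rewrite -(@ler_pXn2r _ 2)// ?nnegrE ?eucl_norm_ge0// sqr_eucl_norm.
rewrite real_normK ?num_real// (bigD1 i)//= lerDl sumr_ge0// => j _.
exact: sqr_ge0.
Qed.

Lemma cauchy_schwarz_tuple n (x v : n.-tuple R) :
  \sum_(i < n) tnth x i * tnth v i <= eucl_norm x * eucl_norm v.
Proof.
have [x0|x0] := eqVneq (eucl_norm x) 0.
  rewrite x0 mul0r big1// => i _.
  by move: (tnth_le_eucl_norm x i); rewrite x0 normr_le0 => /eqP ->; rewrite mul0r.
have [v0|v0] := eqVneq (eucl_norm v) 0.
  rewrite v0 mulr0 big1// => i _.
  by move: (tnth_le_eucl_norm v i); rewrite v0 normr_le0 => /eqP ->; rewrite mulr0.
have xv0 : 0 < eucl_norm x * eucl_norm v.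
  by rewrite mulr_gt0// lt0r ?x0 ?v0 eucl_norm_ge0.
rewrite -(ler_pM2l xv0).
have -> : eucl_norm x * eucl_norm v * (eucl_norm x * eucl_norm v) =
    2^-1 * (eucl_norm v ^+ 2 * \sum_(i < n) tnth x i ^+ 2 +
            eucl_norm x ^+ 2 * \sum_(i < n) tnth v i ^+ 2).
  by rewrite -!sqr_eucl_norm; field.
rewrite !mulr_sumr -big_split/= mulr_sumr; apply: ler_sum => i _.
have := sqr_ge0 (eucl_norm v * tnth x i - eucl_norm x * tnth v i).
by rewrite sqrrB; nra.
Qed.

Lemma eucl_norm_affine1_le n (v x : n.-tuple R) :
  eucl_norm (affine 1 v x) <= eucl_norm x + eucl_norm v.
Proof.
rewrite -(@ler_pXn2r _ 2)// ?nnegrE ?addr_ge0 ?eucl_norm_ge0//.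
rewrite sqrrD !sqr_eucl_norm.
have -> : \sum_(i < n) tnth (affine 1 v x) i ^+ 2 =
    \sum_(i < n) tnth x i ^+ 2 + (\sum_(i < n) tnth x i * tnth v i) *+ 2 +
    \sum_(i < n) tnth v i ^+ 2.
  rewrite -sumrMnl -!big_split/=; apply: eq_bigr => i _.
  by rewrite tnth_mktuple mul1r sqrrD.
by rewrite lerD2r lerD2l lerMn2r/= cauchy_schwarz_tuple.
Qed.

Lemma eucl_norm_le_sup n (x : n.-tuple R) c :
  (forall i, `|tnth x i| <= c) -> eucl_norm x <= n%:R * c.
Proof.
move=> H; have [n0|n0] := posnP n.
  by move: x {H}; rewrite n0 => x; rewrite mul0r /eucl_norm big_ord0 sqrtr0.
have c0 : 0 <= c by exact: le_trans (H (Ordinal n0)).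
rewrite -(@ler_pXn2r _ 2)// ?nnegrE ?mulr_ge0 ?eucl_norm_ge0//.
rewrite sqr_eucl_norm; apply: (@le_trans _ _ (\sum_(i < n) c ^+ 2)).
  apply: ler_sum => i _; rewrite -real_normK ?num_real//.
  by rewrite ler_pXn2r ?nnegrE.
rewrite sumr_const card_ord -[leLHS]mulr_natl exprMn ler_wpM2r ?sqr_ge0//.
by rewrite -natrX ler_nat -{1}(expn1 n) leq_pexp2l.
Qed.

Lemma eucl_norm_ex_coord n (x : n.-tuple R) : (0 < n)%N ->
  exists i, eucl_norm x <= n%:R * `|tnth x i|.
Proof.
move=> n0; have [i _ H] := @arg_maxP _ _ _ (Ordinal n0) xpredT
  (fun i => `|tnth x i|) isT.
by exists i; apply: eucl_norm_le_sup => j; exact: H.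
Qed.

Lemma eucl_norm_near_le n (x x' : n.-tuple R) c :
  (forall i, `|tnth x' i - tnth x i| <= c) ->
  eucl_norm x' <= eucl_norm x + n%:R * c.
Proof.
move=> H; pose v := [tuple tnth x' i - tnth x i | i < n].
have -> : x' = affine 1 v x.
  by apply: eq_from_tnth => i; rewrite !tnth_mktuple mul1r subrKC.
apply: (le_trans (eucl_norm_affine1_le _ _)); rewrite lerD2l.
by apply: eucl_norm_le_sup => i; rewrite tnth_mktuple.
Qed.

Definition zvec n : n.-tuple R := [tuple 0 | _ < n].

Lemma eucl_norm_zvec n : eucl_norm (zvec n) = 0.
Proof.
by rewrite /eucl_norm big1 ?sqrtr0// => i _; rewrite tnth_mktuple expr0n.
Qed.

Definition dvec n (i : 'I_n) (c : R) : n.-tuple R :=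
  [tuple if j == i then c else 0 | j < n].

Lemma eucl_norm_scale n (al : R) (v x : n.-tuple R) : 0 <= al ->
  (forall i, tnth v i = al * tnth x i) ->
  eucl_norm v = al * eucl_norm x.
Proof.
move=> al0 H; apply/eqP; rewrite -(@eqrXn2 _ 2)// ?mulr_ge0 ?eucl_norm_ge0//.
rewrite exprMn !sqr_eucl_norm mulr_sumr; apply/eqP/eq_bigr => i _.
by rewrite H exprMn.
Qed.

Lemma affine_zvec n (al : R) (x : n.-tuple R) i :
  tnth (affine al (zvec n) x) i = al * tnth x i.
Proof. by rewrite !tnth_mktuple addr0. Qed.

Lemma affine1_zvec n (x : n.-tuple R) : affine 1 (zvec n) x = x.
Proof. by apply: eq_from_tnth => i; rewrite affine_zvec mul1r. Qed.

Lemma sqr_eucl_norm_dvec n (i : 'I_n) c (x : n.-tuple R) :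
  eucl_norm (affine 1 (dvec i c) x) ^+ 2 =
  eucl_norm x ^+ 2 + 2 * c * tnth x i + c ^+ 2.
Proof.
rewrite !sqr_eucl_norm (bigD1 i)//= [X in _ = X + _ + _](bigD1 i)//=.
rewrite !tnth_mktuple eqxx mul1r.
rewrite [X in _ + X = _](eq_bigr (fun j => tnth x j ^+ 2)); first by ring.
by move=> j /negbTE ji; rewrite !tnth_mktuple ji addr0 mul1r.
Qed.

Lemma eucl_norm_dvec n (i : 'I_n) c : eucl_norm (dvec i c) = `|c|.
Proof.
rewrite /eucl_norm (bigD1 i)//= big1; last first.
  by move=> j /negbTE ji; rewrite tnth_mktuple ji expr0n.
by rewrite tnth_mktuple eqxx addr0 sqrtr_sqr.
Qed.

End euclidean_norm.

(** * Short moves and short curves *)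

Section carnot_caratheodory.
Context {R : realType}.
Variables (n m : nat) (gamma : R).
Hypothesis gamma0 : 0 <= gamma.
Notation leb := (@lebesgue_measure R).
Notation X := (n.-tuple R * m.-tuple R)%type.

Lemma absolutely_continuous_affine (a b c d : R) :
  absolutely_continuous a b (fun s : R => c + s * d).
Proof.
move=> e e0; exists (e / (`|d| + 1)); first by rewrite divr_gt0// ltr_wpDl.
move=> k u v H _ le.
have d1 : 0 < `|d| + 1 by rewrite ltr_wpDl.
rewrite (eq_bigr (fun i => `|d| * (v i - u i))); last first.
  move=> i _; have [_ [uv _]] := H i.
  have -> : c + v i * d - (c + u i * d) = d * (v i - u i) by ring.
  by rewrite normrM (ger0_norm (_ : 0 <= v i - u i))// subr_ge0.
rewrite -mulr_sumr; move: le; rewrite ltr_pdivlMr// => le.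
apply: le_lt_trans le; rewrite mulrC ler_wpM2l ?lerDl//.
by apply: sumr_ge0 => i _; have [_ [uv _]] := H i; rewrite subr_ge0.
Qed.

Lemma is_derive_affine (c d s : R) : is_derive s 1 (fun r : R => c + r * d) d.
Proof.
apply/is_derive1_caratheodory; exists (fun=> d); split => //.
- by move=> z; ring.
- exact: cvg_cst.
Qed.

Let straight k (x e : k.-tuple R) (s : R) : k.-tuple R :=
  [tuple tnth x i + s * tnth e i | i < k].

Let straight0 k (x e : k.-tuple R) : straight x e 0 = x.
Proof. by apply: eq_from_tnth => i; rewrite tnth_mktuple mul0r addr0. Qed.

Let straight1 k (x e : k.-tuple R) : straight x e 1 = affine 1 e x.
Proof. by apply: eq_from_tnth => i; rewrite !tnth_mktuple !mul1r. Qed.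

(** A straight line is horizontal when the control b produces the constant
    velocity h; this is used with x fixed, and with y fixed. *)
Lemma cc_dist_straight (x e : n.-tuple R) (y h b : m.-tuple R) :
  (forall s, s \in `]0, 1[ -> forall j,
     eucl_norm (straight x e s) `^ gamma * tnth b j = tnth h j) ->
  (cc_dist gamma (x, y) (affine 1 e x, affine 1 h y) <=
   (Num.sqrt (eucl_norm e ^+ 2 + eucl_norm b ^+ 2))%:E)%E.
Proof.
move=> H; apply: ereal_inf_lbound.
exists (straight x e), (straight y h), (fun=> e), (fun=> b); split.
  split.
  - by rewrite !straight0 !straight1.
  - move=> i; rewrite (_ : (fun s => _) = (fun s => tnth x i + s * tnth e i)).
      exact: absolutely_continuous_affine.
    by apply/funext => s; rewrite tnth_mktuple.
  - move=> i; rewrite (_ : (fun s => _) = (fun s => tnth y i + s * tnth h i)).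
      exact: absolutely_continuous_affine.
    by apply/funext => s; rewrite tnth_mktuple.
  - by split; exact: measurable_cst.
  - apply: aeW => s sI; split => i.
      rewrite (_ : (fun r => _) = (fun r => tnth x i + r * tnth e i)).
        exact: is_derive_affine.
      by apply/funext => r; rewrite tnth_mktuple.
    rewrite (_ : (fun r => _) = (fun r => tnth y i + r * tnth h i)).
      by rewrite H//; exact: is_derive_affine.
    by apply/funext => r; rewrite tnth_mktuple.
rewrite /curve_length integral_cst//= lebesgue_measure_itv/= lte_fin ltr01.
by rewrite oppr0 adde0 mule1.
Qed.

Lemma cc_dist_move_x (x e : n.-tuple R) (y : m.-tuple R) :
  (cc_dist gamma (x, y) (affine 1 e x, y) <= (eucl_norm e)%:E)%E.
Proof.
have := @cc_dist_straight x e y (zvec m) (zvec m) _.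
rewrite affine1_zvec => H; apply: le_trans (H _) _.
  by move=> s _ j; rewrite !tnth_mktuple mulr0.
rewrite lee_fin eucl_norm_zvec expr0n addr0.
by rewrite sqrtr_sqr ger0_norm ?eucl_norm_ge0.
Qed.

Lemma cc_dist_move_y (x : n.-tuple R) (y h : m.-tuple R) :
  0 < eucl_norm x ->
  (cc_dist gamma (x, y) (x, affine 1 h y) <=
   (eucl_norm h / eucl_norm x `^ gamma)%:E)%E.
Proof.
move=> x0; have xg : 0 < eucl_norm x `^ gamma by rewrite powR_gt0.
pose b : m.-tuple R := [tuple (eucl_norm x `^ gamma)^-1 * tnth h j | j < m].
have := @cc_dist_straight x (zvec n) y h b.
rewrite affine1_zvec => H; apply: le_trans (H _) _.
  move=> s _ j.
  rewrite (_ : straight _ _ _ = x); last first.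
    by apply: eq_from_tnth => i; rewrite !tnth_mktuple mulr0 addr0.
  by rewrite tnth_mktuple mulVKf// gt_eqF.
rewrite lee_fin eucl_norm_zvec expr0n add0r.
rewrite sqrtr_sqr ger0_norm ?eucl_norm_ge0//.
rewrite (@eucl_norm_scale _ _ (eucl_norm x `^ gamma)^-1 b h).
- by rewrite mulrC.
- by rewrite invr_ge0 ltW.
- by move=> i; rewrite tnth_mktuple.
Qed.

Lemma measurable_sqrtr : measurable_fun [set: R] (@Num.sqrt R).
Proof. by apply: continuous_measurable_fun => x; exact: sqrt_continuous. Qed.

Lemma measurable_eucl_norm k : measurable_fun [set: k.-tuple R] (@eucl_norm R k).
Proof.
rewrite /eucl_norm; apply: measurableT_comp; first exact: measurable_sqrtr.
apply: measurable_sum => i; apply: measurable_funX; exact: measurable_tnth.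
Qed.

(** The speed bounds every coordinate of the controls, so x stays close to its
    starting point, which bounds the factor |x|^gamma in the velocity of y. *)
Lemma horizontal_curve_displacement (g h : X) x y a b (eps : R) :
  horizontal_curve gamma g h x y a b ->
  (curve_length a b < eps%:E)%E ->
  (forall i, `|tnth h.1 i - tnth g.1 i| <= eps) /\
  (forall j, `|tnth h.2 j - tnth g.2 j| <=
      (eucl_norm g.1 + n%:R * eps) `^ gamma * eps).
Proof.
move=> [[g0 h1] acx acy [ma mb] dxy] len.
pose G s := Num.sqrt (eucl_norm (a s) ^+ 2 + eucl_norm (b s) ^+ 2).
have G0 s : 0 <= G s by exact: sqrtr_ge0.
have mG : measurable_fun (`[0, 1] : set R) G.
  apply: measurableT_comp; first exact: measurable_sqrtr.
  by apply: measurable_funD; apply: measurable_funX;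
    apply: measurableT_comp => //; exact: measurable_eucl_norm.
have aG s i : `|tnth (a s) i| <= G s.
  apply: le_trans (tnth_le_eucl_norm _ _) _.
  rewrite -[leLHS]ger0_norm ?eucl_norm_ge0// -sqrtr_sqr ler_wsqrtr//.
  by rewrite lerDl sqr_ge0.
have bG s i : `|tnth (b s) i| <= G s.
  apply: le_trans (tnth_le_eucl_norm _ _) _.
  rewrite -[leLHS]ger0_norm ?eucl_norm_ge0// -sqrtr_sqr ler_wsqrtr//.
  by rewrite lerDr sqr_ge0.
have aef := ae_filter_ringOfSetsType leb.
have dx s i : 0 <= s <= 1 -> `|tnth (x s) i - tnth (x 0) i| <= eps.
  move=> s01; rewrite -lee_fin; apply: le_trans (ltW len).
  apply: (@ac_norm_increment_le_integral _ (fun s => tnth (x s) i)) => //.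
  move: dxy; apply: filterS => r /[apply] -[/(_ i) + _].
  by exists (tnth (a r) i).
have x0g : x 0 = g.1 by rewrite -g0.
have xs s : 0 <= s <= 1 -> eucl_norm (x s) <= eucl_norm g.1 + n%:R * eps.
  by move=> s01; apply: eucl_norm_near_le => i; rewrite -x0g dx.
have x1h : x 1 = h.1 by rewrite -h1.
have y0g : y 0 = g.2 by rewrite -g0.
have y1h : y 1 = h.2 by rewrite -h1.
split => [i|j]; first by rewrite -x1h -x0g dx// lexx ler01.
set c := _ `^ gamma; have c0 : 0 <= c by exact: powR_ge0.
rewrite -y1h -y0g.
have -> : `|tnth (y 1) j - tnth (y 0) j| <= c * eps =
  ((`|tnth (y 1) j - tnth (y 0) j|)%:E <= c%:E * eps%:E)%E
    by rewrite -EFinM lee_fin.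
apply: (@le_trans _ _ (\int[leb]_(s in `[0%R, 1%R]) (c * G s)%:E)%E).
  apply: (@ac_norm_increment_le_integral _ (fun s => tnth (y s) j)) => //.
  - by rewrite lexx ler01.
  - by move=> s; rewrite mulr_ge0.
  - exact: measurable_funM.
  move: dxy; apply: filterS => r + rI => /(_ rI)[_ /(_ j) yj].
  exists (eucl_norm (x r) `^ gamma * tnth (b r) j) => //.
  rewrite normrM ler_pM// ger0_norm ?powR_ge0//.
  rewrite /c ge0_ler_powR ?nnegrE ?eucl_norm_ge0//.
    apply: le_trans (eucl_norm_ge0 (x r)) _; apply: xs.
    by move: rI; rewrite in_itv/= => /andP[/ltW -> /ltW ->].
  apply: xs; by move: rI; rewrite in_itv/= => /andP[/ltW -> /ltW ->].
under eq_integral do rewrite EFinM.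
rewrite ge0_integralZl_EFin//.
- by rewrite lee_wpmul2l ?lee_fin// ltW.
- by move=> s _; rewrite lee_fin.
- exact/measurable_EFinP.
Qed.

Lemma enlargement_displacement (A : set X) (eps : R) (z : X) :
  enlargement (cc_dist gamma) A eps z -> exists w,
  [/\ A w, (forall i, `|tnth w.1 i - tnth z.1 i| <= eps) &
  (forall j, `|tnth w.2 j - tnth z.2 j| <=
      (eucl_norm z.1 + n%:R * eps) `^ gamma * eps)].
Proof.
move=> /ereal_inf_lt[_ [w Aw <-]] /ereal_inf_lt[_ [x [y [a [b [H ->]]]]]] len.
by exists w; have [? ?] := horizontal_curve_displacement H len; split.
Qed.

Lemma enlargement_mem (A : set X) (eps : R) (z w : X) d :
  (cc_dist gamma z w <= d%:E)%E -> d < eps -> A w ->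
  enlargement (cc_dist gamma) A eps z.
Proof.
move=> zw deps Aw; rewrite /enlargement/= /dist_set.
apply: (@le_lt_trans _ _ d%:E); last by rewrite lte_fin.
by apply: le_trans zw; apply: ereal_inf_lbound; exists w.
Qed.

End carnot_caratheodory.

(** * Powers and exponentials *)

Section powers.
Context {R : realType}.
Implicit Types a b q : R.

(** As b^(q-1) <= a^(q-1). *)
Lemma powR_sub_ge a b q : 0 <= b -> b <= a -> 1 <= q ->
  a `^ (q - 1) * (a - b) <= a `^ q - b `^ q.
Proof.
move=> b0 ba q1; have q0 : 0 < q by exact: lt_le_trans q1.
have a0 : 0 <= a by exact: le_trans ba.
rewrite -(mulr_powRB1 a0 q0) -(mulr_powRB1 b0 q0).
suff : b * b `^ (q - 1) <= b * a `^ (q - 1) by lra.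
by rewrite ler_wpM2l// ge0_ler_powR ?nnegrE ?subr_ge0.
Qed.

Lemma bernoulli_le (k : nat) (u : R) : 0 <= u <= 1 ->
  1 - k%:R * u <= (1 - u) ^+ k.
Proof.
move=> /andP[u0 u1]; elim: k => [|k IH]; first by rewrite mul0r subr0 expr0.
rewrite exprS; have : (1 - u) * (1 - k%:R * u) <= (1 - u) * (1 - u) ^+ k.
  by rewrite ler_wpM2l// subr_ge0.
apply: le_trans; rewrite -natr1.
have : 0 <= k%:R * u * u by rewrite !mulr_ge0.
nra.
Qed.

(** For t = b/a and an integer k >= q this is Bernoulli's inequality for t^k,
    which is at most t^q. *)
Lemma powR_sub_le q : 1 <= q -> exists2 k : R, 1 <= k &
  forall a b, 0 <= b -> b <= a -> a `^ q - b `^ q <= k * a `^ (q - 1) * (a - b).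
Proof.
move=> q1; have q0 : 0 < q by exact: lt_le_trans q1.
have [k qk] : exists k : nat, q <= k%:R.
  by exists (Num.bound q); apply/ltW/archi_boundP/ltW.
exists k%:R => [|a b b0 ba]; first exact: le_trans qk.
have [a0|a0] := eqVneq a 0.
  have -> : b = 0 by apply/le_anti; rewrite b0 -a0 ba.
  by rewrite a0 !subrr mulr0.
have {}a0 : 0 < a by rewrite lt_neqAle eq_sym a0 (le_trans b0).
pose t := b / a; have t0 : 0 <= t by rewrite divr_ge0// ltW.
have t1 : t <= 1 by rewrite ler_pdivrMr// mul1r.
have bE : b = a * t by rewrite /t mulrCA divff ?mulr1// gt_eqF.
rewrite -(mulr_powRB1 (ltW a0) q0) {1}bE powRM// ?(ltW a0)//.
rewrite -(mulr_powRB1 (ltW a0) q0).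
suff : 1 - k%:R * (1 - t) <= t `^ q.
  have -> : a - b = a * (1 - t) by rewrite bE; ring.
  have : 0 <= a * a `^ (q - 1) by rewrite mulr_ge0 ?powR_ge0// ltW.
  nra.
apply: (@le_trans _ _ (t ^+ k)).
  have -> : t ^+ k = (1 - (1 - t)) ^+ k by congr (_ ^+ _); ring.
  by apply: bernoulli_le; rewrite subr_ge0 t1 /= lerBlDr lerDl.
rewrite -powR_mulrn//; have [->|tn0] := eqVneq t 0.
  rewrite !powR0 ?lexx ?gt_eqF//; exact: lt_le_trans qk.
apply: ger_powR => //; by rewrite t1 lt_neqAle eq_sym tn0 t0.
Qed.

Lemma expR_eventually_le b c eta : 0 < b -> 0 < eta ->
  exists2 M0, 1 <= M0 & forall M, M0 <= M -> c * expR (- (b * M)) <= eta.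
Proof.
move=> b0 eta0; exists (Num.max 1 (`|c| / (eta * b))); first by rewrite le_max lexx.
move=> M; rewrite ge_max => /andP[M1 McM].
have M0 : 0 < M by exact: lt_le_trans M1.
rewrite expRN ler_pdivrMr ?expR_gt0//.
have bM : 0 < b * M by rewrite mulr_gt0.
have : eta * (b * M) <= eta * expR (b * M).
  rewrite ler_pM2l//; apply: le_trans (expR_ge1Dx _); lra.
apply: le_trans; apply: le_trans (ler_norm c) _.
by rewrite mulrA mulrC -ler_pdivrMr ?mulr_gt0.
Qed.

End powers.

(** * The gauge *)

Section gauge.
Context {R : realType}.
Variables (n m : nat) (gamma : R).
Hypothesis gamma0 : 0 <= gamma.
Notation X := (n.-tuple R * m.-tuple R)%type.
Notation lam := (@lebesgue_tuple R n \x @lebesgue_tuple R m)%E.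

Definition xpart (z : X) : R := eucl_norm z.1 `^ (1 + gamma).
Definition ypart (z : X) : R := (1 + gamma) * eucl_norm z.2.
(** This is N^(1+gamma), N being the gauge of the Grushin space; it is
    comparable to X + Y. *)
Definition gaugeM (z : X) : R := Num.sqrt (xpart z ^+ 2 + ypart z ^+ 2).

Let g1_gt0 : 0 < 1 + gamma. Proof. by rewrite ltr_pwDl. Qed.

Lemma xpart_ge0 z : 0 <= xpart z. Proof. exact: powR_ge0. Qed.

Lemma ypart_ge0 z : 0 <= ypart z.
Proof. by rewrite mulr_ge0 ?eucl_norm_ge0// ltW. Qed.

Lemma gaugeM_ge0 z : 0 <= gaugeM z. Proof. exact: sqrtr_ge0. Qed.

Lemma sqr_gaugeM z : gaugeM z ^+ 2 = xpart z ^+ 2 + ypart z ^+ 2.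
Proof. by rewrite sqr_sqrtr// addr_ge0// sqr_ge0. Qed.

Lemma xpart_le z : xpart z <= gaugeM z.
Proof.
rewrite -(@ler_pXn2r _ 2)// ?nnegrE ?gaugeM_ge0 ?xpart_ge0// sqr_gaugeM.
by rewrite lerDl sqr_ge0.
Qed.

Lemma ypart_le z : ypart z <= gaugeM z.
Proof.
rewrite -(@ler_pXn2r _ 2)// ?nnegrE ?gaugeM_ge0 ?ypart_ge0// sqr_gaugeM.
by rewrite lerDr sqr_ge0.
Qed.

Lemma gaugeM_le z : gaugeM z <= xpart z + ypart z.
Proof.
have [x0 y0] := (xpart_ge0 z, ypart_ge0 z).
rewrite -(@ler_pXn2r _ 2)// ?nnegrE ?gaugeM_ge0 ?addr_ge0// sqr_gaugeM.
nra.
Qed.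

Lemma gaugeM_le_of c z : 0 <= c -> xpart z ^+ 2 + ypart z ^+ 2 <= c ^+ 2 ->
  gaugeM z <= c.
Proof.
by move=> c0 H; rewrite -(@ler_pXn2r _ 2)// ?nnegrE ?gaugeM_ge0// sqr_gaugeM.
Qed.

Lemma grushin_densityE (p : R) z :
  grushin_density gamma p z = expR (- (gaugeM z `^ (p / (1 + gamma)))).
Proof.
rewrite /grushin_density /grushin_gauge; congr (expR (- _)).
have -> : (1 + gamma) ^+ 2 * eucl_norm z.2 ^+ 2 = ypart z ^+ 2 by rewrite -exprMn.
have -> : eucl_norm z.1 `^ (2 * (1 + gamma)) = xpart z ^+ 2.
  by rewrite mulrC powRrM -powR_mulrn ?powR_ge0.
rewrite -powRrM.
have -> : (2 * (1 + gamma))^-1 * p = 2^-1 * (p / (1 + gamma)).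
  by rewrite invfM -mulrA (mulrC p).
by rewrite [LHS]powRrM powR12_sqrt// addr_ge0// sqr_ge0.
Qed.

Lemma measurable_xpart : measurable_fun [set: X] xpart.
Proof.
apply: (measurableT_comp (measurable_powR _)).
by apply: measurableT_comp => //; exact: measurable_eucl_norm.
Qed.

Lemma measurable_ypart : measurable_fun [set: X] ypart.
Proof.
apply: measurable_funM => //.
by apply: measurableT_comp => //; exact: measurable_eucl_norm.
Qed.

Lemma measurable_gaugeM : measurable_fun [set: X] gaugeM.
Proof.
apply: measurableT_comp; first exact: measurable_sqrtr.
apply: measurable_funD; apply: measurable_funX.
  exact: measurable_xpart.
exact: measurable_ypart.
Qed.

Lemma measurable_le_set d (T : measurableType d) (f g : T -> R) :
  measurable_fun [set: T] f -> measurable_fun [set: T] g ->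
  measurable [set z | f z <= g z].
Proof.
by move=> mf mg; rewrite -[X in measurable X]setTI; exact: measurable_fun_le.
Qed.

Definition box (I : 'I_n -> set R) (J : 'I_m -> set R) : set X :=
  [set z | (forall i, I i (tnth z.1 i)) /\ (forall j, J j (tnth z.2 j))].

Lemma measurable_tuple_box k (I : 'I_k -> set R) : (forall i, measurable (I i)) ->
  measurable [set x : k.-tuple R | forall i, I i (tnth x i)].
Proof.
move=> mI; have -> : [set x : k.-tuple R | forall i, I i (tnth x i)] =
    \bigcap_(i in [set: 'I_k]) (fun x : k.-tuple R => tnth x i) @^-1` I i.
  by apply/seteqP; split=> x /= h i; [move=> _; exact: h|exact: (h i Logic.I)].
apply: fin_bigcap_measurable => // i _; rewrite -[X in measurable X]setTI.
by apply: measurable_tnth => //; exact: mI.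
Qed.

Lemma boxE I J : box I J = [set x | forall i, I i (tnth x i)] `*`
   [set y | forall j, J j (tnth y j)].
Proof. by []. Qed.

Lemma measurable_box I J : (forall i, measurable (I i)) ->
  (forall j, measurable (J j)) -> measurable (box I J).
Proof. by move=> mI mJ; rewrite boxE; apply: measurableX;
  exact: measurable_tuple_box. Qed.

Lemma lebesgue_box I J : (forall i, measurable (I i)) ->
  (forall j, measurable (J j)) ->
  lam (box I J) = ((\prod_(i < n) lebesgue_measure (I i)) *
                   (\prod_(j < m) lebesgue_measure (J j)))%E.
Proof.
move=> mI mJ; have mI' := measurable_tuple_box mI.
have mJ' := measurable_tuple_box mJ.
by rewrite boxE product_measure1E//; congr (_ * _)%E; exact: lebesgue_tuple_box.
Qed.

Lemma prod_EFin k (c : 'I_k -> R) (f : 'I_k -> \bar R) :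
  (forall i, f i = (c i)%:E) -> (\prod_(i < k) f i)%E = (\prod_(i < k) c i)%:E.
Proof.
move=> H; rewrite (eq_bigr (fun i => (c i)%:E)); last by move=> i _; rewrite H.
by rewrite -prodEFin.
Qed.

Lemma eucl_norm_le_xpart z : eucl_norm z.1 <= 1 + xpart z.
Proof.
have [h|h] := leP (eucl_norm z.1) 1;
  first by rewrite (le_trans h)// lerDl xpart_ge0.
have := @le1r_powR _ (eucl_norm z.1) (1 + gamma) (ltW h).
by rewrite lerDl => /(_ gamma0); rewrite -/(xpart z); lra.
Qed.

Lemma lebesgue_sublevel_fin c : (lam [set z | (gaugeM z <= c)%R] < +oo)%E.
Proof.
pose r := 1 + `|c|.
have r0 : 0 <= r by rewrite addr_ge0.
pose I : set R := [set` `[- r, r]].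
have mI : measurable I by exact: measurable_itv.
apply: (@le_lt_trans _ _ (lam (box (fun=> I) (fun=> I)))).
  apply: le_measure; rewrite ?inE.
  - by apply: measurable_le_set; [exact: measurable_gaugeM|exact: measurable_cst].
  - exact: measurable_box.
  move=> z /= zc.
  have := xpart_le z; have := ypart_le z; have := ler_norm c => h1 h2 h3.
  have xr : eucl_norm z.1 <= r.
    by have := eucl_norm_le_xpart z; rewrite /r; lra.
  have yr : eucl_norm z.2 <= r.
    have : eucl_norm z.2 <= ypart z.
      by rewrite ler_peMl ?eucl_norm_ge0// lerDl.
    rewrite /r; lra.
  split=> i; rewrite /I /= in_itv/= -ler_norml;
    by apply: le_trans (tnth_le_eucl_norm _ _) _.
rewrite lebesgue_box//.
have E : lebesgue_measure I = (r + r)%:E.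
  rewrite lebesgue_measure_itv/= lte_fin; case: ltP => h.
    by rewrite -EFinB opprK.
  have -> : r = 0 by lra.
  by rewrite addr0.
rewrite !(prod_EFin (c := fun=> r + r))//.
by rewrite -EFinM ltry.
Qed.

End gauge.

(** The integral of a nonnegative function, measurable or not, is the supremum
    of the integrals of the simple functions below it. It is applied to
    enlargements, which are not shown to be measurable. *)
Lemma le_integral_incl {R : realType} d (T : measurableType d)
    (mu : {measure set T -> \bar R}) (f g : T -> R) (S S' : set T) :
  (forall z, 0 <= f z) -> (forall z, 0 <= g z) -> S `<=` S' ->
  (forall z, S z -> f z <= g z) ->
  (\int[mu]_(z in S) (f z)%:E <= \int[mu]_(z in S') (g z)%:E)%E.
Proof.
move=> f0 g0 SS' fg; rewrite integral_mkcond [leRHS]integral_mkcond.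
rewrite !ge0_integralTE; last 2 first.
- by move=> z; rewrite erestrict_ge0// => z' _; rewrite lee_fin.
- by move=> z; rewrite erestrict_ge0// => z' _; rewrite lee_fin.
apply: le_ereal_sup => _ [h hle <-]; exists h => // z.
apply: le_trans (hle z) _; rewrite !patchE.
case: ifPn => [|_]; last by case: ifPn => // _; rewrite lee_fin.
by rewrite inE => Sz; rewrite mem_set ?lee_fin ?fg//; exact: SS'.
Qed.

Section weights.
Local Open Scope ereal_scope.
Context {R : realType} d (T : measurableType d).
Variables (mu : {measure set T -> \bar R}) (f : T -> R).
Hypotheses (mf : measurable_fun [set: T] f) (f0 : forall z, (0 <= f z)%R).

Let w (S : set T) := \int[mu]_(z in S) (f z)%:E.

Let mfE (S : set T) : measurable_fun S (fun z => (f z)%:E).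
Proof. exact/measurable_EFinP/measurable_funTS. Qed.

Lemma weight_ge0 S : 0 <= w S.
Proof. by apply: integral_ge0 => z _; rewrite lee_fin. Qed.

Lemma le_weight S S' : S `<=` S' -> w S <= w S'.
Proof. by move=> SS'; exact: le_integral_incl. Qed.

Lemma weightZ S c : measurable S -> (0 <= c)%R ->
  c%:E * w S = \int[mu]_(z in S) (c * f z)%:E.
Proof.
by move=> mS c0; rewrite /w -ge0_integralZl_EFin// => z _; rewrite lee_fin.
Qed.

Lemma weightU S S' : measurable S -> measurable S' -> S `&` S' = set0 ->
  w (S `|` S') = w S + w S'.
Proof.
move=> mS mS' SS'; rewrite /w ge0_integral_setU//.
- by move=> z _; rewrite lee_fin.
- by rewrite disj_set2E; apply/eqP.
Qed.

Lemma weight_split S B : measurable S -> measurable B ->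
  w S = w (S `&` B) + w (S `\` B).
Proof.
move=> mS mB; rewrite -weightU.
- by rewrite setUIDK.
- exact: measurableI.
- exact: measurableD.
- by apply/seteqP; split => z // [[_ Bz] [_ /(_ Bz)]].
Qed.

Lemma weight_leU S S' : measurable S -> measurable S' ->
  w (S `|` S') <= w S + w S'.
Proof.
move=> mS mS'; rewrite (@weight_split (S `|` S') S)//; last exact: measurableU.
apply: leeD; apply: le_weight; first by move=> z [].
by move=> z [[]].
Qed.

Lemma weight_cover (I : finType) S (P : I -> set T) : measurable S ->
  (forall i, measurable (P i)) -> (forall z, S z -> exists i, P i z) ->
  w S <= \sum_(i : I) w (S `&` P i).
Proof.
move=> mS mP cov.
apply: (@le_trans _ _ (w (\big[setU/set0]_(i : I) (S `&` P i)))).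
  by apply: le_weight => z Sz; have [i Pi] := cov _ Sz;
    rewrite (bigD1 i)//=; left.
have [_ //] : measurable (\big[setU/set0]_(i : I) (S `&` P i)) /\
  w (\big[setU/set0]_(i : I) (S `&` P i)) <= \sum_(i : I) w (S `&` P i).
elim/big_ind2 : _ => [|A x B y [mA Ax] [mB By]|i _].
- by split => //; rewrite /w integral_set0.
- split; first exact: measurableU.
  by apply: le_trans (weight_leU mA mB) _; exact: leeD.
- by split => //; exact: measurableI.
Qed.

Lemma weight_le_bound S c : measurable S -> (0 <= c)%R ->
  (forall z, S z -> (f z <= c)%R) -> w S <= c%:E * mu S.
Proof.
move=> mS c0 H; rewrite -(integral_cst mu mS c%:E).
by apply: ge0_le_integral => // z Sz; rewrite lee_fin ?f0 ?H.
Qed.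

Lemma weight_ge_bound S c : measurable S -> (0 <= c)%R ->
  (forall z, S z -> (c <= f z)%R) -> c%:E * mu S <= w S.
Proof.
move=> mS c0 H; rewrite -(integral_cst mu mS c%:E).
by apply: ge0_le_integral => // z Sz; rewrite lee_fin ?f0 ?H.
Qed.

End weights.

(** * Integrability of the density *)

Section integrability.
Context {R : realType}.
Variables (n m : nat) (gamma q : R).
Hypotheses (gamma0 : 0 <= gamma) (q1 : 1 <= q).
Notation X := (n.-tuple R * m.-tuple R)%type.
Notation lam := (@lebesgue_tuple R n \x @lebesgue_tuple R m)%E.
Notation M := (@gaugeM R n m gamma).

Let g1_gt0 : 0 < 1 + gamma. Proof. by rewrite ltr_pwDl. Qed.

Definition decay (beta b : R) (z : X) : R :=
  (1 + M z) `^ beta * expR (- (b * M z `^ q)).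

Lemma decay_ge0 beta b z : 0 <= decay beta b z.
Proof. by rewrite mulr_ge0 ?powR_ge0 ?expR_ge0. Qed.

Lemma measurable_decay beta b : measurable_fun [set: X] (decay beta b).
Proof.
apply: measurable_funM.
  apply: (measurableT_comp (measurable_powR _)).
  by apply: measurable_funD => //; exact: measurable_gaugeM.
apply: (measurableT_comp (@measurable_expR R)).
apply: measurable_funN; apply: measurable_funM => //.
by apply: (measurableT_comp (measurable_powR _)); exact: measurable_gaugeM.
Qed.

Let zz : X := (zvec n, zvec m).
Let half (z : X) := affine2 2^-1 2^-1 zz z.

Lemma xpart_dilate al be (z : X) : 0 <= al ->
  xpart gamma (affine2 al be zz z) = al `^ (1 + gamma) * xpart gamma z.
Proof.
move=> al0; rewrite /xpart /= (@eucl_norm_scale _ _ al _ z.1)//.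
  by rewrite powRM ?eucl_norm_ge0.
by move=> i; rewrite affine_zvec.
Qed.

Lemma ypart_dilate al be (z : X) : 0 <= be ->
  ypart gamma (affine2 al be zz z) = be * ypart gamma z.
Proof.
move=> be0; rewrite /ypart /= (@eucl_norm_scale _ _ be _ z.2)//.
  by rewrite mulrCA.
by move=> i; rewrite affine_zvec.
Qed.

Let c2 : R := 2 `^ (1 + gamma).

Let c2_ge2 : 2 <= c2.
Proof. by rewrite /c2 le1r_powR// ?lerDl// ler1n. Qed.

Let xpart_half z : xpart gamma (half z) = xpart gamma z / c2.
Proof. by rewrite /half xpart_dilate// ?invr_ge0// mulrC /c2 -powRN
  -powR_inv1// -powRrM mulN1r. Qed.

Let ypart_half z : ypart gamma (half z) = ypart gamma z / 2.
Proof. by rewrite /half ypart_dilate// ?invr_ge0// mulrC. Qed.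

Let gaugeM_half_le z : M (half z) <= M z / 2.
Proof.
apply: gaugeM_le_of => //; first by rewrite divr_ge0// gaugeM_ge0.
have -> : (M z / 2) ^+ 2 = (xpart gamma z ^+ 2 + ypart gamma z ^+ 2) / 2 ^+ 2.
  by rewrite -sqr_gaugeM; field.
rewrite xpart_half ypart_half.
set x := xpart _ _; set y := ypart _ _.
have c20 : 0 < c2 by rewrite (lt_le_trans _ c2_ge2).
have x0 : 0 <= x by exact: xpart_ge0.
have : x / c2 <= x / 2 by rewrite ler_wpM2l// lef_pV2 ?posrE.
have : 0 <= x / c2 by rewrite divr_ge0// ltW.
nra.
Qed.

Let gaugeM_half_ge z : M z <= c2 * M (half z).
Proof.
have c20 : 0 < c2 by rewrite (lt_le_trans _ c2_ge2).
apply: gaugeM_le_of => //; first by rewrite mulr_ge0 ?gaugeM_ge0// ltW.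
have -> : (c2 * M (half z)) ^+ 2 =
    c2 ^+ 2 * (xpart gamma (half z) ^+ 2 + ypart gamma (half z) ^+ 2).
  by rewrite -sqr_gaugeM; ring.
rewrite xpart_half ypart_half.
set x := xpart _ _; set y := ypart _ _.
have -> : c2 ^+ 2 * ((x / c2) ^+ 2 + (y / 2) ^+ 2) = x ^+ 2 + (c2 * (y / 2)) ^+ 2.
  by field; rewrite gt_eqF.
have y0 : 0 <= y by exact: ypart_ge0.
have : y <= c2 * (y / 2).
  have : 0 <= (c2 - 2) * y by rewrite mulr_ge0// subr_ge0.
  lra.
nra.
Qed.

(** M is at least twice as small at z/2, so that the exponential gains a factor
    exp(bM/2), which is larger than any constant once M is large. *)
Let decay_half beta b J : 0 < b -> 0 <= beta -> 0 <= J ->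
  exists2 M0, 1 <= M0 & forall z, M0 < M z ->
    J * decay beta b z <= 2^-1 * decay beta b (half z).
Proof.
move=> b0 beta0 J0.
have b20 : 0 < b / 2 by rewrite divr_gt0.
have h0 : (0 : R) < 2^-1 by rewrite invr_gt0.
have [M0 M01 H] :=
  expR_eventually_le (J * c2 `^ beta) b20 h0.
exists M0; first exact: M01.
move=> z Mz.
have c20 : 1 <= c2 by rewrite (le_trans _ c2_ge2)// ler1n.
have M1 : 1 <= M z by exact: le_trans M01 (ltW Mz).
have e1 : (1 + M z) `^ beta <= c2 `^ beta * (1 + M (half z)) `^ beta.
  have hz0 := gaugeM_ge0 gamma (half z).
  rewrite -powRM ?addr_ge0 ?(le_trans _ c20)// ge0_ler_powR ?nnegrE//.
  - by rewrite addr_ge0// gaugeM_ge0.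
  - by rewrite mulr_ge0 ?addr_ge0 ?(le_trans _ c20).
  - by rewrite mulrDr mulr1 lerD// gaugeM_half_ge.
have e2 : expR (- (b * M z `^ q)) <=
    expR (- (b / 2 * M z)) * expR (- (b * M (half z) `^ q)).
  rewrite -expRD ler_expR.
  have hM := gaugeM_half_le z.
  have hM2 : M (half z) <= M z.
    by apply: le_trans hM _; rewrite ler_pdivrMr// ler_peMr ?gaugeM_ge0// ler1n.
  have := powR_sub_ge (gaugeM_ge0 _ _) hM2 q1.
  have : 1 <= M z `^ (q - 1).
    by rewrite -[leLHS](powRr0 (M z)) ler_powR// subr_ge0.
  move=> p1 p2.
  rewrite -opprD lerN2 mulrAC -mulrA -mulrDr ler_pM2l// -lerBrDr.
  apply: le_trans p2; apply: (@le_trans _ _ (M z - M (half z))).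
    by rewrite lerBrDl -lerBrDr [X in X - _](splitr (M z)) addrK.
  by rewrite ler_peMl// subr_ge0.
have HM := H _ (ltW Mz).
rewrite /decay.
have := ler_pM (powR_ge0 _ _) (expR_ge0 _) e1 e2 => /(ler_wpM2l J0).
move=> /le_trans; apply.
set u := (1 + M (half z)) `^ beta; set v := expR (- (b * M (half z) `^ q)).
have uv : 0 <= u * v by rewrite mulr_ge0 ?powR_ge0 ?expR_ge0.
have -> : J * (c2 `^ beta * u * (expR (- (b / 2 * M z)) * v)) =
  (J * c2 `^ beta * expR (- (b / 2 * M z))) * (u * v) by ring.
exact: ler_wpM2r.
Qed.

(** Halving z maps M0 < M <= 2^(k+1) M0 into M <= 2^k M0, so by the gain of the
    previous lemma the integrals I k over M <= 2^k M0 satisfy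
    I (k+1) <= I 0 + (I k)/2, and remain below 2 (I 0). *)
Lemma decay_integral_fin beta b : 0 < b -> 0 <= beta ->
  (\int[lam]_z (decay beta b z)%:E < +oo)%E.
Proof.
move=> b0 beta0; pose J : R := 2^-1 ^- n * 2^-1 ^- m.
have J0 : 0 <= J by rewrite mulr_ge0// invr_ge0 exprn_ge0// invr_ge0.
have [M0 M01 H] := decay_half b0 beta0 J0.
pose S k : set X := [set z | M z <= 2 ^+ k * M0].
have mS k : measurable (S k).
  by apply: measurable_le_set; [exact: measurable_gaugeM|exact: measurable_cst].
have md := @measurable_decay beta b.
have d0 := @decay_ge0 beta b.
pose I k := (\int[lam]_(z in S k) (decay beta b z)%:E)%E.
have M00 : 0 <= M0 by exact: le_trans M01.
have I0fin : (I 0%N < +oo)%E.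
  apply: (@le_lt_trans _ _ (((1 + M0) `^ beta)%:E * lam (S 0%N))%E).
    apply: weight_le_bound => //; first exact: powR_ge0.
    move=> z; rewrite /S/= expr0 mul1r => Mz.
    rewrite /decay -[leRHS]mulr1 ler_pM ?powR_ge0 ?expR_ge0//.
      by rewrite ge0_ler_powR ?nnegrE ?lerD2l// addr_ge0// gaugeM_ge0.
    by rewrite -expR0 ler_expR oppr_le0 mulr_ge0 ?powR_ge0// ltW.
  have fin : (lam (S 0%N) < +oo)%E by exact: lebesgue_sublevel_fin.
  by rewrite lte_mul_pinfty// ?lee_fin ?powR_ge0// ge0_fin_numE.
have [r rE] : exists r, I 0%N = r%:E.
  exists (fine (I 0%N)); rewrite fineK// ge0_fin_numE//.
  exact: weight_ge0.
have r0 : 0 <= r by rewrite -lee_fin -rE; exact: weight_ge0.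
have Sle k : S k `<=` S k.+1.
  move=> z /= /le_trans; apply; rewrite exprS -mulrA ler_peMl// ?ler1n//.
  by rewrite mulr_ge0// exprn_ge0.
have Ik k : (I k <= (2 * r)%:E)%E.
  elim: k => [|k IH]; first by rewrite rE lee_fin; lra.
  rewrite /I (weight_split _ _ _ (mS k.+1) (mS 0%N))//.
  have -> : (2 * r = r + r)%R by ring.
  rewrite EFinD -[X in (_ <= X + _)%E]rE; apply: leeD.
    by apply: le_weight => // z [].
  apply: (@le_trans _ _ ((2^-1)%:E * I k)%E).
    have h0 : (0 : R) < 2^-1 by rewrite invr_gt0.
    have mP : measurable (S k.+1 `\` S 0%N) by exact: measurableD.
    apply: (integral_transport (w := zz) h0 h0 (ltW h0) mP (mS k) md md d0 d0).
    move=> z [Sz nSz]; split.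
      rewrite /S/=; apply: le_trans (gaugeM_half_le z) _.
      by rewrite ler_pdivrMr//; move: Sz; rewrite /S/= exprS; lra.
    apply: H; move: nSz; rewrite /S/= expr0 mul1r => /negP.
    by rewrite -ltNge.
  apply: le_trans (lee_wpmul2l _ IH) _; first by rewrite lee_fin.
  by rewrite -EFinM lee_fin mulrA mulVf// mul1r.
have cvgI : I k @[k --> \oo] --> (\int[lam]_z (decay beta b z)%:E)%E.
  have -> : [set: X] = \bigcup_k S k.
    apply/seteqP; split => // z _.
    have [k Hk] : exists k : nat, M z <= k%:R.
      by exists (Num.bound (M z)); apply/ltW/archi_boundP/gaugeM_ge0.
    exists k => //=; apply: le_trans Hk _.
    rewrite -[leLHS]mulr1 ler_pM// -natrX ler_nat.
    exact/ltnW/ltn_expl.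
  apply: ge0_nondecreasing_set_cvg_integral => //.
  - by apply/nondecreasing_seqP => k; apply/subsetPset; exact: Sle.
  - by move=> k; exact/measurable_EFinP/measurable_funTS.
  - by move=> k z _; rewrite lee_fin.
have -> : (\int[lam]_z (decay beta b z)%:E)%E = limn I by apply/esym/cvg_lim.
apply: (@le_lt_trans _ _ (2 * r)%:E); last by rewrite ltry.
apply: lime_le; first by apply/cvg_ex; eexists; exact: cvgI.
exact: nearW.
Qed.

End integrability.

(** * Moving one coordinate towards 0 *)

Section moves.
Context {R : realType}.
Variables (n m : nat) (gamma q : R).
Hypotheses (gamma0 : 0 <= gamma) (q1 : 1 <= q).
Notation X := (n.-tuple R * m.-tuple R)%type.
Notation M := (@gaugeM R n m gamma).

Let g1_gt0 : 0 < 1 + gamma. Proof. by rewrite ltr_pwDl. Qed.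

(** The square changes by 2 c x_i + c^2 <= - |c| |x_i|. *)
Lemma dvec_shift_sqr_le k (i : 'I_k) c (x : k.-tuple R) :
  c * tnth x i <= 0 -> `|c| <= `|tnth x i| -> eucl_norm x <= k%:R * `|tnth x i| ->
  eucl_norm (affine 1 (dvec i c) x) ^+ 2 <=
    eucl_norm x ^+ 2 - `|c| * eucl_norm x / k%:R.
Proof.
move=> cx cle xle; rewrite sqr_eucl_norm_dvec.
have k0 : (0 : R) < k%:R by rewrite ltr0n (leq_ltn_trans _ (ltn_ord i)).
have E : c * tnth x i = - (`|c| * `|tnth x i|).
  by rewrite -normrM ler0_norm// opprK.
have -> : c ^+ 2 = `|c| ^+ 2 by rewrite real_normK ?num_real.
have h1 : `|c| * eucl_norm x / k%:R <= `|c| * `|tnth x i|.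
  by rewrite ler_pdivrMr// -mulrA ler_wpM2l// mulrC.
have h2 : `|c| ^+ 2 <= `|c| * `|tnth x i| by rewrite expr2 ler_wpM2l.
by rewrite -mulrA E; lra.
Qed.

Lemma dvec_shift_le k (i : 'I_k) c (x : k.-tuple R) :
  c * tnth x i <= 0 -> `|c| <= `|tnth x i| ->
  eucl_norm (affine 1 (dvec i c) x) <= eucl_norm x.
Proof.
move=> cx cle; rewrite -(@ler_pXn2r _ 2)// ?nnegrE ?eucl_norm_ge0//.
rewrite sqr_eucl_norm_dvec.
have E : c * tnth x i = - (`|c| * `|tnth x i|).
  by rewrite -normrM ler0_norm// opprK.
have -> : c ^+ 2 = `|c| ^+ 2 by rewrite real_normK ?num_real.
have h2 : `|c| ^+ 2 <= `|c| * `|tnth x i| by rewrite expr2 ler_wpM2l.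
have : 0 <= `|c| * `|tnth x i| by rewrite mulr_ge0.
by rewrite -mulrA E; lra.
Qed.

Lemma dvec_shift_ge k (i : 'I_k) c (x : k.-tuple R) :
  eucl_norm x - `|c| <= eucl_norm (affine 1 (dvec i c) x).
Proof.
have -> : eucl_norm x = eucl_norm (affine 1 (dvec i (- c)) (affine 1 (dvec i c) x)).
  congr eucl_norm; apply: eq_from_tnth => j; rewrite !tnth_mktuple.
  by case: ifP => _; rewrite !mul1r ?addrK ?addr0.
rewrite lerBlDr; apply: le_trans (eucl_norm_affine1_le _ _) _.
by rewrite eucl_norm_dvec normrN.
Qed.

(** As a - b >= (a^2 - b^2) / (2a). *)
Lemma powR_gain (a b D : R) : 0 <= b -> 0 < a -> 0 <= D ->
  b ^+ 2 <= a ^+ 2 - D ->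
  b <= a /\ a `^ (q - 1) * (D / (2 * a)) <= a `^ q - b `^ q.
Proof.
move=> b0 a0 D0 H.
have ba : b <= a by rewrite -(@ler_pXn2r _ 2)// ?nnegrE// ?(ltW a0)//; lra.
split => //; apply: le_trans (powR_sub_ge b0 ba q1).
rewrite ler_wpM2l ?powR_ge0// ler_pdivrMr ?mulr_gt0//.
nra.
Qed.

Lemma gaugeM_yshift_le (z : X) j c : c * tnth z.2 j <= 0 ->
  `|c| <= `|tnth z.2 j| -> M (affine2 1 1 (zvec n, dvec j c) z) <= M z.
Proof.
move=> h1 h2; apply: gaugeM_le_of; first exact: gaugeM_ge0.
rewrite sqr_gaugeM /xpart /= affine1_zvec lerD2l.
rewrite ler_pXn2r// ?nnegrE ?ypart_ge0//.
by rewrite /ypart ler_pM2l//= dvec_shift_le.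
Qed.

Lemma gaugeM_yshift_gain (z : X) j c (kappa : R) : c * tnth z.2 j <= 0 ->
  `|c| <= `|tnth z.2 j| -> eucl_norm z.2 <= m%:R * `|tnth z.2 j| ->
  0 < M z -> 0 < kappa -> M z <= kappa * ypart gamma z ->
  M z ^+ 2 - M (affine2 1 1 (zvec n, dvec j c) z) ^+ 2 >=
    (1 + gamma) * `|c| * M z / (kappa * m%:R).
Proof.
move=> h1 h2 h3 Mz0 k0 My.
have m0 : (0 : R) < m%:R by rewrite ltr0n (leq_ltn_trans _ (ltn_ord j)).
rewrite !sqr_gaugeM /xpart /= affine1_zvec /ypart /=.
have := dvec_shift_sqr_le h1 h2 h3.
set a := eucl_norm z.2; set b := eucl_norm (affine _ _ _) => H.
have D : (1 + gamma) * `|c| * M z / (kappa * m%:R) <=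
  (1 + gamma) ^+ 2 * (`|c| * a / m%:R).
  rewrite ler_pdivrMr ?mulr_gt0//.
  have -> : (1 + gamma) ^+ 2 * (`|c| * a / m%:R) * (kappa * m%:R) =
    ((1 + gamma) * `|c|) * (kappa * ((1 + gamma) * a)).
    by field; rewrite gt_eqF.
  by rewrite ler_wpM2l// mulr_ge0// ltW.
apply: le_trans D _; rewrite !exprMn.
have : 0 <= (1 + gamma) ^+ 2 by exact: sqr_ge0.
nra.
Qed.

Lemma powR_yshift_gain (z : X) j c (kappa : R) : c * tnth z.2 j <= 0 ->
  `|c| <= `|tnth z.2 j| -> eucl_norm z.2 <= m%:R * `|tnth z.2 j| ->
  0 < M z -> 0 < kappa -> M z <= kappa * ypart gamma z ->
  M z `^ (q - 1) * ((1 + gamma) * `|c| / (2 * kappa * m%:R)) <=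
   M z `^ q - M (affine2 1 1 (zvec n, dvec j c) z) `^ q.
Proof.
move=> h1 h2 h3 Mz0 k0 My.
have m0 : (0 : R) < m%:R by rewrite ltr0n (leq_ltn_trans _ (ltn_ord j)).
have H := gaugeM_yshift_gain h1 h2 h3 Mz0 k0 My.
have [||_] := @powR_gain (M z) (M (affine2 1 1 (zvec n, dvec j c) z))
  ((1 + gamma) * `|c| * M z / (kappa * m%:R)) (gaugeM_ge0 _ _) Mz0.
- apply: divr_ge0; last by apply: mulr_ge0; exact: ltW.
  by apply: mulr_ge0; [apply: mulr_ge0 => //|]; exact: ltW.
- by lra.
apply: le_trans; rewrite ler_wpM2l ?powR_ge0// le_eqVlt; apply/orP; left.
by apply/eqP; field; rewrite !gt_eqF.
Qed.

Lemma gaugeM_xshift_le (z : X) i c : c * tnth z.1 i <= 0 ->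
  `|c| <= `|tnth z.1 i| -> M (affine2 1 1 (dvec i c, zvec m) z) <= M z.
Proof.
move=> h1 h2; apply: gaugeM_le_of; first exact: gaugeM_ge0.
rewrite sqr_gaugeM /ypart /= affine1_zvec lerD2r.
rewrite ler_pXn2r// ?nnegrE ?xpart_ge0//.
by rewrite /xpart ge0_ler_powR ?nnegrE ?eucl_norm_ge0 ?dvec_shift_le// ltW.
Qed.

(** Where |x| >= 1 the derivative of |x|^(1+gamma) is at least 1. *)
Lemma powR_xshift_gain (z : X) i c : c * tnth z.1 i <= 0 ->
  `|c| <= `|tnth z.1 i| -> eucl_norm z.1 <= n%:R * `|tnth z.1 i| ->
  1 <= xpart gamma z -> M z <= 2 * xpart gamma z ->
  M z `^ (q - 1) * (`|c| / (8 * n%:R)) <=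
   M z `^ q - M (affine2 1 1 (dvec i c, zvec m) z) `^ q.
Proof.
move=> h1 h2 h3 X1 MX.
have n0 : (0 : R) < n%:R by rewrite ltr0n (leq_ltn_trans _ (ltn_ord i)).
have Mz0 : 0 < M z by have := xpart_le gamma z; lra.
have x1 : 1 <= eucl_norm z.1.
  rewrite leNgt; apply/negP => xlt.
  have := @gt0_ltr_powR R (1 + gamma) g1_gt0 (eucl_norm z.1) 1.
  rewrite !nnegrE eucl_norm_ge0 powR1 => /(_ isT ler01 xlt).
  by rewrite -/(xpart _ z); lra.
have := dvec_shift_sqr_le h1 h2 h3; have := dvec_shift_le h1 h2.
set a := eucl_norm z.1 in x1 *; set b := eucl_norm (affine _ _ _) => ba H.
have b0 : 0 <= b by exact: eucl_norm_ge0.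
have ab : `|c| / (2 * n%:R) <= a - b.
  have e : `|c| * a / n%:R = `|c| / (2 * n%:R) * (2 * a).
    by field; rewrite gt_eqF.
  have : `|c| / (2 * n%:R) * (2 * a) <= (a - b) * (a + b).
    by rewrite -e; have -> : (a - b) * (a + b) = a ^+ 2 - b ^+ 2 by [ring]; lra.
  have ab0 : 0 <= a - b by rewrite subr_ge0.
  have : (a - b) * (a + b) <= (a - b) * (2 * a) by rewrite ler_wpM2l//; lra.
  move=> u v; have := le_trans v u; rewrite ler_pM2r//; lra.
pose z' := affine2 1 1 (dvec i c, zvec m) z.
have XX : `|c| / (2 * n%:R) <= xpart gamma z - xpart gamma z'.
  have := @powR_sub_ge R a b (1 + gamma) b0 ba; rewrite lerDl => /(_ gamma0).
  rewrite /xpart -/a -[eucl_norm z'.1]/b; apply: le_trans.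
  have -> : 1 + gamma - 1 = gamma by ring.
  have : 1 <= a `^ gamma by rewrite -[leLHS](powRr0 a) ler_powR.
  have c0 : 0 <= `|c| / (2 * n%:R) by rewrite divr_ge0// mulr_ge0// ltW.
  nra.
have [||_] := @powR_gain (M z) (M z')
  (`|c| / (2 * n%:R) * xpart gamma z) (gaugeM_ge0 _ _) Mz0.
- by rewrite mulr_ge0 ?xpart_ge0// divr_ge0// mulr_ge0// ltW.
- rewrite !sqr_gaugeM.
  have -> : ypart gamma z' = ypart gamma z by rewrite /ypart /= affine1_zvec.
  have := xpart_ge0 gamma z'; have := xpart_ge0 gamma z.
  have c0 : 0 <= `|c| / (2 * n%:R) by rewrite divr_ge0// mulr_ge0// ltW.
  nra.
apply: le_trans; rewrite ler_wpM2l ?powR_ge0//.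
rewrite ler_pdivlMr ?mulr_gt0//.
have -> : `|c| / (8 * n%:R) * (2 * M z) = `|c| / (2 * n%:R) * (M z / 2).
  by field; rewrite gt_eqF.
rewrite ler_wpM2l//; lra.
Qed.

End moves.

(** * The length scales at height K *)

Section scales.
Context {R : realType}.
Variables (gamma q : R).
Hypotheses (gamma0 : 0 <= gamma) (q1 : 1 <= q).

(** Where M is comparable to K, M^q varies by a bounded amount if y moves by
    yscale K or, close to x = 0, if x moves by xscale K. *)
Definition yscale (K : R) := K `^ (1 - q).
Definition xscale (K : R) := yscale K `^ (1 + gamma)^-1.

Let g1_gt0 : 0 < 1 + gamma. Proof. by rewrite ltr_pwDl. Qed.

Variable K : R.
Hypothesis K1 : 1 <= K.
Let K0 : 0 < K. Proof. exact: lt_le_trans K1. Qed.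

Lemma yscale_gt0 : 0 < yscale K. Proof. exact: powR_gt0. Qed.

Lemma yscale_le1 : yscale K <= 1.
Proof. by rewrite -[leRHS](powRr0 K) ler_powR// subr_le0. Qed.

Lemma xscale_gt0 : 0 < xscale K. Proof. by rewrite powR_gt0// yscale_gt0. Qed.

Lemma powR_xscale : xscale K `^ (1 + gamma) = yscale K.
Proof. by rewrite -powRrM mulVf ?gt_eqF// powRr1// ltW// yscale_gt0. Qed.

Lemma xscale_le1 : xscale K <= 1.
Proof.
have : 0 <= (1 + gamma)^-1 by rewrite invr_ge0 ltW.
move=> /ge0_ler_powR/(_ (yscale K) 1); rewrite !nnegrE (ltW yscale_gt0) powR1.
by apply => //; exact: yscale_le1.
Qed.

Lemma yscale_xscale : yscale K = xscale K * xscale K `^ gamma.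
Proof.
rewrite -powR_xscale powRD ?powRr1 ?ltW ?xscale_gt0//.
by apply/implyP => _; rewrite gt_eqF ?xscale_gt0.
Qed.

Lemma yscale_le_xscale : yscale K <= xscale K.
Proof.
rewrite yscale_xscale ler_piMr// ?(ltW xscale_gt0)//.
rewrite -[leRHS](powRr0 (xscale K)) ger_powR// xscale_gt0; exact: xscale_le1.
Qed.

Lemma powR_yscale : K `^ (q - 1) * yscale K = 1.
Proof.
rewrite /yscale -powRD; last by apply/implyP => _; rewrite gt_eqF.
by have -> : q - 1 + (1 - q) = 0 by [ring]; rewrite powRr0.
Qed.

Lemma powR_xscale_gamma : xscale K `^ gamma * K `^ (q - 1) = (xscale K)^-1.
Proof.
have L0 := xscale_gt0; apply: (mulfI (lt0r_neq0 L0)).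
by rewrite mulrA -yscale_xscale mulrC powR_yscale divff// gt_eqF.
Qed.

End scales.

(** * The mass gained by lowering the threshold *)

Section strip.
Context {R : realType}.
Variables (n m : nat) (gamma q : R).
Hypotheses (gamma0 : 0 <= gamma) (q1 : 1 <= q).
Notation X := (n.-tuple R * m.-tuple R)%type.
Notation lam := (@lebesgue_tuple R n \x @lebesgue_tuple R m)%E.
Notation M := (@gaugeM R n m gamma).

Let g1_gt0 : 0 < 1 + gamma. Proof. by rewrite ltr_pwDl. Qed.

(** The density before normalisation; the statements on mu are proved for the
    measure wgt of density rho. *)
Definition rho (z : X) : R := expR (- (M z `^ q)).

Definition wgt (S : set X) : \bar R := (\int[lam]_(z in S) (rho z)%:E)%E.

Lemma rho_ge0 z : 0 <= rho z. Proof. exact: expR_ge0. Qed.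

Lemma measurable_rho : measurable_fun [set: X] rho.
Proof.
apply: (measurableT_comp (@measurable_expR R)); apply: measurable_funN.
by apply: (measurableT_comp (measurable_powR _)); exact: measurable_gaugeM.
Qed.

Lemma rho_le z z' : M z' <= M z -> rho z <= rho z'.
Proof.
move=> h; rewrite ler_expR lerN2 ge0_ler_powR ?nnegrE ?gaugeM_ge0//.
exact: le_trans q1.
Qed.

(** The extremiser with threshold lowered by theta. *)
Definition lowered (K : R) (theta : n.-tuple R -> R) : set X :=
  [set z | xpart gamma z + K - theta z.1 <= ypart gamma z].

Lemma measurable_lowered K theta : measurable_fun [set: n.-tuple R] theta ->
  measurable (lowered K theta).
Proof.
move=> mt; apply: measurable_le_set; last exact: measurable_ypart.
apply: measurable_funB; last exact: measurableT_comp.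
by apply: measurable_funD => //; exact: measurable_xpart.
Qed.

Lemma gaugeM_ydilate_le (z : X) (s : R) : 1 <= s ->
  M z <= M (affine2 1 s (zvec n, zvec m) z) /\
  M (affine2 1 s (zvec n, zvec m) z) <= s * M z.
Proof.
move=> s1; have s0 : 0 <= s by exact: le_trans s1.
have E : M (affine2 1 s (zvec n, zvec m) z) ^+ 2 =
    xpart gamma z ^+ 2 + (s * ypart gamma z) ^+ 2.
  by rewrite sqr_gaugeM xpart_dilate// powR1 mul1r ypart_dilate.
have y0 := ypart_ge0 gamma0 z.
have ysy : ypart gamma z <= s * ypart gamma z by rewrite ler_peMl.
split.
  apply: gaugeM_le_of; rewrite ?gaugeM_ge0// E lerD2l.
  by rewrite ler_pXn2r ?nnegrE// mulr_ge0.
have -> : M (affine2 1 s (zvec n,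
  zvec m) z) = Num.sqrt (M (affine2 1 s (zvec n, zvec m) z) ^+ 2).
  by rewrite sqrtr_sqr ger0_norm// gaugeM_ge0.
rewrite E; have sM : 0 <= s * M z by rewrite mulr_ge0// gaugeM_ge0.
rewrite -[leRHS]ger0_norm// -sqrtr_sqr ler_wsqrtr//.
have -> : (s * M z) ^+ 2 = s ^+ 2 * (xpart gamma z ^+ 2 + ypart gamma z ^+ 2).
  by rewrite -sqr_gaugeM; ring.
have : 1 <= s ^+ 2 by rewrite exprn_ege1.
have := sqr_ge0 (xpart gamma z); nra.
Qed.

(** In each fibre the dilation of y has Jacobian at least 1. *)
Lemma integral_fiber_dilation_le (F G H : X -> \bar R) (s : n.-tuple R -> R) :
  measurable_fun [set: X] F -> measurable_fun [set: X] G ->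
  measurable_fun [set: X] H ->
  (forall z, 0 <= F z)%E -> (forall z, 0 <= G z)%E -> (forall z, 0 <= H z)%E ->
  (forall x, 1 <= s x) ->
  (forall x y, F (x, y) <= G (x, affine (s x) (zvec m) y) + H (x, y))%E ->
  (\int[lam]_z F z <= \int[lam]_z G z + \int[lam]_z H z)%E.
Proof.
move=> mF mG mH F0 G0 H0 s1 key.
rewrite -ge0_integralD//.
rewrite (fubini_tonelli1 F)// (fubini_tonelli1 (fun z => G z + H z)%E)//;
  last 2 first.
- exact: emeasurable_funD.
- by move=> z; rewrite adde_ge0.
have mGH : measurable_fun [set: X] (fun z => G z + H z)%E
  by exact: emeasurable_funD.
apply: ge0_le_integral => //.
- by move=> x _; exact: integral_ge0.
- by apply: (measurable_fun_fubini_tonelli_F (m2 := @lebesgue_tuple R m) _ mF).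
- apply: (measurable_fun_fubini_tonelli_F (m2 := @lebesgue_tuple R m) _ mGH).
  by move=> z; rewrite adde_ge0.
move=> x _; rewrite /fubini_F.
have s0 : 0 < s x by exact: lt_le_trans (s1 x).
have mGx : measurable_fun [set: m.-tuple R] (fun y => G (x, y)).
  exact: (measurableT_comp mG (pair1_measurable x)).
have mHx : measurable_fun [set: m.-tuple R] (fun y => H (x, y)).
  exact: (measurableT_comp mH (pair1_measurable x)).
have mFx : measurable_fun [set: m.-tuple R] (fun y => F (x, y)).
  exact: (measurableT_comp mF (pair1_measurable x)).
have mGs : measurable_fun [set: m.-tuple R]
    (fun y => G (x, affine (s x) (zvec m) y)).
  by apply: (measurableT_comp mGx); exact: measurable_affine.
apply: (@le_trans _ _ (\int[lebesgue_tuple m]_y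
    (G (x, affine (s x) (zvec m) y) + H (x, y)))%E).
  by apply: ge0_le_integral => //; exact: emeasurable_funD.
rewrite !ge0_integralD//; apply: leeD => //.
rewrite -[leRHS](integral_affine (zvec m) s0 mGx)//.
by apply: lee_pemull; [exact: integral_ge0|rewrite lee_fin exprn_ege1].
Qed.

(** Let r = X + K. The dilation of y by s = r / (r - theta) maps the fibre of the
    lowered set over x into that of the extremiser. It increases M^q by at most
    C (theta / r) M^q, and 1 - exp(-u) <= u bounds what the density loses. *)
Lemma wgt_lowered_le : exists2 C : R, 0 < C &
  forall (K : R) (theta : n.-tuple R -> R), 0 < K ->
  measurable_fun [set: n.-tuple R] theta -> (forall x, 0 <= theta x) ->
  (forall z : X, theta z.1 <= (xpart gamma z + K) / 2) ->
  (wgt (lowered K theta) <= wgt (lowered K (fun=> 0%R)) +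
    C%:E * \int[lam]_(z in lowered K theta)
      (theta z.1 / (xpart gamma z + K) * M z `^ q * rho z)%:E)%E.
Proof.
have [k k1 Hk] := powR_sub_le q1.
pose C := k * 2 `^ (q - 1) * 2.
have C0 : 0 < C by rewrite !mulr_gt0 ?powR_gt0// (lt_le_trans ltr01).
exists C => // K theta K0 mt t0 tle.
pose B := lowered K theta; pose A := lowered K (fun=> 0).
have mB : measurable B by exact: measurable_lowered.
have mA : measurable A by apply: measurable_lowered.
pose h (z : X) : R := C * (theta z.1 / (xpart gamma z + K) * M z `^ q * rho z).
have XK (z : X) : 0 < xpart gamma z + K by rewrite ltr_wpDl// xpart_ge0.
have g0 (z : X) : 0 <= theta z.1 / (xpart gamma z + K) * M z `^ q * rho z.
  apply: mulr_ge0; last exact: rho_ge0.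
  apply: mulr_ge0; last exact: powR_ge0.
  by apply: divr_ge0 => //; exact/ltW/XK.
have h0 z : 0 <= h z by exact: mulr_ge0 (ltW C0) (g0 z).
have mh0 : measurable_fun [set: X] (fun z : X =>
    theta z.1 / (xpart gamma z + K) * M z `^ q * rho z).
  apply: measurable_funM; last exact: measurable_rho.
  apply: measurable_funM; last first.
    by apply: (measurableT_comp (measurable_powR _)); exact: measurable_gaugeM.
  apply: measurable_funM; first exact: measurableT_comp.
  apply: (eq_measurable_fun (fun z => (xpart gamma z + K) `^ (-1))).
    by move=> z _; rewrite powR_inv1// ltW.
  apply: (measurableT_comp (measurable_powR _)).
  by apply: measurable_funD => //; exact: measurable_xpart.
have mh : measurable_fun [set: X] h by exact: measurable_funM.
pose F := ((fun z => (rho z)%:E) \_ B)%E.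
pose G := ((fun z => (rho z)%:E) \_ A)%E.
pose H := ((fun z => (h z)%:E) \_ B)%E.
have mr := measurable_rho.
have mF : measurable_fun [set: X] F by exact: measurable_restrict_EFin.
have mG : measurable_fun [set: X] G by exact: measurable_restrict_EFin.
have mH : measurable_fun [set: X] H by exact: measurable_restrict_EFin.
have F0 z : (0 <= F z)%E.
  by apply: erestrict_ge0 => ? _; rewrite lee_fin rho_ge0.
have G0 z : (0 <= G z)%E.
  by apply: erestrict_ge0 => ? _; rewrite lee_fin rho_ge0.
have H0 z : (0 <= H z)%E.
  by apply: erestrict_ge0 => ? _; rewrite lee_fin.
pose s (x : n.-tuple R) : R := let r :=
  eucl_norm x `^ (1 + gamma) + K in r / (r - theta x).
have sP x : [/\ 1 <= s x, s x <= 2, s x - 1 <=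
  2 * (theta x / (eucl_norm x `^ (1 + gamma) + K)) &
    s x * (eucl_norm x `^ (1 + gamma) + K - theta x) =
      eucl_norm x `^ (1 + gamma) + K].
  rewrite /s; have := XK (x, zvec m); have := tle (x, zvec m); have := t0 x.
  rewrite /xpart /=; set r := _ + K; set t := theta x => t0' tr r0.
  have rt : 0 < r - t by lra.
  split.
  - by rewrite ler_pdivlMr// mul1r; lra.
  - by rewrite ler_pdivrMr//; lra.
  - have -> : r / (r - t) - 1 = t / (r - t) by field; rewrite gt_eqF.
    rewrite ler_pdivrMr//.
    have -> : 2 * (t / r) * (r - t) = t * (2 * (r - t) / r).
      by field; rewrite gt_eqF.
    by rewrite ler_peMr// ler_pdivlMr//; lra.
  - by rewrite mulfVK// gt_eqF.
have key x y : (F (x, y) <= G (x, affine (s x) (zvec m) y) + H (x, y))%E.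
  rewrite {1}/F patchE; case: ifPn => [|_]; last by rewrite adde_ge0.
  rewrite inE => Bz; have [s1 s2 s3 s4] := sP x.
  have zE : (x, affine (s x) (zvec m) y) = affine2 1 (s x) (zvec n, zvec m) (x,
    y) :> X.
    by rewrite /affine2 /= affine1_zvec.
  have Az : A (x, affine (s x) (zvec m) y).
    rewrite zE /A /lowered /= subr0 xpart_dilate// powR1 mul1r.
    rewrite ypart_dilate ?(le_trans _ s1)//.
    move: Bz; rewrite /B /lowered /= /xpart /=; rewrite -[in X in _ -> X]s4.
    by rewrite ler_pM2l// (lt_le_trans _ s1).
  rewrite /G patchE mem_set// /H patchE mem_set// -EFinD lee_fin zE.
  have [] := gaugeM_ydilate_le (x, y) s1.
  set z := (x, y) in Bz *; set z' := affine2 _ _ _ _ => M1 M2.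
  have M0 := gaugeM_ge0 gamma z.
  suff UU : M z' `^ q - M z `^ q <= C * (theta x / (xpart gamma z + K)) * M z `^ q.
    have -> : rho z' = rho z * expR (- (M z' `^ q - M z `^ q)).
      by rewrite /rho -expRD; congr expR; rewrite opprB addKr.
    have r0 := rho_ge0 z.
    have a1 := ler_wpM2l r0 (expR_ge1Dx (- (M z' `^ q - M z `^ q))).
    have a2 := ler_wpM2l r0 UU.
    have -> : h z = rho z * (C * (theta x / (xpart gamma z + K)) * M z `^ q).
      rewrite /h /=; move: (rho z) (M z `^ q) (theta x) ((xpart gamma z + K)^-1).
      by move=> r1 r2 r3 r4; ring.
    apply: le_trans (_ : _ <= _ + rho z * (M z' `^ q - M z `^ q)) _.
      rewrite -lerBlDr; apply: le_trans a1.
      by rewrite [leRHS]mulrDr mulr1 mulrN.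
    by rewrite lerD2l.
  apply: le_trans (Hk _ _ M0 M1) _.
  have e1 : M z' - M z <= 2 * (theta x / (xpart gamma z + K)) * M z.
    apply: (@le_trans _ _ ((s x - 1) * M z)); first lra.
    by rewrite ler_wpM2r.
  have e2 : M z' `^ (q - 1) <= 2 `^ (q - 1) * M z `^ (q - 1).
    rewrite -powRM// ge0_ler_powR ?nnegrE ?subr_ge0 ?gaugeM_ge0 ?mulr_ge0//.
    by apply: le_trans M2 _; rewrite ler_wpM2r.
  have q0 : 0 < q by exact: lt_le_trans q1.
  rewrite -(mulr_powRB1 M0 q0) /C.
  have k0 : 0 <= k by exact: le_trans k1.
  have e3 : k * M z' `^ (q - 1) <= k * (2 `^ (q - 1) * M z `^ (q - 1))
    by rewrite ler_wpM2l.
  have := ler_pM (mulr_ge0 k0 (powR_ge0 _ _)) _ e3 e1; rewrite subr_ge0 => /(_ M1).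
  move=> /le_trans; apply; rewrite le_eqVlt; apply/orP; left; apply/eqP.
  move: (2 `^ (q - 1)) (M z `^ (q - 1)) (M z) (theta x / _) => r1 r2 r3 r4.
  by ring.
have Hint : (\int[lam]_z H z = C%:E * \int[lam]_(z in B)
    (theta z.1 / (xpart gamma z + K) * M z `^ q * rho z)%:E)%E.
  rewrite -ge0_integralZl_EFin//.
  - by rewrite [RHS]integral_mkcond; apply: eq_integral.
  - by move=> z _; rewrite lee_fin; exact: g0.
  - exact/measurable_EFinP/measurable_funTS.
  - exact: ltW.
rewrite /wgt -/B -Hint integral_mkcond [X in (_ <= X + _)%E]integral_mkcond.
apply: (integral_fiber_dilation_le mF mG mH F0 G0 H0) key => x.
by have [] := sP x.
Qed.

End strip.

(** * Moments of the lowered set *)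

Section coordinate_pieces.
Context {R : realType}.

(** On each piece one coordinate has a known sign and is comparable to the norm,
    so that the same translation decreases the norm at all its points. *)
Definition coord_piece k (jb : 'I_k * bool) : set (k.-tuple R) :=
  [set x | eucl_norm x <= k%:R * ((-1) ^+ jb.2 * tnth x jb.1)].

Lemma measurable_coord_piece k jb : measurable (@coord_piece k jb).
Proof.
apply: measurable_le_set; first exact: measurable_eucl_norm.
do 2 apply: measurable_funM => //; exact: measurable_tnth.
Qed.

Lemma coord_piece_cover k (x : k.-tuple R) : (0 < k)%N ->
  exists jb, coord_piece jb x.
Proof.
move=> k0; have [j xj] := eucl_norm_ex_coord x k0.
exists (j, tnth x j < 0); rewrite /coord_piece /=.
apply: le_trans xj _; rewrite ler_wpM2l//.
by case: ltP => h; rewrite ?expr1 ?expr0 ?mulN1r ?mul1r ?(ltr0_norm h)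
  ?(ger0_norm h).
Qed.

Lemma coord_pieceP k jb (x : k.-tuple R) (tau : R) : coord_piece jb x -> 0 <= tau ->
  let c := - ((-1) ^+ jb.2 * tau) in
  [/\ c * tnth x jb.1 <= 0, `|c| = tau & eucl_norm x <= k%:R * `|tnth x jb.1| ].
Proof.
case: jb => j b /=; rewrite /coord_piece /= => H t0.
have k0 : (0 : R) < k%:R by rewrite ltr0n (leq_ltn_trans _ (ltn_ord j)).
have s0 : 0 <= (-1) ^+ b * tnth x j.
  by rewrite -(pmulr_rge0 _ k0); apply: le_trans (eucl_norm_ge0 x) _.
split.
- by rewrite mulNr oppr_le0 mulrAC mulr_ge0.
- by rewrite normrN normrM normrX normrN1 expr1n mul1r ger0_norm.
- have <- : (-1) ^+ b * tnth x j = `|tnth x j| by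
    rewrite -[LHS]ger0_norm// normrM normrX normrN1 expr1n mul1r.
  exact: H.
Qed.

End coordinate_pieces.

Section moments.
Context {R : realType}.
Variables (n m : nat) (gamma q : R).
Hypotheses (hm : (0 < m)%N) (gamma0 : 0 <= gamma) (q1 : 1 <= q).
Notation X := (n.-tuple R * m.-tuple R)%type.
Notation lam := (@lebesgue_tuple R n \x @lebesgue_tuple R m)%E.
Notation M := (@gaugeM R n m gamma).
Notation yscale := (@yscale R q).
Notation xscale := (@xscale R gamma q).
Notation rho := (@rho R n m gamma q).
Notation wgt := (@wgt R n m gamma q).
Notation lowered := (@lowered R n m gamma).

Let g1_gt0 : 0 < 1 + gamma. Proof. by rewrite ltr_pwDl. Qed.

(** The contraction of x that halves X. *)
Definition xhalf : R := 2^-1 `^ (1 + gamma)^-1.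

Lemma xhalf_gt0 : 0 < xhalf. Proof. by rewrite powR_gt0// invr_gt0. Qed.

Lemma xhalf_powR : xhalf `^ (1 + gamma) = 2^-1.
Proof. by rewrite -powRrM mulVf ?gt_eqF// powRr1// invr_ge0. Qed.

Lemma xhalf_ge : 2^-1 <= xhalf.
Proof.
have g1 : 1 <= 1 + gamma by rewrite lerDl.
apply: ger1_powR; first by rewrite invr_gt0 ltr0n/= invf_le1// ler1n.
by rewrite invf_le1.
Qed.

Lemma xhalf_powR_gamma : 2^-1 <= xhalf `^ gamma.
Proof.
rewrite -powRrM; apply: ger1_powR;
  first by rewrite invr_gt0 ltr0n/= invf_le1// ler1n.
by rewrite mulrC ler_pdivrMr// mul1r lerDr.
Qed.

(** For the loss theta of an eps-enlargement, theta M^q / (X + K) is at most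
    eps / xscale K times a multiple of this function. *)
Definition moment (K : R) (z : X) : R :=
  (1 + eucl_norm z.1 / xscale K) `^ gamma * (M z / K) `^ q.

Lemma measurable_moment K : measurable_fun [set: X] (moment K).
Proof.
apply: measurable_funM; apply: (measurableT_comp (measurable_powR _)).
  apply: measurable_funD => //; apply: measurable_funM => //.
  by apply: measurableT_comp => //; exact: measurable_eucl_norm.
by apply: measurable_funM => //; exact: measurable_gaugeM.
Qed.

Lemma moment_ge0 K z : 0 <= moment K z.
Proof. by rewrite mulr_ge0 ?powR_ge0. Qed.

(** Finiteness makes the absorption in moment_bound possible. *)
Lemma moment_rho_fin K : 1 <= K ->
  (\int[lam]_z (moment K z * rho z)%:E < +oo)%E.
Proof.
move=> K1; have L0 := xscale_gt0 gamma q K1; have L1 := xscale_le1 gamma0 q1 K1.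
have K0 : 0 < K by exact: lt_le_trans K1.
have q0 : 0 <= q by exact: le_trans q1.
have le1 z : moment K z * rho z <=
  (2 / xscale K) `^ gamma * decay gamma q (gamma + q) 1 z.
  have M0 := gaugeM_ge0 gamma z.
  have M10 : 0 < 1 + M z by rewrite ltr_pwDl.
  have xM : 1 + eucl_norm z.1 / xscale K <= 2 / xscale K * (1 + M z).
    have := eucl_norm_le_xpart gamma0 z; have := xpart_le gamma z => h1 h2.
    have L1' : 1 <= (xscale K)^-1 by rewrite invf_ge1.
    have e0 := eucl_norm_ge0 z.1.
    nra.
  have xM0 : 0 <= 1 + eucl_norm z.1 / xscale K.
    by rewrite addr_ge0// divr_ge0 ?eucl_norm_ge0// ltW.
  have e1 : (1 + eucl_norm z.1 / xscale K) `^ gamma <=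
     (2 / xscale K) `^ gamma * (1 + M z) `^ gamma.
    have l20 : 0 <= 2 / xscale K by rewrite divr_ge0// ltW.
    rewrite -powRM// ?(ltW M10)// ge0_ler_powR ?nnegrE//.
    by rewrite mulr_ge0// ltW.
  have e2 : (M z / K) `^ q <= (1 + M z) `^ q.
    rewrite ge0_ler_powR ?nnegrE ?divr_ge0 ?(ltW K0) ?(ltW M10)//.
    by rewrite ler_pdivrMr//; nra.
  rewrite /decay mul1r -/(rho z) powRD; last by apply/implyP => _; rewrite gt_eqF.
  rewrite !mulrA ler_wpM2r ?rho_ge0// /moment.
  by rewrite ler_pM ?powR_ge0.
have mm : measurable_fun [set: X] (fun z => moment K z * rho z).
  by apply: measurable_funM; [exact: measurable_moment|exact: measurable_rho].
have md := @measurable_decay R n m gamma q (gamma + q) 1.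
apply: (@le_lt_trans _ _ (((2 / xscale K) `^ gamma)%:E *
    \int[lam]_z (decay gamma q (gamma + q) 1 z)%:E)%E).
  rewrite -ge0_integralZl_EFin//.
  - apply: ge0_le_integral => //.
    + by move=> z _; rewrite lee_fin mulr_ge0 ?moment_ge0 ?rho_ge0.
    + exact/measurable_EFinP.
    + by apply: emeasurable_funM => //; exact/measurable_EFinP.
    + by move=> z _; rewrite -EFinM lee_fin.
  - by move=> z _; rewrite lee_fin decay_ge0.
  - exact/measurable_EFinP.
  - exact: powR_ge0.
have dfin : (\int[lam]_z (decay gamma q (gamma + q) 1 z)%:E < +oo)%E.
  by apply: decay_integral_fin => //; rewrite addr_ge0.
rewrite lte_mul_pinfty// ?lee_fin ?powR_ge0// ge0_fin_numE//.
Qed.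

Section moment_step.
Variables (K a : R) (theta : n.-tuple R -> R).
Hypotheses (K1 : 1 <= K) (a0 : 0 <= a).
Hypothesis t0 : forall x, 0 <= theta x.
Hypothesis tle : forall z : X, theta z.1 <= xpart gamma z / 2 + yscale K.
Hypothesis t2 : forall x, theta x <= 2 * theta (affine xhalf (zvec n) x).

Let tau : R := a * yscale K / (m%:R * (1 + gamma)).

Let m0 : (0 : R) < m%:R. Proof. by rewrite ltr0n. Qed.

Let tau0 : 0 <= tau.
Proof. by rewrite divr_ge0 ?mulr_ge0 ?(ltW (yscale_gt0 q K1)) ?(ltW g1_gt0). Qed.

Definition contract_at (jb : 'I_m * bool) (z : X) : X :=
  affine2 xhalf 1 (zvec n, dvec jb.1 (- ((-1) ^+ jb.2 * tau))) z.

(** X is halved, and the large coordinate of y moves so that Y decreases by at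
    most a yscale K. Hence the point stays in the lowered set if it starts at
    height 2 a yscale K above K. The gain comes from the move of y, since M <= 3Y
    there. *)
Lemma contract_at_gain jb z : lowered K theta z ->
  2 * a * yscale K <= ypart gamma z - K -> coord_piece jb z.2 ->
  [/\ lowered K theta (contract_at jb z),
      moment K z <= 2 `^ gamma * 4 `^ q * moment K (contract_at jb z) &
      rho z <= expR (- ((6 * m%:R ^+ 2)^-1 * a)) * rho (contract_at jb z)].
Proof.
move=> Bz Ya Pz; have [c1 c2 c3] := coord_pieceP Pz tau0.
set c := - _ in c1 c2.
have Lam0 := yscale_gt0 q K1; have Lam1 := yscale_le1 q1 K1.
have L0 := xscale_gt0 gamma q K1.
have K0 : 0 < K by exact: lt_le_trans K1.
have aL0 : 0 <= a * yscale K by rewrite mulr_ge0// ltW.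
have x0 := xpart_ge0 gamma z; have y0 := ypart_ge0 gamma0 z.
pose z' := contract_at jb z.
have X' : xpart gamma z' = xpart gamma z / 2.
  rewrite /xpart /z' /= (@eucl_norm_scale _ _ xhalf _ z.1) ?(ltW xhalf_gt0)//.
    by rewrite powRM ?(ltW xhalf_gt0) ?eucl_norm_ge0// xhalf_powR mulrC.
  by move=> i; rewrite affine_zvec.
have gtau : (1 + gamma) * tau <= a * yscale K.
  have -> : (1 + gamma) * tau = a * yscale K / m%:R.
    by rewrite /tau; field; rewrite !gt_eqF.
  by rewrite ler_pdivrMr// ler_peMr// ler1n.
have Y' : ypart gamma z - a * yscale K <= ypart gamma z'.
  have := dvec_shift_ge jb.1 c z.2; rewrite c2 => h.
  rewrite /ypart /z' /= -/c -/(ypart gamma z).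
  have : (1 + gamma) * (eucl_norm z.2 - tau) <=
     (1 + gamma) * eucl_norm (affine 1 (dvec jb.1 c) z.2) by rewrite ler_pM2l.
  apply: le_trans; rewrite mulrBr /ypart; lra.
have hyj : tau <= `|tnth z.2 jb.1|.
  have h : ypart gamma z <= (1 + gamma) * (m%:R * `|tnth z.2 jb.1|).
    by rewrite ler_pM2l.
  rewrite /tau ler_pdivrMr ?mulr_gt0//.
  have -> : `|tnth z.2 jb.1| * (m%:R * (1 + gamma)) =
    (1 + gamma) * (m%:R * `|tnth z.2 jb.1|) by ring.
  apply: le_trans h; lra.
have XY : xpart gamma z / 2 <= ypart gamma z.
  move: Bz (tle z) Lam1 K1; rewrite /lowered /=.
  move: (xpart gamma z) (ypart gamma z) (theta _) (yscale K).
  by move=> u v w t; lra.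
have M3 : M z <= 3 * ypart gamma z.
  move: (gaugeM_le gamma0 z) XY; move: (M z) (xpart gamma z) (ypart gamma z).
  by move=> u v w; lra.
have MK : K <= M z by have := ypart_le gamma0 z; lra.
have M0 : 0 < M z by exact: lt_le_trans MK.
split.
- move: Bz; rewrite /lowered /= X'; have := t2 z.1.
  by rewrite -[affine xhalf _ _]/(z'.1); lra.
- have M4 : M z <= 4 * M z'.
    have := gaugeM_le gamma0 z; have := xpart_le gamma z'.
    have := ypart_le gamma0 z'; rewrite X'; lra.
  have e1 : (1 + eucl_norm z.1 / xscale K) `^ gamma <=
      2 `^ gamma * (1 + eucl_norm z'.1 / xscale K) `^ gamma.
    have e0 : 0 <= eucl_norm z.1 / xscale K
      by rewrite divr_ge0 ?eucl_norm_ge0// ltW.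
    have e0' : 0 <= eucl_norm z'.1 / xscale K
      by rewrite divr_ge0 ?eucl_norm_ge0// ltW.
    rewrite -powRM// ?addr_ge0// ge0_ler_powR ?nnegrE// ?addr_ge0//.
      by rewrite mulr_ge0// addr_ge0.
    rewrite mulrDr mulr1 lerD// ?ler1n//.
    rewrite mulrA ler_wpM2r ?invr_ge0 ?(ltW L0)//.
    rewrite [eucl_norm z'.1](@eucl_norm_scale _ _ xhalf _ z.1) ?(ltW xhalf_gt0)//.
      rewrite mulrA ler_peMl ?eucl_norm_ge0//.
      by have := xhalf_ge; lra.
    by move=> i; rewrite affine_zvec.
  have e2 : (M z / K) `^ q <= 4 `^ q * (M z' / K) `^ q.
    have m'0 : 0 <= M z' / K by rewrite divr_ge0 ?gaugeM_ge0// ltW.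
    rewrite -powRM// ge0_ler_powR ?nnegrE// ?divr_ge0 ?(ltW M0) ?(ltW K0)//.
    + exact: le_trans q1.
    + by rewrite mulr_ge0.
    + by rewrite mulrA ler_wpM2r// invr_ge0 ltW.
  rewrite /moment; apply: le_trans (ler_pM (powR_ge0 _ _) (powR_ge0 _ _) e1 e2) _.
  by rewrite mulrACA.
- have Mle : M z' <= M (affine2 1 1 (zvec n, dvec jb.1 c) z).
    have Xle : xpart gamma z' <= xpart gamma z by rewrite X'; lra.
    apply: gaugeM_le_of; first exact: gaugeM_ge0.
    rewrite sqr_gaugeM.
    have -> : xpart gamma (affine2 1 1 (zvec n, dvec jb.1 c) z) = xpart gamma z.
      by rewrite /xpart /= affine1_zvec.
    by rewrite lerD2r (ler_pXn2r (ltn0Sn 1)) ?nnegrE ?xpart_ge0.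
  have hyj' : `|c| <= `|tnth z.2 jb.1| by rewrite c2.
  have := powR_yshift_gain gamma0 q1 c1 hyj' c3 M0 (ltr0Sn _ 2) M3.
  rewrite c2; set z1 := affine2 1 1 _ z => G.
  apply: le_trans (_ : _ <= expR (- ((6 * m%:R ^+ 2)^-1 * a)) * rho z1) _.
    rewrite -expRD ler_expR.
    suff : (6 * m%:R ^+ 2)^-1 * a <=
      M z `^ (q - 1) * ((1 + gamma) * tau / (2 * 3 * m%:R)).
      by move=> /le_trans/(_ G) h; rewrite -opprD lerN2 -lerBrDr.
    have -> : (1 + gamma) * tau / (2 * 3 * m%:R) =
      (6 * m%:R ^+ 2)^-1 * a * yscale K.
      by rewrite /tau; field; rewrite !gt_eqF.
    rewrite [leRHS]mulrCA; apply: ler_peMr.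
      by apply: mulr_ge0 => //; rewrite invr_ge0 mulr_ge0// sqr_ge0.
    rewrite -[leLHS](powR_yscale q K1); apply: ler_wpM2r; first exact: ltW.
    by rewrite ge0_ler_powR ?nnegrE ?subr_ge0 ?(ltW K0) ?(ltW M0).
  by apply: ler_wpM2l; [exact: expR_ge0|exact: (rho_le q1 Mle)].
Qed.

(** At height at most 2 a yscale K above K, |x| is at most a multiple of xscale K
    and M at most a multiple of K. *)
Lemma moment_le_low z : lowered K theta z ->
  ypart gamma z - K < 2 * a * yscale K ->
  moment K z <= (4 * a + 3) `^ gamma * (6 * a + 3) `^ q.
Proof.
move=> Bz Ya.
have Lam0 := yscale_gt0 q K1; have Lam1 := yscale_le1 q1 K1.
have L0 := xscale_gt0 gamma q K1.
have K0 : 0 < K by exact: lt_le_trans K1.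
have x0 := xpart_ge0 gamma z; have y0 := ypart_ge0 gamma0 z.
have Xle : xpart gamma z <= (4 * a + 2) * yscale K.
  by move: Bz; rewrite /lowered /=; have := tle z; lra.
have a42 : 1 <= 4 * a + 2 by move: a0; lra.
have xle : eucl_norm z.1 <= (4 * a + 2) * xscale K.
  rewrite leNgt; apply/negP => h.
  have := @gt0_ltr_powR R (1 + gamma) g1_gt0 ((4 * a + 2) * xscale K)
    (eucl_norm z.1).
  rewrite !nnegrE eucl_norm_ge0 mulr_ge0 ?(ltW L0) ?(le_trans ler01)//.
  move=> /(_ isT isT h);
    rewrite -/(xpart gamma z) powRM ?(ltW L0) ?(le_trans ler01)//.
  rewrite powR_xscale// => h'.
  have : (4 * a + 2) * yscale K <= (4 * a + 2) `^ (1 + gamma) * yscale K.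
    by rewrite ler_wpM2r ?(ltW Lam0)// le1r_powR// lerDl.
  lra.
have Mle : M z <= (6 * a + 3) * K.
  apply: le_trans (gaugeM_le gamma0 z) _.
  have : (6 * a + 2) * yscale K <= (6 * a + 2) * K.
    by apply: ler_wpM2l; [move: a0; lra|exact: le_trans K1].
  by move: Xle Ya; lra.
have q0 : 0 <= q by exact: le_trans q1.
rewrite /moment ler_pM ?powR_ge0//.
  rewrite ge0_ler_powR ?nnegrE ?addr_ge0 ?divr_ge0 ?eucl_norm_ge0 ?(ltW L0)
    ?mulr_ge0//.
  suff : eucl_norm z.1 / xscale K <= 4 * a + 2 by lra.
  by rewrite ler_pdivrMr.
rewrite ge0_ler_powR ?nnegrE ?addr_ge0 ?divr_ge0 ?gaugeM_ge0 ?(ltW K0) ?mulr_ge0//.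
by rewrite ler_pdivrMr.
Qed.

End moment_step.

End moments.

Section moment_bound.
Context {R : realType}.
Variables (n m : nat) (gamma q : R).
Hypotheses (hm : (0 < m)%N) (gamma0 : 0 <= gamma) (q1 : 1 <= q).
Notation X := (n.-tuple R * m.-tuple R)%type.
Notation lam := (@lebesgue_tuple R n \x @lebesgue_tuple R m)%E.
Notation M := (@gaugeM R n m gamma).
Notation yscale := (@yscale R q).
Notation xscale := (@xscale R gamma q).
Notation rho := (@rho R n m gamma q).
Notation wgt := (@wgt R n m gamma q).
Notation lowered := (@lowered R n m gamma).
Notation moment := (@moment R n m gamma q).
Notation xhalf := (@xhalf R gamma).

Let g1_gt0 : 0 < 1 + gamma. Proof. by rewrite ltr_pwDl. Qed.

Lemma wgtT_fin : (wgt setT < +oo)%E.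
Proof.
have := @decay_integral_fin R n m gamma q gamma0 q1 0 1 ltr01 (lexx 0).
rewrite /wgt; under eq_integral do rewrite /decay powRr0 !mul1r.
exact.
Qed.

Lemma wgt_fin S : (wgt S < +oo)%E.
Proof.
apply: le_lt_trans wgtT_fin; apply: le_weight => // z.
exact: rho_ge0.
Qed.

Lemma wgt_ge0 S : (0 <= wgt S)%E.
Proof. by apply: weight_ge0 => z; exact: rho_ge0. Qed.

Lemma wgtE S : exists2 r, 0 <= r & wgt S = r%:E.
Proof.
exists (fine (wgt S)); first by rewrite fine_ge0// wgt_ge0.
by rewrite fineK// ge0_fin_numE ?wgt_fin// wgt_ge0.
Qed.

Lemma measurable_contract_region (K a : R) :
  measurable [set z : X | 2 * a * yscale K <= ypart gamma z - K].
Proof.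
apply: measurable_le_set; first exact: measurable_cst.
by apply: measurable_funB => //; exact: measurable_ypart.
Qed.

(** The set S of points at height at least 2 a yscale K is contracted into the
    lowered set. For a large the gain makes the integral over S at most half of
    the whole integral. On the rest the moment is bounded. *)
Lemma moment_bound : exists2 C, 0 < C &
  forall (K : R) (theta : n.-tuple R -> R), 1 <= K ->
  measurable_fun [set: n.-tuple R] theta -> (forall x, 0 <= theta x) ->
  (forall z : X, theta z.1 <= xpart gamma z / 2 + yscale K) ->
  (forall x, theta x <= 2 * theta (affine xhalf (zvec n) x)) ->
  (\int[lam]_(z in lowered K theta) (moment K z * rho z)%:E <=
    C%:E * wgt (lowered K theta))%E.
Proof.
have m0 : (0 : R) < m%:R by rewrite ltr0n.
have h0 := xhalf_gt0 gamma.
pose J := xhalf ^- n * 1 ^- m.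
have J0 : 0 <= J by rewrite mulr_ge0// invr_ge0 exprn_ge0// ltW.
pose c24 : R := 2 `^ gamma * 4 `^ q.
have c240 : 0 <= c24 by rewrite mulr_ge0 ?powR_ge0.
pose b : R := (6 * m%:R ^+ 2)^-1.
have b0 : 0 < b by rewrite invr_gt0 mulr_gt0// exprn_gt0.
have e0 : (0 : R) < 2^-1 by rewrite invr_gt0.
have [a a1 /(_ a (lexx a)) Ha] := expR_eventually_le ((m * 2)%:R * (J * c24)) b0 e0.
have a0 : 0 <= a by exact: le_trans a1.
pose Ca : R := (4 * a + 3) `^ gamma * (6 * a + 3) `^ q.
have Ca0 : 0 < Ca.
  by apply: mulr_gt0; apply: powR_gt0; move: a0; lra.
exists (2 * Ca); first by rewrite mulr_gt0.
move=> K theta K1 mt t0 tle t2.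
set B := lowered K theta; pose f z := moment K z * rho z.
have mB : measurable B by exact: measurable_lowered.
have f0 z : 0 <= f z by rewrite mulr_ge0 ?moment_ge0 ?rho_ge0.
have mf : measurable_fun [set: X] f.
  by apply: measurable_funM; [exact: measurable_moment|exact: measurable_rho].
pose F := (\int[lam]_(z in B) (f z)%:E)%E.
have Ffin : (F < +oo)%E.
  apply: (@le_lt_trans _ _ (\int[lam]_z (moment K z * rho z)%:E)%E).
    exact: le_weight.
  exact: moment_rho_fin.
have [r r0 rE] : exists2 r, 0 <= r & F = r%:E.
  exists (fine F); first by rewrite fine_ge0// /F weight_ge0.
  by rewrite fineK// ge0_fin_numE// /F weight_ge0.
have [s s0 sE] := wgtE B.
pose S := [set z : X | 2 * a * yscale K <= ypart gamma z - K].
have mS : measurable S by exact: measurable_contract_region.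
have low : (\int[lam]_(z in B `\` S) (f z)%:E <= (Ca * s)%:E)%E.
  apply: (@le_trans _ _ (Ca%:E * wgt (B `\` S))%E); last first.
    rewrite [leRHS]EFinM -sE lee_wpmul2l ?lee_fin ?(ltW Ca0)//.
    by apply: le_weight => [z|z []//]; exact: rho_ge0.
  have mBS : measurable (B `\` S) by exact: measurableD.
  rewrite /wgt (weightZ lam (@measurable_rho R n m gamma q)
    (@rho_ge0 R n m gamma q) mBS (ltW Ca0)).
  have Cr0 (z : X) : 0 <= Ca * rho z by exact: mulr_ge0 (ltW Ca0) (rho_ge0 _ _ _).
  have inc : B `\` S `<=` B `\` S by [].
  apply: (le_integral_incl lam f0 Cr0 inc) => z [Bz Sz].
  apply: ler_wpM2r; first exact: rho_ge0.
  have Yz : ypart gamma z - K < 2 * a * yscale K by rewrite ltNge; apply/negP.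
  exact: (moment_le_low gamma0 q1 K1 a0 tle Bz Yz).
pose c1 := J * c24 * expR (- (b * a)).
have c10 : 0 <= c1 by apply: mulr_ge0; [exact: mulr_ge0|exact: expR_ge0].
have high : (\int[lam]_(z in B `&` S) (f z)%:E <= (2^-1 * r)%:E)%E.
  apply: (@le_trans _ _ (\sum_(jb : 'I_m * bool)
      \int[lam]_(z in (B `&` S) `&` (fun z : X => coord_piece jb z.2)) (f z)%:E)%E).
    apply: weight_cover => //.
    - exact: measurableI.
    - move=> jb; rewrite -[X in measurable X]setTI.
      apply: measurable_snd => //; exact: measurable_coord_piece.
    - by move=> z _; exact: coord_piece_cover.
  apply: (@le_trans _ _ (\sum_(jb : 'I_m * bool) (c1 * r)%:E)%E).
    apply: lee_sum => jb _; rewrite [leRHS]EFinM -rE.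
    apply: (integral_transport (al := xhalf) (be := 1)
      (w := (zvec n, dvec jb.1 (- ((-1) ^+ jb.2 * (a * yscale K / (m%:R * (1 +
        gamma)))))))
      h0 ltr01 c10 _ mB mf mf f0 f0).
      apply: measurableI; first exact: measurableI.
      rewrite -[X in measurable X]setTI.
      apply: measurable_snd => //; exact: measurable_coord_piece.
    move=> z [[Bz Sz] Pz].
    have [g1 g2 g3] := contract_at_gain hm gamma0 q1 K1 a0 tle t2 Bz Sz Pz.
    split; first exact: g1.
    have -> : c1 = J * (c24 * expR (- (b * a))) by rewrite /c1 -[LHS]mulrA.
    rewrite -/J -[leRHS]mulrA; apply: ler_wpM2l; first exact: J0.
    set z' := affine2 _ _ _ _.
    apply: le_trans (ler_pM (moment_ge0 _ _ _ _) (rho_ge0 _ _ _) g2 g3) _.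
    by rewrite -[contract_at _ _ _ _ _ _]/z' mulrACA.
  rewrite sumEFin lee_fin sumr_const card_prod card_ord card_bool.
  by rewrite -[leLHS]mulr_natl mulrA ler_wpM2r// /c1 mulrA.
have : (F <= (2^-1 * r)%:E + (Ca * s)%:E)%E.
  by rewrite /F (weight_split _ mf f0 mB mS); exact: leeD.
rewrite -[X in _ -> (X <= _)%E]/F rE sE -EFinD -EFinM !lee_fin -[2 * Ca * s]mulrA.
by move: (Ca * s) => u; lra.
Qed.

End moment_bound.

(** * Enlargements of the extremisers *)

Section enlargement_bound.
Context {R : realType}.
Variables (n m : nat) (gamma q : R).
Hypotheses (hm : (0 < m)%N) (gamma0 : 0 <= gamma) (q1 : 1 <= q).
Notation X := (n.-tuple R * m.-tuple R)%type.
Notation lam := (@lebesgue_tuple R n \x @lebesgue_tuple R m)%E.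
Notation M := (@gaugeM R n m gamma).
Notation yscale := (@yscale R q).
Notation xscale := (@xscale R gamma q).
Notation rho := (@rho R n m gamma q).
Notation wgt := (@wgt R n m gamma q).
Notation lowered := (@lowered R n m gamma).
Notation moment := (@moment R n m gamma q).
Notation xhalf := (@xhalf R gamma).

Let g1_gt0 : 0 < 1 + gamma. Proof. by rewrite ltr_pwDl. Qed.

Lemma extremiserE K : extremiser n m gamma K = lowered K (fun=> 0).
Proof. by apply/seteqP; split => z; rewrite /extremiser /lowered /= subr0. Qed.

Definition horizontal_loss (c eps : R) (x : n.-tuple R) : R :=
  c * eps * (eucl_norm x + n%:R * eps) `^ gamma.

Lemma measurable_horizontal_loss c eps :
  measurable_fun [set: n.-tuple R] (horizontal_loss c eps).
Proof.
apply: measurable_funM => //.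
apply: (measurableT_comp (measurable_powR _)).
by apply: measurable_funD => //; exact: measurable_eucl_norm.
Qed.

(** Along a curve of length less than eps that ends in the extremiser, X and Y
    change by at most a multiple of eps (|x| + n eps)^gamma. *)
Lemma enlargement_sub_lowered : exists2 c, 0 < c &
  forall K eps, 0 < eps ->
  enlargement (cc_dist gamma) (extremiser n m gamma K) eps `<=`
  lowered K (horizontal_loss c eps).
Proof.
have [k k1 Hk] : exists2 k, 1 <= k & forall a b : R, 0 <= b -> b <= a ->
    a `^ (1 + gamma) - b `^ (1 + gamma) <= k * a `^ (1 + gamma - 1) * (a - b).
  by apply: powR_sub_le; rewrite lerDl.
have m0 : (0 : R) < m%:R by rewrite ltr0n.
have k0 : 0 <= k by exact: le_trans k1.
exists ((1 + gamma) * m%:R + k * n%:R).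
  by rewrite ltr_pwDl ?mulr_gt0// mulr_ge0.
move=> K eps eps0 z /enlargement_displacement-/(_ gamma0)[w [Aw dx dy]].
rewrite /lowered /horizontal_loss /=.
set B := eucl_norm z.1 + n%:R * eps.
have B0 : 0 <= B by rewrite addr_ge0 ?eucl_norm_ge0 ?mulr_ge0// ltW.
have zx : eucl_norm z.1 <= eucl_norm w.1 + n%:R * eps.
  by apply: eucl_norm_near_le => i; rewrite distrC.
have wy : eucl_norm w.2 <= eucl_norm z.2 + m%:R * (B `^ gamma * eps).
  exact: eucl_norm_near_le.
have xB : eucl_norm z.1 `^ gamma <= B `^ gamma.
  by rewrite ge0_ler_powR ?nnegrE ?eucl_norm_ge0// lerDl mulr_ge0// ltW.
have XX : xpart gamma z - xpart gamma w <= k * B `^ gamma * (n%:R * eps).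
  have [h|h] := leP (eucl_norm z.1) (eucl_norm w.1).
    apply: (@le_trans _ _ 0).
      by rewrite subr_le0 ge0_ler_powR ?nnegrE ?eucl_norm_ge0// ltW.
    by rewrite !mulr_ge0 ?powR_ge0// ltW.
  apply: le_trans (Hk _ _ (eucl_norm_ge0 _) (ltW h)) _.
  have -> : 1 + gamma - 1 = gamma by ring.
  apply: ler_pM.
  - by rewrite mulr_ge0 ?powR_ge0.
  - by rewrite subr_ge0 ltW.
  - exact: ler_wpM2l.
  - by rewrite lerBlDl.
have YY : ypart gamma w <= ypart gamma z + (1 + gamma) * m%:R * eps * B `^ gamma.
  have : (1 + gamma) * eucl_norm w.2 <=
    (1 + gamma) * (eucl_norm z.2 + m%:R * (B `^ gamma * eps)) by rewrite ler_pM2l.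
  move=> /le_trans; apply; rewrite mulrDr lerD2l le_eqVlt; apply/orP; left.
  by apply/eqP; rewrite (mulrC (B `^ gamma)) !mulrA.
have AA : xpart gamma w + K <= ypart gamma w by exact: Aw.
move: XX YY AA.
move: (xpart gamma z) (xpart gamma w) (ypart gamma z) (ypart gamma w) (B `^ gamma).
by move=> r1 r2 r3 r4 r5 h1 h2 h3; move: h1 h2 h3; lra.
Qed.

Lemma eucl_norm_xhalf (x : n.-tuple R) :
  eucl_norm (affine xhalf (zvec n) x) = xhalf * eucl_norm x.
Proof.
apply: eucl_norm_scale; first exact/ltW/xhalf_gt0.
by move=> i; rewrite affine_zvec.
Qed.

Lemma horizontal_loss_xhalf c eps x : 0 <= c -> 0 <= eps ->
  horizontal_loss c eps x <= 2 * horizontal_loss c eps (affine xhalf (zvec n) x).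
Proof.
move=> c0 e0; rewrite /horizontal_loss eucl_norm_xhalf.
rewrite mulrCA; apply: ler_wpM2l; first exact: mulr_ge0.
have x0 := eucl_norm_ge0 x; have h0 := xhalf_gt0 gamma.
have ne0 : 0 <= n%:R * eps by rewrite mulr_ge0.
have h1 : xhalf <= 1.
  rewrite /xhalf -[leRHS](powRr0 2^-1) ger_powR ?invr_ge0 ?(ltW g1_gt0)//.
  by rewrite invr_gt0 ltr0n/= invf_le1// ler1n.
have : (xhalf * (eucl_norm x + n%:R * eps)) `^ gamma <=
    (xhalf * eucl_norm x + n%:R * eps) `^ gamma.
  rewrite ge0_ler_powR ?nnegrE//.
  - by rewrite mulr_ge0 ?(ltW h0)// addr_ge0.
  - by rewrite addr_ge0// mulr_ge0// ltW.
  - by rewrite mulrDr lerD2l ler_piMl.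
rewrite powRM ?(ltW h0) ?addr_ge0//.
have := xhalf_powR_gamma gamma0; have := powR_ge0 (eucl_norm x + n%:R * eps) gamma.
move: (xhalf `^ gamma) ((eucl_norm x + _) `^ gamma) ((xhalf * _ + _) `^ gamma).
move=> r1 r2 r3.
nra.
Qed.

(** For small eps the loss is at most (xscale K / 2) r^gamma, where r is the
    larger of |x| and xscale K. *)
Lemma horizontal_loss_le c eps K (z : X) : 0 < c -> 0 < eps -> 1 <= K ->
  n%:R * eps <= xscale K -> c * eps * 2 `^ (gamma + 1) <= xscale K ->
  horizontal_loss c eps z.1 <= xpart gamma z / 2 + yscale K.
Proof.
move=> c0 e0 K1 h1 h2; rewrite /horizontal_loss.
have L0 := xscale_gt0 gamma q K1; have Lam0 := yscale_gt0 q K1.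
have x0 := eucl_norm_ge0 z.1.
have ne0 : 0 <= n%:R * eps by rewrite mulr_ge0// ltW.
have ce0 : 0 <= c * eps by rewrite mulr_ge0// ltW.
have p2 : 2 `^ (gamma + 1) = 2 `^ gamma * 2 :> R.
  by rewrite powRD ?powRr1//; apply/implyP => _; rewrite pnatr_eq0.
pose r := Num.max (eucl_norm z.1) (xscale K).
have r0 : 0 <= r by rewrite le_max x0.
have e1 : (eucl_norm z.1 + n%:R * eps) `^ gamma <= 2 `^ gamma * r `^ gamma.
  have s0 : 0 <= eucl_norm z.1 + n%:R * eps by rewrite addr_ge0.
  have r20 : 0 <= 2 * r by rewrite mulr_ge0.
  have sr : eucl_norm z.1 + n%:R * eps <= 2 * r.
    have : eucl_norm z.1 <= r by rewrite le_max lexx.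
    have : xscale K <= r by rewrite le_max lexx orbT.
    by move: h1; lra.
  by rewrite -powRM// ge0_ler_powR ?nnegrE.
have e2 : c * eps * (eucl_norm z.1 + n%:R * eps) `^ gamma <=
  xscale K / 2 * r `^ gamma.
  apply: le_trans (ler_wpM2l ce0 e1) _.
  rewrite mulrA; apply: ler_wpM2r; first exact: powR_ge0.
  by move: h2; rewrite p2; move: (2 `^ gamma) => u; lra.
apply: le_trans e2 _.
have xp0 := xpart_ge0 gamma z.
rewrite /r; case: (leP (eucl_norm z.1) (xscale K)) => h.
  rewrite -mulrA [_^-1 * _]mulrC mulrA -(yscale_xscale q gamma0 K1).
  by move: xp0 Lam0; lra.
have xpE : xpart gamma z = eucl_norm z.1 * eucl_norm z.1 `^ gamma.
  have z0 : 0 < eucl_norm z.1 by exact: lt_trans h.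
  by rewrite /xpart powRD ?powRr1//; apply/implyP => _; rewrite gt_eqF.
have : xscale K * eucl_norm z.1 `^ gamma <= xpart gamma z.
  by rewrite xpE; apply: ler_wpM2r; [exact: powR_ge0|exact: ltW].
rewrite -mulrA [_^-1 * _]mulrC mulrA.
by move: Lam0; lra.
Qed.

(** For the lowered set B that contains the enlargement, the previous bounds give
    wgt B <= wgt A + u (wgt B) with u a multiple of eps / xscale K. For small eps
    u <= 1/2, so wgt B <= 2 (wgt A) on the right. *)
Lemma wgt_enlargement_le : exists2 C, 0 < C & forall K, 2 <= K ->
  exists2 e0, 0 < e0 & forall eps, 0 < eps -> eps < e0 ->
  exists B, [/\ measurable B,
    enlargement (cc_dist gamma) (extremiser n m gamma K) eps `<=` B &
    (wgt B <= wgt (extremiser n m gamma K) +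
      (C * eps / xscale K)%:E * wgt (extremiser n m gamma K))%E].
Proof.
have [c c0 Hc] := enlargement_sub_lowered.
have [C1 C10 H1] := @wgt_lowered_le R n m gamma q gamma0 q1.
have [C2 C20 H2] := @moment_bound R n m gamma q hm gamma0 q1.
pose C := C1 * (c * C2); have C0 : 0 < C by rewrite !mulr_gt0.
exists (2 * C); first by rewrite mulr_gt0.
move=> K K2; have K1 : 1 <= K by move: K2; lra.
have K0 : 0 < K by move: K2; lra.
have L0 := xscale_gt0 gamma q K1; have L1 := xscale_le1 gamma0 q1 K1.
have p20 : 0 < 2 `^ (gamma + 1) :> R by rewrite powR_gt0.
pose D := n%:R + c * 2 `^ (gamma + 1) + 2 * C.
have cp0 : 0 < c * 2 `^ (gamma + 1) by rewrite mulr_gt0.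
have n0 : 0 <= n%:R :> R by [].
have D0 : 0 < D by move: C0 cp0 n0; rewrite /D; lra.
(* each term of D is a smallness condition on eps *)
exists (xscale K / D); first by rewrite divr_gt0.
move=> eps eps0; rewrite ltr_pdivlMr// => epsD.
have [en ec eC] : [/\ n%:R * eps <= xscale K, c * eps * 2 `^ (gamma + 1) <= xscale K
    & 2 * C * eps <= xscale K].
  have h1 : 0 <= n%:R * eps by rewrite mulr_ge0// ltW.
  have h2 : 0 <= c * 2 `^ (gamma + 1) * eps by rewrite mulr_ge0// ltW.
  have h3 : 0 <= C * eps by rewrite mulr_ge0// ltW.
  have : eps * D = n%:R * eps + c * 2 `^ (gamma + 1) * eps + 2 * (C * eps).
    by rewrite /D; ring.
  rewrite [c * eps * _]mulrAC -[2 * C * eps]mulrA.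
  by split; move: epsD h1 h2 h3; lra.
pose theta := horizontal_loss c eps.
have mt : measurable_fun [set: n.-tuple R] theta.
  exact: measurable_horizontal_loss.
have t0 x : 0 <= theta x.
  by rewrite /theta /horizontal_loss mulr_ge0 ?powR_ge0// mulr_ge0// ltW.
have tle (z : X) : theta z.1 <= xpart gamma z / 2 + yscale K.
  exact: horizontal_loss_le.
have tle2 (z : X) : theta z.1 <= (xpart gamma z + K) / 2.
  by have := tle z; have := yscale_le1 q1 K1; move: K2; lra.
have t2 x : theta x <= 2 * theta (affine xhalf (zvec n) x).
  by apply: horizontal_loss_xhalf; exact: ltW.
pose B := lowered K theta; pose A := extremiser n m gamma K.
have mB : measurable B by exact: measurable_lowered.
have HB := H1 K theta K0 mt t0 tle2; rewrite -extremiserE -/A -/B in HB.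
have HM := H2 K theta K1 mt t0 tle t2; rewrite -/B in HM.
have mm : measurable_fun [set: X] (fun z => moment K z * rho z).
  by apply: measurable_funM; [exact: measurable_moment|exact: measurable_rho].
have mm0 z : 0 <= moment K z * rho z by rewrite mulr_ge0 ?moment_ge0 ?rho_ge0.
have XK (z : X) : 0 < xpart gamma z + K by rewrite ltr_wpDl// xpart_ge0.
have pw (z : X) : theta z.1 / (xpart gamma z + K) * M z `^ q * rho z <=
    c * eps / xscale K * (moment K z * rho z).
  rewrite mulrA; apply: ler_wpM2r; first exact: rho_ge0.
  have M0 := gaugeM_ge0 gamma z; have x0 := eucl_norm_ge0 z.1.
  have e1 : theta z.1 <= c * eps * (xscale K `^ gamma * (1 + eucl_norm z.1 /
    xscale K) `^ gamma).
    apply: ler_wpM2l; first by rewrite mulr_ge0// ltW.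
    have h : 0 <= 1 + eucl_norm z.1 / xscale K by rewrite addr_ge0// divr_ge0// ltW.
    rewrite -powRM ?(ltW L0)// ge0_ler_powR ?nnegrE//.
    - by rewrite addr_ge0// mulr_ge0// ltW.
    - by rewrite mulr_ge0// ltW.
    - rewrite mulrDr mulr1 mulrCA divff ?gt_eqF// mulr1 addrC.
      by rewrite lerD2r.
  have e2 : (xpart gamma z + K)^-1 * M z `^ q <= K `^ (q - 1) * (M z / K) `^ q.
    have -> : K `^ (q - 1) * (M z / K) `^ q = K^-1 * M z `^ q.
      have q0 : 0 < q by exact: lt_le_trans q1.
      rewrite powRM ?invr_ge0 ?(ltW K0)// mulrCA mulrC; congr (_ * _).
      rewrite -powR_inv1 ?(ltW K0)// -powRrM mulN1r -powRD.
        by have -> : q - 1 + - q = -1 by ring.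
      by apply/implyP => _; rewrite gt_eqF.
    apply: ler_wpM2r; first exact: powR_ge0.
    by rewrite lef_pV2 ?posrE// lerDr xpart_ge0.
  rewrite -mulrA; apply: le_trans (ler_pM (t0 _) _ e1 e2) _.
    by apply: mulr_ge0; [rewrite invr_ge0 ltW|exact: powR_ge0].
  have -> : c * eps / xscale K = c * eps * (xscale K `^ gamma * K `^ (q - 1)).
    by rewrite powR_xscale_gamma.
  rewrite /moment.
  move: (xscale K `^ gamma) (K `^ (q - 1)) ((1 + _) `^ gamma) ((M z / K) `^ q).
  by move=> r1 r2 r3 r4; rewrite le_eqVlt; apply/orP; left; apply/eqP; ring.
have HI : (\int[lam]_(z in B) (theta z.1 / (xpart gamma z + K) * M z `^ q * rho
  z)%:E <=
    (c * eps / xscale K)%:E * \int[lam]_(z in B) (moment K z * rho z)%:E)%E.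
  have k0 : 0 <= c * eps / xscale K by rewrite divr_ge0 ?mulr_ge0// ltW.
  rewrite -ge0_integralZl_EFin//; last 2 first.
  - by move=> z _; rewrite lee_fin.
  - exact/measurable_EFinP/measurable_funTS.
  apply: le_integral_incl => // z.
    apply: mulr_ge0; last exact: rho_ge0.
    apply: mulr_ge0; last exact: powR_ge0.
    by apply: divr_ge0 => //; exact: ltW.
  exact: mulr_ge0.
have [a a0 aE] := wgtE gamma0 q1 A.
have [b b0 bE] := wgtE gamma0 q1 B.
have ba : b <= a + C * eps / xscale K * b.
  rewrite -lee_fin EFinD -aE EFinM -bE.
  apply: le_trans HB _; apply: leeD => //.
  apply: (@le_trans _ _ (C1%:E * ((c * eps / xscale K)%:E * (C2%:E * wgt B)))%E).
    apply: lee_wpmul2l; first by rewrite lee_fin ltW.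
    apply: le_trans HI _; apply: lee_wpmul2l; last exact: HM.
    by rewrite lee_fin divr_ge0 ?mulr_ge0// ltW.
  rewrite bE -!EFinM lee_fin /C le_eqVlt; apply/orP; left; apply/eqP.
  by move: (xscale K)^-1 => u; ring.
exists B; split => //; first exact: Hc.
rewrite -/A aE bE -EFinM -EFinD lee_fin.
have u0 : 0 <= C * eps / xscale K by rewrite divr_ge0 ?mulr_ge0// ltW.
have u2 : C * eps / xscale K <= 2^-1.
  by rewrite ler_pdivrMr//; move: eC; lra.
have -> : 2 * C * eps / xscale K = 2 * (C * eps / xscale K) by rewrite -!mulrA.
move: (C * eps / xscale K) u0 u2 ba a0 b0 => u u0 u2 ba a0 b0.
have : u * b <= 2^-1 * b by apply: ler_wpM2r.
have : b <= 2 * a -> u * b <= u * (2 * a) by move=> ?; apply: ler_wpM2l.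
by move: ba; lra.
Qed.

End enlargement_bound.

(** * The mass of the extremisers *)

Section mass.
Context {R : realType}.
Variables (n m : nat) (gamma q : R).
Hypotheses (hm : (0 < m)%N) (gamma0 : 0 <= gamma) (q1 : 1 <= q).
Notation X := (n.-tuple R * m.-tuple R)%type.
Notation lam := (@lebesgue_tuple R n \x @lebesgue_tuple R m)%E.
Notation M := (@gaugeM R n m gamma).
Notation rho := (@rho R n m gamma q).
Notation wgt := (@wgt R n m gamma q).
Notation lowered := (@lowered R n m gamma).
Notation A := (@extremiser R n m gamma).

Let g1_gt0 : 0 < 1 + gamma. Proof. by rewrite ltr_pwDl. Qed.
Let q0 : 0 < q. Proof. exact: lt_le_trans q1. Qed.

Lemma measurable_extremiser K : measurable (A K).
Proof. by rewrite extremiserE; exact: measurable_lowered. Qed.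

Lemma extremiser_gaugeM K z : A K z -> K <= M z.
Proof.
rewrite /extremiser /= => Az; apply: le_trans (ypart_le gamma0 z).
apply: le_trans Az; rewrite lerDr; exact: powR_ge0.
Qed.

Lemma le_extremiser K K' : K <= K' -> A K' `<=` A K.
Proof. by move=> KK z; rewrite /extremiser /=; apply: le_trans; rewrite lerD2l. Qed.

(** A unit box inside the extremiser, at bounded distance from its lowest
    points, gives the bound. *)
Lemma mass_lower : exists2 c, 0 < c & forall K, 0 <= K ->
  ((expR (- ((K + c) `^ q)))%:E <= wgt (A K))%E.
Proof.
pose N0 : R := n%:R `^ (1 + gamma).
have N00 : 0 <= N0 by exact: powR_ge0.
pose j0 := Ordinal hm.
exists (N0 + (N0 + (1 + gamma) * m%:R)).
  by rewrite ltr_wpDl// ltr_wpDl// mulr_gt0// ltr0n.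
move=> K K0; pose k := (K + N0) / (1 + gamma).
have k0 : 0 <= k by rewrite divr_ge0 ?addr_ge0// ltW.
have kE : (1 + gamma) * k = K + N0 by rewrite mulrC divfK// gt_eqF.
pose I (i : 'I_n) : set R := [set` `[0, 1]].
pose J (j : 'I_m) : set R := [set` `[tnth (dvec j0 k) j, tnth (dvec j0 k) j + 1]].
have IE i x : I i x -> 0 <= x <= 1 by rewrite /I /= in_itv.
have JE j x : J j x -> tnth (dvec j0 k) j <= x <= tnth (dvec j0 k) j + 1.
  by rewrite /J /= in_itv.
have mI i : measurable (I i) by exact: measurable_itv.
have mJ j : measurable (J j) by exact: measurable_itv.
have lI i : lebesgue_measure (I i) = 1%:E.
  by rewrite lebesgue_measure_itv/= lte_fin ltr01 oppr0 adde0.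
have lJ j : lebesgue_measure (J j) = 1%:E.
  rewrite lebesgue_measure_itv/= lte_fin ltrDl ltr01 -EFinB; congr EFin.
  by rewrite addrC addKr.
have lB : lam (box I J) = 1%:E.
  by rewrite lebesgue_box// !(prod_EFin (c := fun=> 1))// !big1// -EFinM mul1r.
have Xle z : box I J z -> xpart gamma z <= N0.
  move=> [hx _]; rewrite ge0_ler_powR ?nnegrE ?eucl_norm_ge0 ?(ltW g1_gt0)//.
  rewrite -[leRHS]mulr1; apply: eucl_norm_le_sup => i.
  by have /IE/andP[x0 x1] := hx i; rewrite ger0_norm.
have BA : box I J `<=` A K.
  move=> z [hx hy]; rewrite /extremiser /=.
  apply: (@le_trans _ _ ((1 + gamma) * k)).
    by rewrite kE [leRHS]addrC lerD2r; exact: Xle.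
  rewrite ler_pM2l//; have /JE := hy j0; rewrite tnth_mktuple eqxx.
  move=> /andP[ky _]; apply: le_trans ky _.
  exact: le_trans (ler_norm _) (tnth_le_eucl_norm _ _).
have rB z : box I J z ->
    expR (- ((K + (N0 + (N0 + (1 + gamma) * m%:R))) `^ q)) <= rho z.
  move=> Bz; rewrite ler_expR lerN2 ge0_ler_powR ?nnegrE ?gaugeM_ge0 ?(ltW q0)//.
    by rewrite !addr_ge0// mulr_ge0// ltW.
  apply: le_trans (gaugeM_le gamma0 z) _.
  have yle : eucl_norm z.2 <= k + m%:R.
    have := @eucl_norm_near_le _ _ (dvec j0 k) z.2 1.
    rewrite eucl_norm_dvec ger0_norm// mulr1; apply => j.
    have [_ hy] := Bz; have /JE/andP[y0 y1] := hy j.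
    by rewrite ger0_norm ?subr_ge0// lerBlDl.
  have : ypart gamma z <= (1 + gamma) * (k + m%:R) by rewrite ler_pM2l.
  have := Xle _ Bz.
  by rewrite mulrDr kE; move: ((1 + gamma) * m%:R) => u; lra.
apply: (@le_trans _ _ (wgt (box I J))); last first.
  by apply: le_weight => // z; exact: rho_ge0.
have mB : measurable (box I J) by exact: measurable_box.
have mr := @measurable_rho R n m gamma q.
rewrite -[leLHS]mule1 -[X in (_ * X <= _)%E]lB.
exact: (weight_ge_bound _ mr mB (expR_ge0 _) rB).
Qed.

(** Where M >= K, exp(-M^q) <= exp(-(1-b) K^q) exp(-b M^q). *)
Lemma tail_upper b : 0 < b -> b <= 1 -> exists2 D, 0 < D & forall K, 0 <= K ->
  (wgt [set z | (K <= M z)%R] <= (D * expR (- ((1 - b) * K `^ q)))%:E)%E.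
Proof.
move=> b0 b1.
have := @decay_integral_fin R n m gamma q gamma0 q1 0 b b0 (lexx 0).
set I := (\int[_]_z _)%E => Ifin.
have d0 := @decay_ge0 R n m gamma q 0 b.
have I0 : (0 <= I)%E by apply: integral_ge0 => z _; rewrite lee_fin.
have IE : I = (fine I)%:E by rewrite fineK// ge0_fin_numE.
exists (fine I + 1); first by rewrite ltr_wpDl// fine_ge0.
move=> K K0; set e := expR _.
have md := @measurable_decay R n m gamma q 0 b.
apply: (@le_trans _ _ (e%:E * I)%E); last first.
  by rewrite IE -EFinM lee_fin mulrC ler_wpM2r ?expR_ge0// lerDl.
rewrite /I -ge0_integralZl_EFin ?expR_ge0//; last 2 first.
- by move=> z _; rewrite lee_fin.
- exact/measurable_EFinP.
rewrite /wgt; under [leRHS]eq_integral do rewrite -EFinM.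
apply: le_integral_incl => //; first by move=> z; exact: rho_ge0.
  by move=> z; rewrite mulr_ge0 ?expR_ge0.
move=> z /= Kz; rewrite /decay powRr0 mul1r -expRD ler_expR.
have : (1 - b) * K `^ q <= (1 - b) * M z `^ q.
  rewrite ler_wpM2l ?subr_ge0// ge0_ler_powR ?nnegrE ?gaugeM_ge0//.
  exact: ltW.
by move: (M z `^ q) (K `^ q) => u v; lra.
Qed.

Lemma mass_upper : exists2 D, 0 < D & forall K, 0 <= K ->
  (wgt (A K) <= (D * expR (- (K `^ q / 2)))%:E)%E.
Proof.
have [||D D0 H] := @tail_upper 2^-1; rewrite ?invr_gt0// ?invf_le1 ?ler1n//.
exists D => // K K0.
apply: (@le_trans _ _ (wgt [set z | (K <= M z)%R])).
  apply: le_weight => [z|z]; first exact: rho_ge0.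
  exact: extremiser_gaugeM.
apply: le_trans (H K K0) _; rewrite lee_fin.
by have -> : (1 - 2^-1) * K `^ q = K `^ q / 2 by [field]; rewrite lexx.
Qed.

(** This is wgt_lowered_le for a constant theta. *)
Lemma mass_lipschitz : exists2 C, 0 < C & forall K t, 2 <= K -> 0 <= t -> t <= 1 ->
  (wgt (A (K - t)) <= wgt (A K) + (C * t)%:E)%E.
Proof.
have [C1 C10 H1] := @wgt_lowered_le R n m gamma q gamma0 q1.
have := @decay_integral_fin R n m gamma q gamma0 q1 q 1 ltr01 (ltW q0).
set I := (\int[_]_z _)%E => Ifin.
have d0 := @decay_ge0 R n m gamma q q 1.
have I0 : (0 <= I)%E by apply: integral_ge0 => z _; rewrite lee_fin.
have IE : I = (fine I)%:E by rewrite fineK// ge0_fin_numE.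
have fI0 : 0 <= fine I by rewrite fine_ge0.
exists (C1 * (fine I + 1)); first by rewrite mulr_gt0// ltr_wpDl.
move=> K t K2 t0 t1.
have K0 : 0 < K by move: K2; lra.
have EA : A (K - t) = lowered K (fun=> t).
  by apply/seteqP; split => z; rewrite /extremiser /lowered /= addrA.
have tle (z : X) : t <= (xpart gamma z + K) / 2.
  by have := xpart_ge0 gamma z; move: K2 t1; lra.
rewrite EA [in leRHS]extremiserE.
apply: le_trans (H1 K (fun=> t) K0 (measurable_cst t) (fun=> t0) tle) _.
apply: leeD => //.
have md := @measurable_decay R n m gamma q q 1.
have le1 : (\int[lam]_(z in lowered K (fun=> t))
    (t / (xpart gamma z + K) * M z `^ q * rho z)%:E <= t%:E * I)%E.
  rewrite /I -ge0_integralZl_EFin//; last 2 first.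
  - by move=> z _; rewrite lee_fin.
  - exact/measurable_EFinP.
  under [leRHS]eq_integral do rewrite -EFinM.
  have XK (z : X) : 1 <= xpart gamma z + K.
    by have := xpart_ge0 gamma z; move: K2; lra.
  apply: le_integral_incl => //.
  - move=> z; apply: mulr_ge0; last exact: rho_ge0.
    apply: mulr_ge0; last exact: powR_ge0.
    by apply: divr_ge0 => //; exact: le_trans (XK z).
  - by move=> z; rewrite mulr_ge0.
  move=> z _; rewrite /decay mul1r -/(rho z) mulrA.
  apply: ler_wpM2r; first exact: rho_ge0.
  apply: ler_pM.
  - by apply: divr_ge0 => //; exact: le_trans (XK z).
  - exact: powR_ge0.
  - rewrite ler_pdivrMr; last exact: lt_le_trans (XK z).
    by rewrite ler_peMr.
  - rewrite ge0_ler_powR ?nnegrE ?gaugeM_ge0 ?addr_ge0 ?gaugeM_ge0 ?(ltW q0)//.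
    by rewrite lerDr.
apply: (@le_trans _ _ (C1%:E * (t%:E * I))%E).
  by apply: lee_wpmul2l => //; rewrite lee_fin ltW.
rewrite IE -!EFinM lee_fin -mulrA ler_pM2l// mulrC.
by rewrite ler_wpM2r// lerDl.
Qed.

Definition extremiser_mass K : R := fine (wgt (A K)).

Lemma extremiser_massE K : wgt (A K) = (extremiser_mass K)%:E.
Proof. by have [r _ rE] := wgtE gamma0 q1 (A K); rewrite /extremiser_mass rE. Qed.

Lemma extremiser_mass_gt0 K : 0 <= K -> 0 < extremiser_mass K.
Proof.
move=> K0; have [c c0 /(_ K K0)] := mass_lower; rewrite extremiser_massE lee_fin.
by apply: lt_le_trans; exact: expR_gt0.
Qed.

Lemma extremiser_mass_decr K K' : K <= K' ->
  extremiser_mass K' <= extremiser_mass K.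
Proof.
move=> KK; rewrite -lee_fin -!extremiser_massE; apply: le_weight.
  by move=> z; exact: rho_ge0.
exact: le_extremiser.
Qed.

Lemma extremiser_mass_continuous K : 3 <= K -> {for K, continuous extremiser_mass}.
Proof.
move=> K3; have [C C0 H] := mass_lipschitz.
have lip a b : 2 <= a -> 2 <= b -> `|a - b| <= 1 ->
    `|extremiser_mass a - extremiser_mass b| <= C * `|a - b|.
  wlog ab : a b / a <= b.
    move=> W a2 b2 ab1; have [ab|/ltW ba] := leP a b; first exact: W.
    by rewrite distrC [in leRHS]distrC; apply: W => //; rewrite distrC.
  move=> a2 b2; rewrite distrC ger0_norm ?subr_ge0// => ab1.
  have ba0 : 0 <= b - a by rewrite subr_ge0.
  have := H b (b - a) b2 ba0 ab1; rewrite subKr !extremiser_massE -EFinD lee_fin.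
  by rewrite ger0_norm ?subr_ge0 ?extremiser_mass_decr//; lra.
have nearK d : 0 < d -> \forall x \near K, `|K - x| <= d.
  by move=> d0; exists d => // y /= /ltW.
apply/cvgrPdist_le => e e0; near=> x.
have x1 : `|K - x| <= 1.
  by near: x; exact: nearK.
have xe : `|K - x| <= e / C.
  by near: x; apply: nearK; rewrite divr_gt0.
apply: le_trans (lip _ _ _ _ x1) _.
- by move: K3; lra.
- by move: x1; rewrite ler_norml => /andP[_]; move: K3; lra.
- by rewrite mulrC -ler_pdivlMr.
Unshelve. all: by end_near. Qed.

Lemma extremiser_mass_range K0 : 3 <= K0 ->
  [set extremiser_mass K | K in [set K | K0 <= K]] = [set t | 0 < t <=
    extremiser_mass K0].
Proof.
move=> K3; have K00 : 0 <= K0 by move: K3; lra.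
apply/seteqP; split => [_ [K /= KK <-]|t /= /andP[t0 tK]].
  by rewrite extremiser_mass_gt0 ?extremiser_mass_decr// (le_trans K00).
have [D D0 HD] := mass_upper.
have b0 : 0 < (2^-1 : R) by rewrite invr_gt0.
have [K1 K11 HK1] := expR_eventually_le D b0 t0.
pose K2 := Num.max K0 K1.
have K02 : K0 <= K2 by rewrite le_max lexx.
have K20 : 0 <= K2 by exact: le_trans K02.
have K21 : 1 <= K2 by move: K02 K3; lra.
have m2 : extremiser_mass K2 <= t.
  have := HD K2 K20; rewrite extremiser_massE lee_fin => /le_trans; apply.
  have K12 : K1 <= K2 by rewrite le_max lexx orbT.
  apply: le_trans (HK1 K2 K12).
  rewrite ler_pM2l// ler_expR lerN2 mulrC ler_pM2r//.
  exact: le1r_powR.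
have := @IVT R extremiser_mass K0 K2 t K02.
case.
- apply: continuous_in_subspaceT => x; rewrite inE/= in_itv/= => /andP[x0 _].
  by apply: extremiser_mass_continuous; exact: le_trans x0.
- by rewrite ge_min m2 orbT le_max tK.
by move=> K; rewrite in_itv/= => /andP[KK _] <-; exists K.
Qed.

End mass.

(** * Leaving a set along a path *)

Section crossing.
Context {R : realType}.
Variables (n m : nat) (gamma q : R).
Hypotheses (gamma0 : 0 <= gamma) (q1 : 1 <= q).
Notation X := (n.-tuple R * m.-tuple R)%type.
Notation M := (@gaugeM R n m gamma).
Notation rho := (@rho R n m gamma q).
Notation wgt := (@wgt R n m gamma q).

Definition scalev k (s : R) (v : k.-tuple R) : k.-tuple R :=
  [tuple s * tnth v i | i < k].

Definition translate (v : X) (s : R) (z : X) : X :=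
  affine2 1 1 (scalev s v.1, scalev s v.2) z.

Lemma translate0 v z : translate v 0 z = z.
Proof.
case: z => x y; rewrite /translate /affine2 /=; congr pair;
  by apply: eq_from_tnth => i; rewrite !tnth_mktuple mul1r mul0r addr0.
Qed.

Lemma translateK v s : cancel (translate v s) (translate v (- s)).
Proof.
move=> [x y]; rewrite /translate /affine2 /=; congr pair;
  by apply: eq_from_tnth => i; rewrite !tnth_mktuple !mul1r mulNr addrK.
Qed.

Lemma translateNK v s : cancel (translate v (- s)) (translate v s).
Proof. by move=> z; have := translateK v (- s) z; rewrite opprK. Qed.

Lemma measurable_translate v s : measurable_fun [set: X] (translate v s).
Proof. exact: measurable_affine2. Qed.

Lemma measurable_translate_preimage v s (A : set X) : measurable A ->
  measurable (translate v s @^-1` A).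
Proof.
by move=> mA; rewrite -[X in measurable X]setTI; exact: measurable_translate.
Qed.

Lemma wgt_translate_le v s (P Q : set X) (C : R) : 0 <= C ->
  measurable P -> measurable Q ->
  (forall z, P z -> Q (translate v s z) /\ rho z <= C * rho (translate v s z)) ->
  (wgt P <= C%:E * wgt Q)%E.
Proof.
move=> C0 mP mQ H; have mr := @measurable_rho R n m gamma q.
have r0 := @rho_ge0 R n m gamma q.
apply: (integral_transport (w := (scalev s v.1, scalev s v.2)) ltr01 ltr01 C0 mP mQ
  mr mr r0 r0).
move=> z /H[Qz le]; split; first exact: Qz.
rewrite (expr1n R n) (expr1n R m) invr1 !mul1r; exact: le.
Qed.

(** The mass of the enlargement outside A is tested on measurable subsets, as
    the enlargement is not shown to be measurable. *)
Definition outer_mass_le (A : set X) (eps Delta : R) := forall S, measurable S ->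
  S `<=` enlargement (cc_dist gamma) A eps -> S `&` A = set0 ->
  (wgt S <= Delta%:E)%E.

Section one_set.
Variables (A : set X) (eps Delta : R).
Hypothesis mA : measurable A.
Hypothesis HDelta : outer_mass_le A eps Delta.

(** Cut the segment into N steps of length less than eps. If its end is outside
    A, one of the steps goes from A to a point outside A, which is in the
    enlargement. *)
Lemma crossing (P : set X) (v : X) (l C : R) (N : nat) :
  (0 < N)%N -> measurable P -> P `<=` A -> 0 <= C -> l < N%:R * eps ->
  (forall z s s', P z -> 0 <= s <= 1 -> 0 <= s' <= 1 ->
     (cc_dist gamma (translate v s z) (translate v s' z) <=
       (l * `|s - s'|)%:E)%E) ->
  (forall z s, P z -> 0 <= s <= 1 -> rho z <= C * rho (translate v s z)) ->
  (wgt [set z | P z /\ ~ A (translate v 1 z)] <= (N%:R * (C * Delta))%:E)%E.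
Proof.
move=> N0 mP PA C0 lN Hd Hr.
have N0' : (0 : R) < N%:R by rewrite ltr0n.
pose st (k : nat) : R := k%:R / N%:R.
have st01 k : (k <= N)%N -> 0 <= st k <= 1.
  by move=> kN; rewrite divr_ge0//= ler_pdivrMr// mul1r ler_nat.
pose Q (k : 'I_N) := P `&` (translate v (st k) @^-1` A) `\` (translate v (st
  k.+1) @^-1` A).
have mQ k : measurable (Q k).
  apply: measurableD; last exact: measurable_translate_preimage.
  by apply: measurableI => //; exact: measurable_translate_preimage.
have mS : measurable [set z | P z /\ ~ A (translate v 1 z)].
  have -> : [set z | P z /\ ~ A (translate v 1 z)] =
    P `\` (translate v 1 @^-1` A) by [].
  by apply: measurableD => //; exact: measurable_translate_preimage.
have mr := @measurable_rho R n m gamma q.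
have r0 := @rho_ge0 R n m gamma q.
have cov z : [set z | P z /\ ~ A (translate v 1 z)] z -> exists k, Q k z.
  move=> [Pz Az]; apply: contrapT => nex.
  suff H k : (k <= N)%N -> A (translate v (st k) z).
    by apply: Az; have := H N (leqnn N); rewrite /st divff// gt_eqF.
  elim: k => [|k IH] kN; first by rewrite /st mul0r translate0; exact: PA.
  apply: contrapT => nA; apply: nex; exists (Ordinal kN); split => //; split => //.
  by apply: IH; exact: ltnW.
apply: le_trans (weight_cover _ mr r0 mS mQ cov) _.
have QD k : (wgt (Q k) <= (C * Delta)%:E)%E.
  pose S := translate v (- st k.+1) @^-1` Q k.
  have mS' : measurable S by exact: measurable_translate_preimage.
  have st1 := st01 k (ltnW (ltn_ord k)); have st2 := st01 k.+1 (ltn_ord k).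
  apply: (@le_trans _ _ (C%:E * wgt S)%E).
    apply: (wgt_translate_le (v := v) (s := st k.+1)) => // z Qz; split.
      by rewrite /S /= translateK.
    by apply: Hr => //; case: Qz => -[].
  rewrite EFinM lee_wpmul2l ?lee_fin//; apply: HDelta => //.
  - move=> z'; rewrite /S /=; set z := translate v (- st k.+1) z' => -[[Pz Az] _].
    have zE : z' = translate v (st k.+1) z by rewrite translateNK.
    have := Hd z (st k.+1) (st k) Pz st2 st1; rewrite -zE => dle.
    apply: (enlargement_mem dle _ Az).
    have -> : st k.+1 - st k = N%:R^-1.
      by rewrite /st -mulrBl -natr1 addrAC subrr add0r mul1r.
    by rewrite ger0_norm ?invr_ge0// ltr_pdivrMr// mulrC.
  - apply/seteqP; split => // z' []; rewrite /S /=.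
    by move=> [_] /=; rewrite translateNK.
apply: (@le_trans _ _ (\sum_(k < N) (C * Delta)%:E)%E).
  apply: lee_sum => k _; apply: le_trans (QD k).
  by apply: le_weight => // z [].
by rewrite sumEFin sumr_const card_ord lee_fin -[leLHS]mulr_natl.
Qed.

Lemma wgt_return_le (P : set X) (v : X) (C : R) : 0 <= C -> measurable P ->
  (forall z, P z -> rho z <= C * rho (translate v 1 z)) ->
  (wgt [set z | P z /\ A (translate v 1 z)] <= C%:E * wgt A)%E.
Proof.
move=> C0 mP H; apply: (wgt_translate_le (v := v) (s := 1)) => //.
- have -> : [set z | P z /\ A (translate v 1 z)] =
  P `&` (translate v 1 @^-1` A) by [].
  by apply: measurableI => //; exact: measurable_translate_preimage.
- by move=> z [Pz Az]; split => //; exact: H.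
Qed.

Lemma outer_mass_ge0 : 0 <= Delta.
Proof.
have := HDelta measurable0 (@sub0set _ _) (set0I _).
by rewrite /wgt integral_set0 lee_fin.
Qed.

Lemma crossing_real (P : set X) (v : X) (l C : R) :
  measurable P -> P `<=` A -> 0 <= C -> 0 < eps -> eps <= l ->
  (forall z s s', P z -> 0 <= s <= 1 -> 0 <= s' <= 1 ->
     (cc_dist gamma (translate v s z) (translate v s' z) <=
       (l * `|s - s'|)%:E)%E) ->
  (forall z s, P z -> 0 <= s <= 1 -> rho z <= C * rho (translate v s z)) ->
  (wgt [set z | P z /\ ~ A (translate v 1 z)] <= (2 * l / eps * (C * Delta))%:E)%E.
Proof.
move=> mP PA C0 e0 el Hd Hr.
have le1 : 1 <= l / eps by rewrite ler_pdivlMr// mul1r.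
have le0 : 0 <= l / eps by exact: le_trans le1.
pose N := (Num.truncn (l / eps)).+1.
have /andP[N1 N2] := truncn_itv le0.
apply: le_trans (crossing (N := N) (l := l) (C := C) _ mP PA C0 _ Hd Hr) _ => //.
  by rewrite -ltr_pdivrMr.
rewrite lee_fin; apply: ler_wpM2r; first by rewrite mulr_ge0// outer_mass_ge0.
rewrite /N -natr1 -mulrA; move: (l / eps) N1 le1 => u; lra.
Qed.

End one_set.

Lemma translate_xy (u : n.-tuple R) (h : m.-tuple R) z :
  translate (zvec n, h) 1 (translate (u, zvec m) 1 z) = translate (u, h) 1 z.
Proof.
case: z => x y; rewrite /translate /affine2 /=; congr pair;
  by apply: eq_from_tnth => i; rewrite !tnth_mktuple !mul1r addr0.
Qed.

Lemma scalev_zvec k s : scalev s (zvec k) = zvec k :> k.-tuple R.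
Proof. by apply: eq_from_tnth => i; rewrite !tnth_mktuple mulr0. Qed.

Lemma eucl_norm_scalev k s (v : k.-tuple R) : eucl_norm (scalev s v) =
  `|s| * eucl_norm v.
Proof.
have -> : eucl_norm (scalev s v) = eucl_norm (scalev `|s| v).
  rewrite /eucl_norm; congr Num.sqrt; apply: eq_bigr => i _.
  by rewrite !tnth_mktuple !exprMn real_normK ?num_real.
by apply: eucl_norm_scale => // i; rewrite tnth_mktuple.
Qed.

Lemma scalevB k s s' (v x : k.-tuple R) :
  affine 1 (scalev s' v) x = affine 1 (scalev (s' - s) v) (affine 1 (scalev s v) x).
Proof.
by apply: eq_from_tnth => i; rewrite !tnth_mktuple; ring.
Qed.

Lemma cc_dist_translate_along_x (u : n.-tuple R) z s s' :
  (cc_dist gamma (translate (u, zvec m) s z) (translate (u, zvec m) s' z) <=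
   (eucl_norm u * `|s - s'|)%:E)%E.
Proof.
rewrite /translate /affine2 /= !scalev_zvec !affine1_zvec (scalevB s s' u).
apply: le_trans (cc_dist_move_x _ _ _ _) _ => //.
by rewrite lee_fin eucl_norm_scalev mulrC distrC.
Qed.

Lemma cc_dist_translate_along_y (h : m.-tuple R) z s s' : 0 < eucl_norm z.1 ->
  (cc_dist gamma (translate (zvec n, h) s z) (translate (zvec n, h) s' z) <=
   (eucl_norm h / eucl_norm z.1 `^ gamma * `|s - s'|)%:E)%E.
Proof.
move=> z0; rewrite /translate /affine2 /= !scalev_zvec !affine1_zvec (scalevB s
  s' h).
apply: le_trans (cc_dist_move_y _ _ _ z0) _.
by rewrite lee_fin eucl_norm_scalev [in leLHS]distrC -[leLHS]mulrA [leLHS]mulrC.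
Qed.

(** First x moves by u, then y by h, so that the length of the second leg is
    measured with the new |x|. A point that does not end in A leaves A along one
    of the legs. *)
Lemma two_leg (A P : set X) (eps Delta l C1 C2 E : R) u h :
  measurable A ->
  outer_mass_le A eps Delta -> measurable P -> P `<=` A -> 0 <= C1 ->
    0 <= C2 -> 0 < eps -> eps <= l ->
  eucl_norm u <= l ->
  (forall z, P z -> 0 < eucl_norm (translate (u, zvec m) 1 z).1 /\
     eucl_norm h <= l * eucl_norm (translate (u, zvec m) 1 z).1 `^ gamma) ->
  (forall z s, P z -> 0 <= s <= 1 ->
    rho z <= C1 * rho (translate (u, zvec m) s z)) ->
  (forall z s, P z -> 0 <= s <= 1 -> rho (translate (u, zvec m) 1 z) <=
     C2 * rho (translate (zvec n, h) s (translate (u, zvec m) 1 z))) ->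
  (wgt [set z | P z /\ A (translate (u, h) 1 z)] <= E%:E)%E ->
  (wgt P <= (E + 2 * l / eps * ((C1 + C1 * C2) * Delta))%:E)%E.
Proof.
move=> mA HD mP PA C10 C20 e0 el ul hl H1 H2 HE.
have mr := @measurable_rho R n m gamma q.
have r0 := @rho_ge0 R n m gamma q.
pose v1 : X := (u, zvec m); pose v2 : X := (zvec n, h).
pose P1 := P `&` (translate v1 1 @^-1` A);
  pose P2 := P `\` (translate v1 1 @^-1` A).
have mA1 : measurable (translate v1 1 @^-1` A)
  by exact: measurable_translate_preimage.
pose A2 := translate (u, h) 1 @^-1` A.
have mA2 : measurable A2 by exact: measurable_translate_preimage.
have mP1 : measurable P1 by exact: measurableI.
have -> : (wgt P = wgt (P1 `&` A2) + wgt (P1 `\` A2) + wgt P2)%E.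
  by rewrite /wgt (weight_split _ mr r0 mP mA1) (weight_split _ mr r0 mP1 mA2).
have B1 : (wgt P2 <= (2 * l / eps * (C1 * Delta))%:E)%E.
  have Hd z s s' : P z -> 0 <= s <= 1 -> 0 <= s' <= 1 ->
      (cc_dist gamma (translate v1 s z) (translate v1 s' z) <=
        (l * `|s - s'|)%:E)%E.
    move=> _ _ _; apply: le_trans (cc_dist_translate_along_x _ _ _ _) _.
    by rewrite lee_fin ler_wpM2r.
  exact: (crossing_real mA HD mP PA C10 e0 el Hd H1).
have B2 : (wgt (P1 `&` A2) <= E%:E)%E.
  by apply: le_trans HE; apply: le_weight => // z [[]].
have B3 : (wgt (P1 `\` A2) <= (2 * l / eps * (C1 * (C2 * Delta)))%:E)%E.
  pose P' := A `&` (translate v1 (- 1) @^-1` P).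
  have mP' : measurable P'.
    by apply: measurableI => //; exact: measurable_translate_preimage.
  have P'E z : P' z -> P (translate v1 (- 1) z) /\ translate v1 1 (translate v1
    (- 1) z) = z.
    by move=> [_ Pz]; split => //; exact: translateNK.
  pose Q := [set z | P' z /\ ~ A (translate v2 1 z)].
  have mQ : measurable Q.
    have -> : Q = P' `\` (translate v2 1 @^-1` A) by [].
    by apply: measurableD => //; exact: measurable_translate_preimage.
  apply: (@le_trans _ _ (C1%:E * wgt Q)%E).
    apply: (wgt_translate_le (v := v1) (s := 1)) => //; first exact: measurableD.
    move=> z [[Pz Az] nA2]; split; last by apply: H1 => //; rewrite ler01 lexx.
    split; first by split => //=; rewrite translateK.
    by rewrite /v2 /v1 translate_xy.
  have -> : 2 * l / eps * (C1 * (C2 * Delta)) = C1 * (2 * l / eps * (C2 * Delta)).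
    by move: (2 * l / eps) => t; ring.
  rewrite EFinM; apply: lee_wpmul2l; first by rewrite lee_fin.
  have P'A : P' `<=` A by move=> z [].
  have Hd z s s' : P' z -> 0 <= s <= 1 -> 0 <= s' <= 1 ->
      (cc_dist gamma (translate v2 s z) (translate v2 s' z) <=
        (l * `|s - s'|)%:E)%E.
    move=> P'z _ _; have [Pz zE] := P'E _ P'z.
    have [z0 hle] := hl _ Pz; rewrite -/v1 zE in z0 hle.
    apply: le_trans (cc_dist_translate_along_y _ _ _ z0) _.
    rewrite lee_fin ler_wpM2r// ler_pdivrMr//.
    by rewrite powR_gt0.
  have Hr z s : P' z -> 0 <= s <= 1 -> rho z <= C2 * rho (translate v2 s z).
    move=> P'z s01; have [Pz zE] := P'E _ P'z.
    by have := H2 _ _ Pz s01; rewrite -/v1 zE.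
  exact: (crossing_real mA HD mP' P'A C20 e0 el Hd Hr).
have -> : (E + 2 * l / eps * ((C1 + C1 * C2) * Delta) =
  E + 2 * l / eps * (C1 * (C2 * Delta)) + 2 * l / eps * (C1 * Delta))%R.
  by move: (2 * l / eps) => t; ring.
by rewrite EFinD EFinD; apply: leeD => //; exact: leeD.
Qed.

End crossing.

(** * Points whose gauge is comparable to K *)

Section middle.
Context {R : realType}.
Variables (n m : nat) (gamma q : R).
Hypotheses (gamma0 : 0 <= gamma) (q1 : 1 <= q).
Notation X := (n.-tuple R * m.-tuple R)%type.
Notation M := (@gaugeM R n m gamma).
Notation yscale := (@yscale R q).
Notation xscale := (@xscale R gamma q).
Notation rho := (@rho R n m gamma q).
Notation wgt := (@wgt R n m gamma q).
Notation translate := (@translate R n m).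
Notation outer_mass_le := (@outer_mass_le R n m gamma q).

Let g1_gt0 : 0 < 1 + gamma. Proof. by rewrite ltr_pwDl. Qed.

(** This is the estimate that is summed over the pieces P of the space. *)
Definition piece_bound (eta C K : R) (P : set X) := forall A eps Delta,
  measurable A -> outer_mass_le A eps Delta -> 0 < eps -> eps <= xscale K ->
  (wgt (A `&` P) <= eta%:E * wgt A + (C * xscale K / eps * Delta)%:E)%E.

Lemma scalev_dvec k s (i : 'I_k) (c : R) : scalev s (dvec i c) = dvec i (s * c).
Proof.
apply: eq_from_tnth => j; rewrite !tnth_mktuple.
by case: ifP; rewrite ?mulr0.
Qed.

Lemma translate_dvec_x i c s (z : X) :
  translate (dvec i c, zvec m) s z = affine2 1 1 (dvec i (s * c), zvec m) z.
Proof. by rewrite /translate scalev_dvec scalev_zvec. Qed.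

Lemma translate_dvec_y j c s (z : X) :
  translate (zvec n, dvec j c) s z = affine2 1 1 (zvec n, dvec j (s * c)) z.
Proof. by rewrite /translate scalev_dvec scalev_zvec. Qed.

Lemma translate_zvec s (z : X) : translate (zvec n, zvec m) s z = z.
Proof. by case: z => x y;
  rewrite /translate /affine2 /= !scalev_zvec !affine1_zvec. Qed.

Lemma scaled_shift (c t s : R) : 0 <= s <= 1 -> c * t <= 0 -> `|c| <= `|t| ->
  s * c * t <= 0 /\ `|s * c| <= `|t|.
Proof.
move=> /andP[s0 s1] ct cle; split; first by rewrite -mulrA mulr_ge0_le0.
by rewrite normrM ger0_norm// (le_trans _ cle)// ler_piMl.
Qed.

Lemma rho_le_gain (D eta : R) (z z' : X) : D <= M z `^ q - M z' `^ q ->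
  expR (- D) <= eta -> rho z <= eta * rho z'.
Proof.
move=> hD heta; apply: le_trans (_ : _ <= expR (- D) * rho z') _.
  by rewrite -expRD ler_expR -opprD lerN2 -lerBrDr.
by apply: ler_wpM2r => //; exact: rho_ge0.
Qed.

Lemma gain_minus_cost (g G U U1 U2 E : R) :
  g <= G -> U1 - U <= E -> G <= U1 - U2 -> g - E <= U - U2.
Proof. by lra. Qed.

(** As K^(q-1) yscale K = 1. *)
Lemma powR_yscale_ge c1 K a : 0 < c1 -> 1 <= K -> c1 * K <= a ->
  c1 `^ (q - 1) <= a `^ (q - 1) * yscale K.
Proof.
move=> c10 K1 h; have K0 : 0 < K by exact: lt_le_trans K1.
have L0 := yscale_gt0 q K1.
rewrite -[leLHS]mulr1 -[X in _ * X <= _](powR_yscale q K1) mulrA.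
apply: ler_wpM2r; first exact: ltW.
rewrite -powRM ?(ltW c10) ?(ltW K0)// ge0_ler_powR ?nnegrE ?subr_ge0//.
  by rewrite mulr_ge0 ?ltW.
by apply: le_trans h; rewrite mulr_ge0 ?ltW.
Qed.

Section pieces.
Variables (c1 eta : R).
Hypotheses (c10 : 0 < c1) (eta0 : 0 < eta).

Definition xdom (K : R) (jb : 'I_n * bool) : set X :=
  [set z | [/\ c1 * K <= M z, ypart gamma z <= xpart gamma z & coord_piece jb z.1]].

(** Moving y by h costs |h| / |x|^gamma. The flag says whether |x| is below
    xscale K, in which case x has to move first. *)
Definition ydom (K : R) (i : bool * ('I_m * bool)) : set X :=
  [set z | [/\ c1 * K <= M z <= 2 * K, xpart gamma z <= ypart gamma z,
     coord_piece i.2 z.2 &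
     if i.1 then eucl_norm z.1 <= xscale K else xscale K <= eucl_norm z.1]].

Lemma measurable_coord_x jb : measurable [set z : X | coord_piece jb z.1].
Proof.
rewrite -[X in measurable X]setTI; apply: measurable_fst => //.
exact: measurable_coord_piece.
Qed.

Lemma measurable_coord_y jb : measurable [set z : X | coord_piece jb z.2].
Proof.
rewrite -[X in measurable X]setTI; apply: measurable_snd => //.
exact: measurable_coord_piece.
Qed.

Lemma measurable_xdom K jb : measurable (xdom K jb).
Proof.
have -> : xdom K jb = [set z : X | c1 * K <= M z] `&`
    ([set z | ypart gamma z <= xpart gamma z] `&` [set z | coord_piece jb z.1]).
  by apply/seteqP; split => z /= [] => [? ? ?|? [? ?]].
apply: measurableI; last apply: measurableI; last exact: measurable_coord_x.
- by apply: measurable_le_set; [exact: measurable_cst|exact: measurable_gaugeM].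
- by apply: measurable_le_set; [exact: measurable_ypart|exact: measurable_xpart].
Qed.

Lemma measurable_ydom K i : measurable (ydom K i).
Proof.
have mx : measurable_fun [set: X] (fun z : X => eucl_norm z.1).
  by apply: measurableT_comp => //; exact: measurable_eucl_norm.
have -> : ydom K i = (([set z : X | c1 * K <= M z] `&`
    [set z : X | M z <= 2 * K]) `&` [set z | xpart gamma z <= ypart gamma z]) `&`
    ([set z | coord_piece i.2 z.2] `&`
     [set z | if i.1 then eucl_norm z.1 <= xscale K else xscale K <=
       eucl_norm z.1]).
  apply/seteqP; split => z /= [] => [/andP[? ?] ? ? ?|[[h1 h2] ?] [? ?]] //.
  by split => //; rewrite h1.
apply: measurableI; [apply: measurableI;
  first apply: measurableI|apply: measurableI].
- by apply: measurable_le_set; [exact: measurable_cst|exact: measurable_gaugeM].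
- by apply: measurable_le_set; [exact: measurable_gaugeM|exact: measurable_cst].
- by apply: measurable_le_set; [exact: measurable_xpart|exact: measurable_ypart].
- exact: measurable_coord_y.
- by case: i.1; apply: measurable_le_set => //; exact: measurable_cst.
Qed.

(** Moving the large coordinate of x towards 0 by B yscale K increases the
    density all along, at the end by the factor exp(g B). B is such that
    exp(- g B) <= eta, so the points that end in A have mass at most
    eta (wgt A). *)
Lemma xdom_piece : exists C K0, forall K, K0 <= K -> forall jb,
  1 <= K /\ piece_bound eta C K (xdom K jb).
Proof.
have [n0|npos] := posnP n.
  by exists 0, 1 => K K1 [[i ni] b]; exfalso; move: ni; rewrite n0.
have n1 : 1 <= n%:R :> R by rewrite ler1n.
have n0 : 0 < n%:R :> R by exact: lt_le_trans n1.
pose g : R := c1 `^ (q - 1) / (8 * n%:R).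
have g0 : 0 < g by rewrite divr_gt0 ?powR_gt0// mulr_gt0.
have [B B1 /(_ B (lexx B))] := expR_eventually_le 1 g0 eta0; rewrite mul1r => HB.
have B0 : 0 < B by exact: lt_le_trans B1.
pose T := (n%:R * B + 1) `^ (1 + gamma).
exists (4 * B), (Num.max 1 (2 * T / c1)) => K; rewrite ge_max => /andP[K1 KT] jb.
split => // A eps Delta mA HD e0 eL.
have L0 := xscale_gt0 gamma q K1; have Lam0 := yscale_gt0 q K1.
have Lam1 := yscale_le1 q1 K1; have LL := yscale_le_xscale gamma0 q1 K1.
have [a a0 aE] := wgtE gamma0 q1 A.
pose ell := B * yscale K; have ell0 : 0 <= ell by rewrite mulr_ge0 ?ltW.
have ellB : ell <= B by rewrite ler_piMr// ltW.
pose c := - ((-1) ^+ jb.2 * ell).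
pose P := A `&` xdom K jb.
have xP z : P z -> [/\ n%:R * B + 1 <= eucl_norm z.1, 1 <= xpart gamma z,
    M z <= 2 * xpart gamma z & c1 * K <= M z].
  move=> [_ [zM zXY _]].
  have M2 : M z <= 2 * xpart gamma z.
    by apply: le_trans (gaugeM_le gamma0 z) _; move: zXY; lra.
  have XT : T <= xpart gamma z.
    have : 2 * T <= c1 * K by move: KT; rewrite ler_pdivrMr// (mulrC K).
    by move: zM M2; lra.
  have nB1 : 1 <= n%:R * B + 1 by rewrite lerDr mulr_ge0// ltW.
  split => //.
    rewrite leNgt; apply/negP => h.
    have := @gt0_ltr_powR R (1 + gamma) g1_gt0 (eucl_norm z.1) (n%:R * B + 1).
    rewrite !nnegrE eucl_norm_ge0 (le_trans ler01 nB1) => /(_ isT isT h).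
    by rewrite -/T -/(xpart gamma z) ltNge XT.
  apply: le_trans XT; rewrite -[leLHS](powRr0 (n%:R * B + 1)) ler_powR//.
  exact: ltW.
have cP z : P z -> [/\ c * tnth z.1 jb.1 <= 0, `|c| = ell, `|c| <= `|tnth z.1 jb.1|
    & eucl_norm z.1 <= n%:R * `|tnth z.1 jb.1| ].
  move=> Pz; have [_ [_ _ Cz]] := Pz; have [x1 _ _ _] := xP z Pz.
  have [h1 h2 h3] := coord_pieceP Cz ell0.
  split => //; rewrite h2; apply: le_trans ellB _.
  by rewrite -(ler_pM2l n0); apply: le_trans h3; apply: le_trans x1; rewrite lerDl.
have mP : measurable P by apply: measurableI => //; exact: measurable_xdom.
have bL : xscale K <= B * xscale K by rewrite ler_peMl// ltW.
have PA : P `<=` A by move=> z [].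
have c0E : `|c| = ell.
  by rewrite normrN normrM normrX normrN1 expr1n mul1r ger0_norm.
have := @two_leg R n m gamma q A P eps Delta (B * xscale K) 1 1 (eta * a)
  (dvec jb.1 c) (zvec m) mA HD mP PA ler01 ler01 e0 (le_trans eL bL).
rewrite -/P aE -EFinM -EFinD.
have -> : 4 * B * xscale K / eps * Delta =
  2 * (B * xscale K) / eps * ((1 + 1 * 1) * Delta).
  by move: (eps^-1) => t; ring.
apply.
- by rewrite eucl_norm_dvec c0E ler_pM2l.
- move=> z Pz; have [x1 _ _ _] := xP z Pz; have [h1 h2 h3 h4] := cP z Pz.
  rewrite translate_dvec_x mul1r /=; split.
    apply: lt_le_trans (dvec_shift_ge _ _ _); rewrite subr_gt0 h2.
    have : B <= n%:R * B by rewrite ler_peMl// ltW.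
    by move: ellB x1; lra.
  by rewrite eucl_norm_zvec mulr_ge0 ?powR_ge0// mulr_ge0// ltW.
- move=> z s Pz s01; have [h1 h2 h3 h4] := cP z Pz.
  have [h5 h6] := scaled_shift s01 h1 h3.
  by rewrite mul1r translate_dvec_x; apply: (rho_le q1); exact: gaugeM_xshift_le.
- by move=> z s _ _; rewrite translate_zvec mul1r.
- rewrite EFinM -aE; apply: wgt_return_le => //; first exact: ltW.
  move=> z Pz; have [h1 h2 h3 h4] := cP z Pz; have [x1 x2 x3 x4] := xP z Pz.
  apply: (@rho_le_gain (g * B)) => //.
  rewrite translate_dvec_x mul1r;
    apply: le_trans (powR_xshift_gain gamma0 q1 h1 h3 h4 x2 x3).
  rewrite h2 /ell /g.
  have -> : c1 `^ (q - 1) / (8 * n%:R) * B = c1 `^ (q - 1) * (B / (8 * n%:R)).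
    by rewrite mulrAC mulrA.
  have -> : M z `^ (q - 1) * (B * yscale K / (8 * n%:R)) =
     M z `^ (q - 1) * yscale K * (B / (8 * n%:R)).
    by move: ((8 * n%:R)^-1) => t; ring.
  apply: ler_wpM2r; first by rewrite divr_ge0 ?mulr_ge0 ?ltW.
  exact: powR_yscale_ge.
Qed.

(** Where |x| is below xscale K, a coordinate of x first moves by 2 (xscale K), so
    that |x| >= xscale K in all cases when y moves. This increases M^q by at most
    a constant E1, as X stays below a multiple of yscale K and M <= 2K. Then the
    large coordinate of y moves towards 0 by B yscale K; the path has length at
    most a multiple of xscale K, and B is so large that the gain g B exceeds E1 by
    enough. *)
Lemma ydom_piece : (0 < n)%N -> exists C K0, forall K, K0 <= K -> forall i,
  1 <= K /\ piece_bound eta C K (ydom K i).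
Proof.
move=> npos; have [m0|mpos] := posnP m.
  by exists 0, 1 => K K1 [cl [[i ni] b]]; exfalso; move: ni; rewrite m0.
have m1' : 1 <= m%:R :> R by rewrite ler1n.
have m0 : 0 < m%:R :> R by exact: lt_le_trans m1'.
pose i0 : 'I_n := Ordinal npos.
pose g : R := (c1 / 2) `^ (q - 1) / (6 * m%:R).
have c2 : 0 < c1 / 2 by rewrite divr_gt0.
have g0 : 0 < g by rewrite divr_gt0 ?powR_gt0// mulr_gt0.
have [k k1 Hk] := @powR_sub_le R q q1.
(* |x| stays below 3 (xscale K), so X stays below c3 (yscale K) *)
pose c3 : R := 3 `^ (1 + gamma); have c30 : 0 < c3 by rewrite powR_gt0.
pose D : R := c3 ^+ 2; have D0 : 0 < D by rewrite exprn_gt0.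
pose E1 : R := k * (2 + D) `^ (q - 1) * D.
have E10 : 0 <= E1.
  by rewrite /E1 mulr_ge0 ?(ltW D0)// mulr_ge0 ?powR_ge0// (le_trans ler01).
have [B B1 /(_ B (lexx B))] := expR_eventually_le (expR E1) g0 eta0;
  rewrite -expRD => HB.
have B0 : 0 < B by exact: lt_le_trans B1.
pose T := (1 + gamma) * (m%:R * B) + D + 1.
have T0 : 0 <= (1 + gamma) * (m%:R * B).
  by rewrite mulr_ge0 ?ltW// mulr_gt0.
exists (4 * (B + 2) * expR E1), (Num.max 1 (2 * T / c1)) => K.
rewrite ge_max => /andP[K1 KT] [cl jb]; split => // A eps Delta mA HD e0 eL.
have K0 : 0 < K by exact: lt_le_trans K1.
have L0 := xscale_gt0 gamma q K1; have Lam0 := yscale_gt0 q K1.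
have Lam1 := yscale_le1 q1 K1.
have [a a0 aE] := wgtE gamma0 q1 A.
pose ell := B * yscale K; have ell0 : 0 <= ell by rewrite mulr_ge0 ?ltW.
have ellB : ell <= B by rewrite ler_piMr// ltW.
pose c := - ((-1) ^+ jb.2 * ell).
pose P := A `&` ydom K (cl, jb).
pose d : R := if cl then 2 * xscale K else 0.
have d0 : 0 <= d by rewrite /d; case: (cl) => //; rewrite mulr_ge0// ltW.
pose u : n.-tuple R := dvec i0 d.
pose z1 (z : X) := translate (u, zvec m) 1 z.
have yP z : P z -> [/\ m%:R * B <= eucl_norm z.2, T <= ypart gamma z,
    M z <= 2 * ypart gamma z & c1 * K <= M z <= 2 * K].
  move=> [_ [/andP[zM zM2] zXY _ _]].
  have M2 : M z <= 2 * ypart gamma z.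
    by apply: le_trans (gaugeM_le gamma0 z) _; move: zXY; lra.
  have YT : T <= ypart gamma z.
    have : 2 * T <= c1 * K by move: KT; rewrite ler_pdivrMr// (mulrC K).
    by move: zM M2; lra.
  split => //; last by rewrite zM.
  rewrite -(ler_pM2l g1_gt0); apply: le_trans YT.
  by rewrite /T -addrA lerDl addr_ge0// ltW.
have cP z : P z -> [/\ c * tnth z.2 jb.1 <= 0, `|c| = ell, `|c| <= `|tnth z.2 jb.1|
    & eucl_norm z.2 <= m%:R * `|tnth z.2 jb.1| ].
  move=> Pz; have [_ [_ _ Cz _]] := Pz; have [y1 _ _ _] := yP z Pz.
  have [h1 h2 h3] := coord_pieceP Cz ell0.
  split => //; rewrite h2; apply: le_trans ellB _.
  by rewrite -(ler_pM2l m0); apply: le_trans h3.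
have mP : measurable P by apply: measurableI => //; exact: measurable_ydom.
have PA : P `<=` A by move=> z [].
have c0E : `|c| = ell.
  by rewrite normrN normrM normrX normrN1 expr1n mul1r ger0_norm.
have uE : eucl_norm u = d by rewrite eucl_norm_dvec ger0_norm.
have uL : eucl_norm u <= 2 * xscale K.
  by rewrite uE /d; case: (cl) => //; rewrite mulr_ge0// ltW.
have BL : 2 * xscale K <= (B + 2) * xscale K.
  by rewrite ler_pM2r// lerDr ltW.
have lL : xscale K <= (B + 2) * xscale K by apply: le_trans BL; move: L0; lra.
have leg1 z s : P z -> 0 <= s <= 1 ->
    M (translate (u, zvec m) s z) <= M z + D * yscale K.
  move=> Pz /andP[s0 s1]; have [_ [_ _ _ Lz]] := Pz.
  have [y1 y2 y3 /andP[y4 y5]] := yP z Pz.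
  have ns : eucl_norm (translate (u, zvec m) s z).1 <= eucl_norm z.1 + d.
    rewrite /translate /=; apply: le_trans (eucl_norm_affine1_le _ _) _.
    by rewrite lerD2l eucl_norm_scalev uE ger0_norm// ler_piMl.
  have DL0 : 0 <= D * yscale K by rewrite mulr_ge0 ?ltW.
  have M0 := gaugeM_ge0 gamma z.
  apply: gaugeM_le_of; first by rewrite addr_ge0.
  have yE : ypart gamma (translate (u, zvec m) s z) = ypart gamma z.
    by rewrite /ypart /translate /= scalev_zvec affine1_zvec.
  have x2 : xpart gamma (translate (u, zvec m) s z) ^+ 2 <=
      xpart gamma z ^+ 2 + D * yscale K * yscale K.
    have xs0 := xpart_ge0 gamma (translate (u, zvec m) s z).
    have xmono c' : 0 <= c' -> eucl_norm (translate (u, zvec m) s z).1 <= c' ->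
        xpart gamma (translate (u, zvec m) s z) <= c' `^ (1 + gamma).
      by move=> c'0 h; rewrite ge0_ler_powR ?nnegrE ?eucl_norm_ge0 ?(ltW g1_gt0).
    have [clE|clE] : cl = true \/ cl = false by case: (cl); [left|right].
    - move: Lz ns; rewrite /d /= clE => Lz ns.
      have xs : xpart gamma (translate (u, zvec m) s z) <= c3 * yscale K.
        rewrite -(powR_xscale q gamma0 K1) -powRM// ?(ltW L0)//; apply: xmono.
          by rewrite mulr_ge0// ltW.
        by move: ns Lz; lra.
      rewrite ler_wpDl ?sqr_ge0//.
      have -> : D * yscale K * yscale K = (c3 * yscale K) ^+ 2 by rewrite /D; ring.
      by rewrite (ler_pXn2r (ltn0Sn 1)) ?nnegrE// (le_trans xs0).
    - move: Lz ns; rewrite /d /= clE => Lz ns.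
      have w0 : 0 <= D * yscale K * yscale K := mulr_ge0 DL0 (ltW Lam0).
      apply: le_trans (_ : xpart gamma z ^+ 2 <= _); last by rewrite lerDl.
      have xz0 := xpart_ge0 gamma z.
      rewrite (ler_pXn2r (ltn0Sn 1)); [|by rewrite nnegrE|by rewrite nnegrE].
      apply: xmono; first exact: eucl_norm_ge0.
      by rewrite -[leRHS]addr0.
  have M1 : yscale K <= M z.
    apply: le_trans Lam1 _; apply: le_trans (ypart_le gamma0 z).
    by apply: le_trans y2; rewrite /T lerDr addr_ge0// ltW.
  have h1 : D * yscale K * yscale K <= D * yscale K * M z by exact: ler_wpM2l.
  have h2 := sqr_gaugeM gamma z.
  rewrite yE.
  move: x2 h1 h2 M0 DL0;
    move: (xpart gamma (translate _ _ _) ^+ 2) (D * yscale K) => v w.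
  move=> x2 h1 h2 M0 w0.
  have wM : 0 <= w * M z by exact: mulr_ge0.
  have ww : 0 <= w ^+ 2 by exact: sqr_ge0.
  have -> : (M z + w) ^+ 2 = M z ^+ 2 + 2 * (w * M z) + w ^+ 2 by ring.
  by move: x2 h1 h2 wM ww; lra.
have leg1U z s : P z -> 0 <= s <= 1 ->
    M (translate (u, zvec m) s z) `^ q - M z `^ q <= E1.
  move=> Pz s01; have h := leg1 z s Pz s01.
  have [_ _ _ /andP[_ y5]] := yP z Pz.
  have M0 := gaugeM_ge0 gamma z.
  have DL0 : 0 <= D * yscale K by rewrite mulr_ge0 ?ltW.
  have MD : M z <= M z + D * yscale K by rewrite lerDl.
  apply: le_trans (_ : (M z + D * yscale K) `^ q - M z `^ q <= _).
    apply: lerB => //; rewrite ge0_ler_powR ?nnegrE ?gaugeM_ge0 ?addr_ge0//.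
    exact: le_trans q1.
  apply: le_trans (Hk _ _ M0 MD) _.
  have -> : M z + D * yscale K - M z = D * yscale K by ring.
  have D2 : 0 <= 2 + D by rewrite addr_ge0// ltW.
  have top : (M z + D * yscale K) `^ (q - 1) <= (2 + D) `^ (q - 1) * K `^ (q - 1).
    rewrite -powRM ?(ltW K0)// ge0_ler_powR ?nnegrE ?subr_ge0 ?addr_ge0//.
      by rewrite mulr_ge0// ltW.
    have : D * yscale K <= D * K by rewrite ler_pM2l//; exact: le_trans K1.
    by move: y5; lra.
  have k0 : 0 <= k by exact: le_trans k1.
  have := ler_wpM2r DL0 (ler_wpM2l k0 top).
  have -> : k * ((2 + D) `^ (q - 1) * K `^ (q - 1)) * (D * yscale K) =
     k * (2 + D) `^ (q - 1) * D * (K `^ (q - 1) * yscale K).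
    by move: (K `^ _) (yscale K) ((2 + D) `^ _) => t1 t2 t3; ring.
  by rewrite (powR_yscale q K1) mulr1.
have yE z : (z1 z).2 = z.2.
  by case: z => x y; rewrite /z1 /translate /affine2 /= scalev_zvec affine1_zvec.
have x1L z : P z -> xscale K <= eucl_norm (z1 z).1.
  move=> [_ [_ _ _ Lz]]; rewrite /z1 translate_dvec_x mul1r /=.
  have [clE|clE] : cl = true \/ cl = false by case: (cl); [left|right].
    move: Lz; rewrite /d /= clE => Lz; apply: le_trans (tnth_le_eucl_norm _ i0).
    rewrite !tnth_mktuple eqxx mul1r.
    have := le_trans (tnth_le_eucl_norm z.1 i0) Lz; rewrite ler_norml => /andP[h _].
    by apply: le_trans (ler_norm _); move: h; lra.
  move: Lz; rewrite /d /= clE => Lz.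
  by apply: (le_trans Lz); have := dvec_shift_ge i0 0 z.1; rewrite normr0 subr0.
have := @two_leg R n m gamma q A P eps Delta ((B + 2) * xscale K) (expR E1) 1
  (eta * a)
  u (dvec jb.1 c) mA HD mP PA (expR_ge0 _) ler01 e0 (le_trans eL lL).
rewrite -/P aE -EFinM -EFinD.
have -> : 4 * (B + 2) * expR E1 * xscale K / eps * Delta =
    2 * ((B + 2) * xscale K) / eps * ((expR E1 + expR E1 * 1) * Delta).
  by move: (eps^-1) (expR E1) => t t'; ring.
apply.
- exact: le_trans uL BL.
- move=> z Pz; have h := x1L z Pz.
  split; first exact: lt_le_trans h.
  rewrite eucl_norm_dvec c0E /ell (yscale_xscale q gamma0 K1) mulrA.
  apply: ler_pM; rewrite ?mulr_ge0 ?powR_ge0 ?(ltW L0) ?(ltW B0)//.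
    by rewrite ler_pM2r// lerDl.
  by rewrite ge0_ler_powR ?nnegrE ?eucl_norm_ge0 ?(ltW L0).
- move=> z s Pz s01; apply: (@rho_le_gain (- E1)); last by rewrite opprK.
  by rewrite lerNl opprB; exact: leg1U.
- move=> z s Pz s01; have [h1 h2 h3 h4] := cP z Pz.
  have [h5 h6] := scaled_shift s01 h1 h3.
  rewrite mul1r translate_dvec_y; apply: (rho_le q1); apply: gaugeM_yshift_le => //.
    by rewrite -/(z1 z) yE.
  by rewrite -/(z1 z) yE.
- rewrite EFinM -aE; apply: wgt_return_le => //; first exact: ltW.
  move=> z Pz; have [h1 h2 h3 h4] := cP z Pz.
  have [y1 y2 y3 /andP[y4 y5]] := yP z Pz.
  apply: (@rho_le_gain (g * B - E1)); last first.
    by rewrite opprB.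
  rewrite -translate_xy translate_dvec_y mul1r.
  have YE : ypart gamma (z1 z) = ypart gamma z by rewrite /ypart (yE z).
  have YM : ypart gamma z <= M (z1 z) by rewrite -YE; exact: (ypart_le gamma0).
  have l1 : 0 <= (1 : R) <= 1 by rewrite ler01 lexx.
  have M3 : M (z1 z) <= 3 * ypart gamma (z1 z).
    rewrite YE; have := leg1 z 1 Pz l1; rewrite -/(z1 z).
    have : D * yscale K <= D by rewrite ler_piMr// ltW.
    by move: y2 y3 T0; rewrite /T; lra.
  have Mc : c1 / 2 * K <= M (z1 z).
    by apply: le_trans YM; move: y3 y4; lra.
  have M10 : 0 < M (z1 z) by apply: lt_le_trans Mc; rewrite mulr_gt0.
  have := powR_yshift_gain gamma0 q1 (z := z1 z) (j := jb.1) (c := c) (kappa := 3).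
  rewrite yE => /(_ h1 h3 h4 M10 (ltr0Sn _ 2) M3).
  have := leg1U z 1 Pz l1; rewrite -/(z1 z).
  suff : g * B <= M (z1 z) `^ (q - 1) * ((1 + gamma) * `|c| / (2 * 3 * m%:R)).
    by move=> h5 h6 h7; exact: (gain_minus_cost h5 h6 h7).
  rewrite h2 /ell /g.
  have -> : (c1 / 2) `^ (q - 1) / (6 * m%:R) * B =
    (c1 / 2) `^ (q - 1) * (B / (6 * m%:R)).
    by rewrite mulrAC mulrA.
  have -> : M (z1 z) `^ (q - 1) * ((1 + gamma) * (B * yscale K) / (2 * 3 * m%:R)) =
     M (z1 z) `^ (q - 1) * yscale K * ((1 + gamma) * (B / (6 * m%:R))).
    have -> : 2 * 3 * m%:R = 6 * m%:R :> R by ring.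
    by move: ((6 * m%:R)^-1) => t; ring.
  apply: ler_pM; first exact: powR_ge0.
  + by rewrite divr_ge0 ?mulr_ge0 ?ltW.
  + exact: powR_yscale_ge.
  + by rewrite ler_peMl ?lerDl// divr_ge0 ?mulr_ge0 ?ltW.
Qed.

End pieces.
End middle.

(** * A well chosen translation *)

Section averaging.
Context {R : realType}.
Variables (n m : nat) (gamma q : R).
Hypotheses (gamma0 : 0 <= gamma) (q1 : 1 <= q).
Notation X := (n.-tuple R * m.-tuple R)%type.
Notation lam := (@lebesgue_tuple R n \x @lebesgue_tuple R m)%E.
Notation rho := (@rho R n m gamma q).
Notation wgt := (@wgt R n m gamma q).
Notation translate := (@translate R n m).

Lemma translationC (w z : X) : affine2 1 1 w z = affine2 1 1 z w.
Proof.
by congr pair; apply: eq_from_tnth => i; rewrite !tnth_mktuple !mul1r addrC.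
Qed.

Lemma scalev1 k (v : k.-tuple R) : scalev 1 v = v.
Proof. by apply: eq_from_tnth => i; rewrite tnth_mktuple mul1r. Qed.

Lemma measurable_addition :
  measurable_fun [set: X * X] (fun zw : X * X => affine2 1 1 zw.2 zw.1).
Proof.
apply: measurable_fun_pair; apply/measurable_fun_tnthP => i.
  apply: (eq_measurable_fun (fun zw : X * X => tnth zw.1.1 i + tnth zw.2.1 i)).
    by move=> zw _ /=; rewrite tnth_mktuple mul1r.
  apply: measurable_funD.
    by apply: measurableT_comp (@measurable_tnth _ _ _ i) _;
      apply: measurableT_comp.
  by apply: measurableT_comp (@measurable_tnth _ _ _ i) _; apply: measurableT_comp.
apply: (eq_measurable_fun (fun zw : X * X => tnth zw.1.2 i + tnth zw.2.2 i)).
  by move=> zw _ /=; rewrite tnth_mktuple mul1r.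
apply: measurable_funD.
  by apply: measurableT_comp (@measurable_tnth _ _ _ i) _; apply: measurableT_comp.
by apply: measurableT_comp (@measurable_tnth _ _ _ i) _; apply: measurableT_comp.
Qed.

Lemma lebesgue_product_sigma_finite : sigma_finite [set: X] lam.
Proof.
exists (fun k : nat => [set z : X | gaugeM gamma z <= k%:R]).
  apply/seteqP; split => // z _; exists (Num.bound (gaugeM gamma z)) => //=.
  by apply/ltW/archi_boundP/gaugeM_ge0.
move=> k; split; last exact: lebesgue_sublevel_fin.
by apply: measurable_le_set; [exact: measurable_gaugeM|exact: measurable_cst].
Qed.

Lemma tonelli_swap (f : X * X -> \bar R) :
  measurable_fun [set: X * X] f -> (forall zw, 0 <= f zw)%E ->
  [/\ (\int[lam]_z \int[lam]_w f (z, w) = \int[lam]_w \int[lam]_z f (z, w))%E,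
    measurable_fun [set: X] (fun z => \int[lam]_w f (z, w))%E &
    measurable_fun [set: X] (fun w => \int[lam]_z f (z, w))%E].
Proof.
move=> mf f0.
pose numeas := (lam : {measure set X -> \bar R}).
pose sl := HB.pack_for {sigma_finite_measure set X -> \bar R}
  (lam : set X -> \bar R) (Measure.class numeas) (Measure_isSigmaFinite.Build _
    _ _ (lam : set X -> \bar R)
    lebesgue_product_sigma_finite).
split.
- exact: (fubini_tonelli (m1 := sl) (m2 := sl) f mf f0).
- by have := @measurable_fun_fubini_tonelli_F _ _ X X R sl f mf f0.
- by have := @measurable_fun_fubini_tonelli_G _ _ X X R sl f mf f0.
Qed.

(** Integrate over w in Box the mass of the points of P that w moves into A. For
    a fixed z in P, the translations that move z into A form a set of Lebesgue
    measure at most c a, because rho >= 1/c at the points z + w. So the integral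
    is at most c a a, and it would exceed E V if no w were suitable. *)
Lemma averaging_translation (P A Box : set X) (c a V E : R) :
  measurable P -> measurable A -> measurable Box -> 0 <= c ->
  (forall z w, P z -> Box w -> 1 <= c * rho (translate w 1 z)) ->
  (wgt P <= a%:E)%E -> (wgt A <= a%:E)%E -> (0 <= E)%R -> lam Box = V%:E ->
    c * a * a < E * V ->
  exists2 w, Box w & (wgt [set z | P z /\ A (translate w 1 z)] <= E%:E)%E.
Proof.
move=> mP mA mB c0 H Pa Aa E0 BV small; apply: contrapT => nex.
have mr := @measurable_rho R n m gamma q.
have r0 := @rho_ge0 R n m gamma q.
have a0 : 0 <= a by rewrite -lee_fin; apply: le_trans Pa; exact: wgt_ge0.
have shE w z : translate w 1 z = affine2 1 1 w z by case: w => w1 w2;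
  rewrite /translate !scalev1.
pose S := [set zw : X * X | (P zw.1 /\ Box zw.2) /\ A (affine2 1 1 zw.2 zw.1)].
have mS : measurable S.
  have -> : S = (P `*` Box) `&` ((fun zw : X * X => affine2 1 1 zw.2 zw.1)
    @^-1` A) by [].
  apply: measurableI; first exact: measurableX.
  by rewrite -[X in measurable X]setTI; exact: measurable_addition.
pose f := (fun zw : X * X => (rho zw.1)%:E) \_ S.
have f0 zw : (0 <= f zw)%E.
  by rewrite /f erestrict_ge0// => z' _; rewrite lee_fin.
have mf : measurable_fun [set: X * X] f.
  apply: (measurable_restrict_EFin (f := fun zw : X * X => rho zw.1) mS).
  exact: measurableT_comp.
have [FT mF mG] := tonelli_swap mf f0.
have fE z w : f (z, w) = if `[< (P z /\ Box w) /\ A (affine2 1 1 w z) >]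
    then (rho z)%:E else 0%E by [].
clearbody f; clear mS S.
have mPA w : measurable [set z | P z /\ A (affine2 1 1 w z)].
  have -> : [set z | P z /\ A (affine2 1 1 w z)] = P `&` ((affine2 1 1 w : X ->
    X) @^-1` A) by [].
  apply: (measurableI _ _ mP); rewrite -[X in measurable X]setTI.
  exact: (measurable_affine2 1 1 w measurableT mA).
have up : (\int[lam]_z \int[lam]_w f (z, w) <= (c * a * a)%:E)%E.
  apply: (@le_trans _ _ (\int[lam]_z ((fun z => (c * a * rho z)%:E) \_ P) z)%E).
    apply: ge0_le_integral => //.
    - by move=> z _; exact: integral_ge0.
    - apply: (measurable_restrict_EFin (f := fun z => c * a * rho z) mP).
      by apply: measurable_funM => //; exact: measurable_cst.
    move=> z _; rewrite [leRHS]patchE; case: ifPn => [|]; last first.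
      rewrite notin_setE => nPz; rewrite integral0_eq// => w _; rewrite fE.
      by case: asboolP => // -[[]].
    rewrite inE => Pz.
    have -> : (\int[lam]_w f (z, w) =
        \int[lam]_(w in Box `&` [set w | A (affine2 1 1 w z)]) (rho z)%:E)%E.
      rewrite [RHS]integral_mkcond; apply: eq_integral => w _; rewrite fE patchE.
      congr (if _ then _ else _);
        apply/asboolP/idP => [[[_ Bw] Aw]|/set_mem[Bw Aw]].
        by apply/mem_set; split.
      by split.
    apply: (@le_trans _ _ ((c * rho z)%:E * wgt A)%E).
      apply: (integral_transport (w := z) ltr01 ltr01 _ _ mA _ mr _ r0).
      - by rewrite mulr_ge0.
      - apply: measurableI => //;
        have -> : [set w | A (affine2 1 1 w z)] = affine2 1 1 z @^-1` A.
          by apply/seteqP; split => w; rewrite /= translationC.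
        by rewrite -[X in measurable X]setTI; exact: measurable_affine2.
      - exact: measurable_cst.
      - by move=> _; exact: r0.
      - move=> w [Bw /= Aw]; rewrite translationC; split; first exact: Aw.
        rewrite (expr1n R n) (expr1n R m) invr1 !mul1r.
        have := H z w Pz Bw; rewrite shE.
        move: (rho (affine2 1 1 w z)) (r0 z) => t r h.
        by rewrite mulrAC -[leLHS]mul1r; exact: ler_wpM2r.
    have -> : c * a * rho z = c * rho z * a by rewrite mulrAC.
    by rewrite [leRHS]EFinM; apply: lee_wpmul2l => //; rewrite lee_fin mulr_ge0.
  rewrite -integral_mkcond.
  apply: (@le_trans _ _ ((c * a)%:E * wgt P)%E).
    by rewrite /wgt -ge0_integralZl_EFin//; [move=> z _; rewrite lee_fin|
      exact/measurable_EFinP/measurable_funTS|rewrite mulr_ge0].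
  by rewrite [leRHS]EFinM; apply: lee_wpmul2l => //; rewrite lee_fin mulr_ge0.
have low : ((E * V)%:E <= \int[lam]_w \int[lam]_z f (z, w))%E.
  apply: (@le_trans _ _ (\int[lam]_(w in Box) E%:E)%E).
    by rewrite integral_cst// EFinM -BV.
  rewrite integral_mkcond; apply: ge0_le_integral => //.
  - by move=> w _; rewrite erestrict_ge0.
  - by apply/(measurable_restrictT _ _).1 => //; exact: measurable_cst.
  - move=> w _; rewrite [leLHS]patchE; case: ifPn => [|_]; last exact: integral_ge0.
    rewrite inE => Bw; rewrite leNgt; apply/negP => h.
    apply: nex; exists w => //; apply/ltW; apply: le_lt_trans h.
    rewrite /wgt [leLHS]integral_mkcond; apply: ge0_le_integral => //.
    + by move=> z _; rewrite erestrict_ge0// => z' _; rewrite lee_fin.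
    + apply: (measurable_restrict_EFin (f := rho)) => //.
      have -> : [set z | P z /\ A (translate w 1 z)] =
        [set z | P z /\ A (affine2 1 1 w z)].
        by apply/seteqP; split => z; rewrite /= shE.
      exact: mPA.
    + by apply: measurableT_comp => //; exact: measurable_pair1.
    + move=> z _; rewrite patchE fE; case: ifPn => [|_]; last first.
        by case: asboolP => // _; rewrite lee_fin.
      by rewrite inE => -[Pz]; rewrite shE => Az; rewrite asboolT.
have := le_trans low (le_trans _ up); rewrite -FT => /(_ (lexx _)).
by rewrite lee_fin leNgt small.
Qed.

End averaging.

(** * Points whose gauge is small compared to K *)

Section near.
Context {R : realType}.
Variables (n m : nat) (gamma q : R).
Hypotheses (gamma0 : 0 <= gamma) (q1 : 1 <= q).
Notation X := (n.-tuple R * m.-tuple R)%type.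
Notation lam := (@lebesgue_tuple R n \x @lebesgue_tuple R m)%E.
Notation M := (@gaugeM R n m gamma).
Notation xscale := (@xscale R gamma q).
Notation rho := (@rho R n m gamma q).
Notation wgt := (@wgt R n m gamma q).
Notation translate := (@translate R n m).

Let g1_gt0 : 0 < 1 + gamma. Proof. by rewrite ltr_pwDl. Qed.

Lemma gaugeM_bounded_shift : exists2 C : R, 1 <= C & forall (z v : X),
  (forall i, `|tnth v.1 i| <= 2) -> (forall j, `|tnth v.2 j| <= 1) ->
  M (affine2 1 1 v z) <= C * (1 + M z).
Proof.
pose B : R := (1 + n%:R * 2) `^ (1 + gamma).
have B0 : 0 <= B by exact: powR_ge0.
have m0 : 0 <= (1 + gamma) * m%:R by rewrite mulr_ge0 ?ler0n ?(ltW g1_gt0).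
exists (B + 1 + (1 + gamma) * m%:R); first by lra.
move=> z v v1 v2; have M0 := gaugeM_ge0 gamma z.
apply: le_trans (gaugeM_le gamma0 _) _.
have hx : xpart gamma (affine2 1 1 v z) <= B * (1 + M z).
  have n0 : 0 <= n%:R * 2 :> R by rewrite mulr_ge0.
  pose a : R := Num.max 1 (eucl_norm z.1).
  have a1 : 1 <= a by rewrite le_max lexx.
  apply: le_trans (_ : ((1 + n%:R * 2) * a) `^ (1 + gamma) <= _).
    rewrite /xpart ge0_ler_powR ?nnegrE ?eucl_norm_ge0 ?(ltW g1_gt0)//.
      by rewrite mulr_ge0 ?addr_ge0// (le_trans ler01).
    apply: le_trans (eucl_norm_affine1_le _ _) _.
    have xa : eucl_norm z.1 <= a by rewrite le_max lexx orbT.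
    have h := eucl_norm_le_sup v1.
    have : n%:R * 2 * 1 <= n%:R * 2 * a by exact: ler_wpM2l.
    by move: h xa; move: (eucl_norm _) (eucl_norm _) => t t'; lra.
  rewrite powRM ?addr_ge0 ?(le_trans ler01 a1)//; apply: ler_wpM2l => //.
  have : a `^ (1 + gamma) <= 1 + xpart gamma z.
    rewrite /a; case: (leP 1 (eucl_norm z.1)) => h.
      by rewrite lerDr.
    by rewrite powR1 lerDl xpart_ge0.
  move=> h; apply: le_trans h _; rewrite lerD2l; exact: xpart_le.
have hy : ypart gamma (affine2 1 1 v z) <= M z + (1 + gamma) * m%:R.
  apply: le_trans (_ : ypart gamma z + (1 + gamma) * m%:R <= _); last first.
    by rewrite lerD2r; exact: ypart_le.
  rewrite /ypart -mulrDr ler_pM2l//; apply: le_trans (eucl_norm_affine1_le _ _) _.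
  by rewrite lerD2l -[leRHS]mulr1; exact: eucl_norm_le_sup.
have : 0 <= (1 + gamma) * m%:R * M z by exact: mulr_ge0.
move: hx hy M0; set t := (1 + gamma) * m%:R => hx hy M0 tM.
have -> : (B + 1 + t) * (1 + M z) = B * (1 + M z) + (1 + M z) + t + t * M z by ring.
by move: hx hy tM; lra.
Qed.

Definition near_origin (c1 K : R) (i0 : 'I_n) (b : bool) : set X :=
  [set z | M z <= c1 * K /\ 0 <= (-1) ^+ b * tnth z.1 i0].

Lemma measurable_near_origin c1 K i0 b : measurable (near_origin c1 K i0 b).
Proof.
have -> : near_origin c1 K i0 b = [set z : X | M z <= c1 * K] `&`
   [set z | 0 <= (-1) ^+ b * tnth z.1 i0] by [].
apply: measurableI.
  by apply: measurable_le_set; [exact: measurable_gaugeM|exact: measurable_cst].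
apply: measurable_le_set; first exact: measurable_cst.
apply: measurable_funM; first exact: measurable_cst.
by apply: (measurableT_comp (@measurable_tnth _ _ _ i0)).
Qed.

Definition translation_box (d d' s : R) : set X :=
  box (fun=> `[s, s + d]%classic) (fun=> `[0, d']%classic).

Lemma measurable_translation_box d d' s : measurable (translation_box d d' s).
Proof. by apply: measurable_box => ?; exact: measurable_itv. Qed.

Lemma lebesgue_translation_box d d' s : 0 < d -> 0 < d' ->
  lam (translation_box d d' s) = (d ^+ n * d' ^+ m)%:E.
Proof.
move=> d0 d'0; rewrite lebesgue_box; [|by move=> ?; exact: measurable_itv..].
rewrite (prod_EFin (c := fun=> d)); last first.
  move=> i; rewrite lebesgue_measure_itv/= lte_fin ltrDl d0 -EFinB.
  by congr EFin; ring.
rewrite (prod_EFin (c := fun=> d')); last first.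
  by move=> i; rewrite lebesgue_measure_itv/= lte_fin d'0 oppr0 adde0.
by rewrite -EFinM !prodr_const !card_ord.
Qed.

(** The translations move the coordinate of x of sign (-1)^b away from 0, so that
    |x| >= d at the end. *)
Definition sign_start (b : bool) (d : R) : R := if b then - (2 * d) else d.

Lemma sign_startP b d x : 0 < d -> sign_start b d <= x <= sign_start b d + d ->
  d <= (-1) ^+ b * x /\ `|x| <= 2 * d.
Proof.
move=> d0; rewrite /sign_start; case: b => /andP[h1 h2]; rewrite ?expr1 ?expr0.
  by split; [lra|rewrite ler_norml; apply/andP; split; lra].
by split; [lra|rewrite ler_norml; apply/andP; split; lra].
Qed.

Lemma translation_boxP b d d' (w : X) : 0 < d -> d <= 1 -> d' <= 1 ->
  translation_box d d' (sign_start b d) w ->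
  [/\ forall i, d <= (-1) ^+ b * tnth w.1 i,
      forall i, `|tnth w.1 i| <= 2 * d,
      forall j, `|tnth w.2 j| <= d',
      forall i, `|tnth w.1 i| <= 2 & forall j, `|tnth w.2 j| <= 1].
Proof.
move=> d0 d1 d'1 [H1 H2].
have A1 i : d <= (-1) ^+ b * tnth w.1 i /\ `|tnth w.1 i| <= 2 * d.
  by apply: sign_startP => //; have := H1 i; rewrite /= in_itv.
have A2 j : `|tnth w.2 j| <= d'.
  by have := H2 j; rewrite /= in_itv /= => /andP[h1 h2]; rewrite ger0_norm.
split.
- by move=> i; case: (A1 i).
- by move=> i; case: (A1 i).
- exact: A2.
- by move=> i; case: (A1 i) => _ h; apply: le_trans h _; move: d1; lra.
- by move=> j; exact: le_trans (A2 j) d'1.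
Qed.

(** Let y = kap K^q. All densities involved are at least exp(-y). The
    translations have size d = exp(-3y), so that even after the loss exp(2y) on
    the density the paths count for at most a multiple of xscale K. But a box
    of such translations has volume exp(-3 dim y), which is much larger than
    exp(y) (wgt A), and averaging_translation applies. In the y-directions the
    box has side d^k0 with k0 >= 1 + gamma, since |x| is only known to be at
    least d when y moves. *)
Lemma near_origin_piece (i0 : 'I_n) (D eta : R) : 0 < D -> 0 < eta ->
  exists c1 C K0, 0 < c1 /\ forall K, K0 <= K -> 1 <= K /\
    exists2 e1, 0 < e1 & forall b A eps Delta, measurable A ->
      outer_mass_le gamma q A eps Delta -> 0 < eps -> eps <= e1 ->
      (wgt A <= (D * expR (- (K `^ q / 2)))%:E)%E ->
      (wgt (A `&` near_origin c1 K i0 b) <=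
        eta%:E * wgt A + (C * xscale K / eps * Delta)%:E)%E.
Proof.
move=> D0 eta0.
have [k0 gk] : exists k : nat, 1 + gamma <= k%:R.
  by exists (Num.bound (1 + gamma)); apply/ltW/archi_boundP/ltW.
have k01 : (0 < k0)%N by rewrite lt0n; apply/eqP => k00; move: gk;
  rewrite k00 leNgt g1_gt0.
pose dim : R := n%:R + k0%:R * m%:R.
have dim0 : 0 <= dim by rewrite addr_ge0 ?mulr_ge0.
(* then (1 + 3 dim) y <= (3/8) K^q, to be compared with wgt A <= D exp(-K^q/2) *)
pose kap : R := (8 * (dim + 1))^-1.
have dim1 : 0 < dim + 1 by rewrite ltr_wpDl.
have kap0 : 0 < kap by rewrite invr_gt0 mulr_gt0.
have kapE : kap * (dim + 1) = 8^-1.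
  by rewrite /kap invfM -mulrA mulVf ?mulr1// gt_eqF.
have [C2 C21 HC2] := gaugeM_bounded_shift.
have C20 : 0 < C2 by exact: lt_le_trans C21.
(* then M <= kap K after the translations *)
pose c1 : R := kap / (2 * C2).
have c10 : 0 < c1 by rewrite divr_gt0// mulr_gt0.
have e80 : 0 < 8^-1 :> R by rewrite invr_gt0.
have eta2 : 0 < eta / 2 by rewrite divr_gt0.
have [M0 M01 HM0] := expR_eventually_le D e80 eta2.
pose nm : R := 2 * n%:R + m%:R.
exists c1, (4 * nm / kap), (Num.max M0 c1^-1); split => // K.
rewrite ge_max => /andP[KM Kc].
have K1 : 1 <= K by exact: le_trans KM.
have K0 : 0 < K by exact: lt_le_trans K1.
split => //.
pose U := K `^ q; have KU : K <= U.
  by rewrite -[leLHS](powRr1 (ltW K0)) ler_powR.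
have U0 : 0 < U by exact: lt_le_trans KU.
pose y := kap * U; have y0 : 0 < y by rewrite mulr_gt0.
pose d : R := expR (- (3 * y)).
have d0 : 0 < d by exact: expR_gt0.
have d1 : d <= 1 by rewrite expR_le1 oppr_le0 mulr_ge0// ltW.
pose d' := d ^+ k0.
have d'0 : 0 < d' by rewrite exprn_gt0.
have d'1 : d' <= 1 by rewrite exprn_ile1// ltW.
exists d => // b A eps Delta mA HD e0 ed Asmall.
have [a a0 aE] := wgtE gamma0 q1 A.
have rho_low z v : M z <= c1 * K -> (forall i, `|tnth v.1 i| <= 2) ->
    (forall j, `|tnth v.2 j| <= 1) -> 1 <= expR y * rho (affine2 1 1 v z).
  move=> zK v1 v2; rewrite -expRD -[leLHS]expR0 ler_expR subr_ge0.
  have h : M (affine2 1 1 v z) <= kap * K.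
    apply: le_trans (HC2 z v v1 v2) _.
    apply: le_trans (_ : C2 * (2 * (c1 * K)) <= _).
      rewrite ler_pM2l//.
      have : 1 <= c1 * K by rewrite -(mulfV (lt0r_neq0 c10)) ler_pM2l.
      by move: zK; lra.
    have -> : C2 * (2 * (c1 * K)) = 2 * C2 * c1 * K by ring.
    by rewrite /c1 mulrCA mulfV ?mulr1// gt_eqF// mulr_gt0.
  have kap1 : kap <= 1.
    by rewrite /kap invf_le1 ?mulr_gt0//; move: dim0; lra.
  apply: le_trans (_ : (kap * K) `^ q <= _).
    rewrite ge0_ler_powR ?nnegrE ?gaugeM_ge0 ?(le_trans ler01 q1)//.
    by rewrite mulr_ge0 ?ltW.
  rewrite powRM ?(ltW kap0) ?(ltW K0)// -/U /y; apply: ler_wpM2r; first exact: ltW.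
  rewrite -[leRHS](powRr1 (ltW kap0)) ger_powR// ?kap0//.
have rho1 z : rho z <= 1 by rewrite expR_le1 oppr_le0 powR_ge0.
pose P := A `&` near_origin c1 K i0 b.
have mP : measurable P by apply: measurableI => //; exact: measurable_near_origin.
have PA : P `<=` A by move=> z [].
rewrite -/P; have [a00|an0] := eqVneq a 0.
  have := le_weight (lam) (@rho_ge0 R n m gamma q) PA.
  rewrite -[X in (_ <= X)%E -> _]/(wgt A) aE a00 mule0 add0e => h.
  apply: le_trans h _; rewrite lee_fin mulr_ge0 ?(outer_mass_ge0 HD)// divr_ge0
    ?(ltW e0)//.
  rewrite mulr_ge0 ?(ltW (xscale_gt0 _ _ K1))// divr_ge0 ?(ltW kap0)// mulr_ge0//.
  by rewrite addr_ge0// mulr_ge0.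
have agt0 : 0 < a by rewrite lt0r an0.
pose Box := translation_box d d' (sign_start b d).
have [w Bw Hw] : exists2 w, Box w &
    (wgt [set z | P z /\ A (translate w 1 z)] <= (eta * a)%:E)%E.
  have mBox : measurable Box by exact: measurable_translation_box.
  apply: (@averaging_translation R n m gamma q gamma0 P A Box (expR y) a
    (d ^+ n * d' ^+ m) (eta * a) mP mA mBox).
  - exact: expR_ge0.
  - move=> z w' [_ [zK _]] /(translation_boxP d0 d1 d'1)[_ _ _ w1 w2].
    by rewrite /translate !scalev1; apply: rho_low.
  - by rewrite -aE; apply: le_weight => // z; exact: rho_ge0.
  - by rewrite aE.
  - by rewrite mulr_ge0// ltW.
  - exact: lebesgue_translation_box.
  have VE : d ^+ n * d' ^+ m = expR (- (3 * dim * y)).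
    rewrite /d' -exprM -exprD /d -expRM_natl natrD natrM.
    by congr expR; rewrite /dim; ring.
  rewrite VE mulrAC [ltRHS]mulrAC ltr_pM2r//.
  move: Asmall; rewrite aE lee_fin -/U => Asmall.
  apply: le_lt_trans (_ : D * expR (- (8^-1 * U)) * expR (- (3 * dim * y)) < _).
    apply: le_trans (ler_wpM2l (expR_ge0 y) Asmall) _.
    rewrite mulrCA -!mulrA ler_pM2l// -!expRD ler_expR.
    have hy : y + dim * y = 8^-1 * U by rewrite -kapE /y; ring.
    by move: hy y0; lra.
  rewrite ltr_pM2r ?expR_gt0//; apply: le_lt_trans (HM0 U (le_trans KM KU)) _.
  by move: eta0; lra.
have [w1 w2 w3 w4 w5] := translation_boxP d0 d1 d'1 Bw.
have nm1 : 2 <= nm.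
  rewrite /nm; have : 1 <= n%:R :> R
    by rewrite ler1n (leq_ltn_trans _ (ltn_ord i0)).
  by have : 0 <= m%:R :> R by []; lra.
have x1d z : P z -> d <= eucl_norm (translate (w.1, zvec m) 1 z).1.
  move=> [_ [_ zb]]; apply: le_trans (tnth_le_eucl_norm _ i0).
  rewrite /translate /= scalev1 tnth_mktuple mul1r.
  have : (-1) ^+ b * (tnth z.1 i0 + tnth w.1 i0) <= `|tnth z.1 i0 + tnth w.1 i0|.
    apply: le_trans (ler_norm _) _; rewrite normrM normrX normrN1 expr1n mul1r//.
  by apply: le_trans; rewrite mulrDr -[leLHS]add0r; exact: lerD.
have sv k s (v : k.-tuple R) c : 0 <= s <= 1 -> (forall i, `|tnth v i| <= c) ->
    forall i, `|tnth (scalev s v) i| <= c.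
  move=> /andP[s0 s1] H i; rewrite tnth_mktuple normrM ger0_norm//.
  by apply: le_trans (H i); rewrite ler_piMl.
have sz k s (c : R) : 0 <= c -> forall i, `|tnth (scalev s (zvec k)) i| <= c.
  by move=> c0 i; rewrite scalev_zvec tnth_mktuple normr0.
have c02 : 0 <= 2 :> R by [].
have TL : (wgt P <= (eta * a + 2 * (nm * d) / eps *
    ((expR y + expR y * expR y) * Delta))%:E)%E.
  apply: (@two_leg R n m gamma q A P eps Delta (nm * d) (expR y) (expR y) (eta * a)
    w.1 w.2 mA HD mP PA (expR_ge0 _) (expR_ge0 _) e0).
- by apply: le_trans ed _; rewrite ler_peMl ?(ltW d0)//; move: nm1; lra.
- apply: le_trans (eucl_norm_le_sup w2) _; rewrite mulrA ler_pM2r// /nm mulrC.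
  by rewrite lerDl.
- move=> z Pz; have dx := x1d z Pz; split; first exact: lt_le_trans dx.
  apply: le_trans (eucl_norm_le_sup w3) _; rewrite -mulrA; apply: ler_pM => //.
  + exact: ltW.
  + by rewrite /nm lerDr mulr_ge0.
  apply: le_trans (_ : d * d `^ gamma <= _); last first.
    by rewrite ler_pM2l// ge0_ler_powR ?nnegrE ?eucl_norm_ge0 ?(ltW d0).
  rewrite -[X in X * _](powRr1 (ltW d0)) -powRD; last first.
    by apply/implyP => _; rewrite gt_eqF.
  by rewrite /d' -(powR_mulrn _ (ltW d0)) ger_powR// d0.
- move=> z s [_ [zK _]] s01; apply: le_trans (rho1 z) _; apply: rho_low => //=.
  + exact: sv.
  + exact: sz.
- move=> z s [_ [zK _]] s01; apply: le_trans (rho1 _) _.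
  have -> : translate (zvec n, w.2) s (translate (w.1,
    zvec m) 1 z) = affine2 1 1 (w.1, scalev s w.2) z.
    have E z' : translate (zvec n, w.2) s z' = translate (zvec n,
      scalev s w.2) 1 z'.
      by rewrite /translate /= !scalev_zvec scalev1.
    rewrite (E (translate (w.1, zvec m) 1 z)) translate_xy /translate /= !scalev1.
    by [].
  by apply: rho_low => //=; exact: sv.
- by rewrite -surjective_pairing.
apply: le_trans TL _; rewrite aE -EFinM -EFinD lee_fin lerD2l.
have D0' := outer_mass_ge0 HD.
have -> : 2 * (nm * d) / eps * ((expR y + expR y * expR y) * Delta) =
    2 * nm * (d * (expR y + expR y * expR y)) * (Delta / eps).
  by move: (eps^-1) (expR y) => t t'; ring.
have -> : 4 * nm / kap * xscale K / eps * Delta =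
    2 * nm * (2 * xscale K / kap) * (Delta / eps).
  by move: (eps^-1) (kap^-1) => t t'; ring.
apply: ler_wpM2r; first by rewrite divr_ge0// ltW.
apply: ler_wpM2l; first by move: nm1; lra.
have y1 : 1 <= expR y by rewrite -expR0 ler_expR ltW.
apply: le_trans (_ : d * (2 * (expR y * expR y)) <= _).
  rewrite ler_pM2l//; have : expR y <= expR y * expR y
    by rewrite ler_peMl// expR_ge0.
  by move: (expR y * expR y) => t; lra.
have -> : d * (2 * (expR y * expR y)) = 2 * expR (- y).
  by rewrite mulrCA -!expRD; congr (_ * expR _); ring.
rewrite -mulrA ler_pM2l// ler_pdivlMr//.
have LU : 1 <= xscale K * U.
  apply: (le_trans K1); apply: le_trans (_ : yscale q K * U <= _).
    rewrite /yscale /U -powRD; last by apply/implyP => _; rewrite gt_eqF.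
    by have -> : 1 - q + q = 1 by [ring]; rewrite powRr1// ltW.
  rewrite ler_pM2r; [exact: (yscale_le_xscale gamma0 q1 K1)|exact: U0].
have ye : y * expR (- y) <= 1.
  rewrite expRN ler_pdivrMr ?expR_gt0// mul1r.
  by apply: le_trans (expR_ge1Dx y); rewrite lerDr.
rewrite -(ler_pM2r U0); apply: le_trans LU.
by have -> : expR (- y) * kap * U = y * expR (- y) by rewrite /y; ring.
Qed.

End near.

(** * The lower bound on enlargements *)

Section combine.
Context {R : realType}.
Variables (n m : nat) (gamma q : R).
Hypotheses (gamma0 : 0 <= gamma) (q1 : 1 <= q) (hn : (0 < n)%N) (hm : (0 < m)%N).
Notation X := (n.-tuple R * m.-tuple R)%type.
Notation lam := (@lebesgue_tuple R n \x @lebesgue_tuple R m)%E.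
Notation M := (@gaugeM R n m gamma).
Notation xscale := (@xscale R gamma q).
Notation rho := (@rho R n m gamma q).
Notation wgt := (@wgt R n m gamma q).
Notation AK := (extremiser n m gamma).

Let q0 : 0 < q. Proof. exact: lt_le_trans q1. Qed.

(** The difference (K+c)^q - K^q is at most k c (K+c)^(q-1), which is a small
    part of (K+c)^q. *)
Lemma powR_translate_le (c : R) : 0 < c -> exists2 K0 : R, 1 <= K0 &
  forall K, K0 <= K -> (K + c) `^ q <= 5 / 4 * K `^ q.
Proof.
move=> c0; have [k k1 Hk] := @powR_sub_le R q q1.
have k0 : 0 < k by exact: lt_le_trans k1.
exists (Num.max 1 (5 * k * c)); first by rewrite le_max lexx.
move=> K; rewrite ge_max => /andP[K1 Kc].
have K0 : 0 < K by exact: lt_le_trans K1.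
have Kc0 : 0 < K + c by rewrite addr_gt0.
have := Hk (K + c) K (ltW K0); rewrite lerDl => /(_ (ltW c0)).
have -> : K + c - K = c by ring.
have E : (K + c) `^ (q - 1) * (K + c) = (K + c) `^ q.
  by rewrite mulrC mulr_powRB1 ?ltW.
have h : k * c * 5 * (K + c) `^ (q - 1) <= (K + c) `^ q.
  rewrite -E mulrC ler_wpM2l ?powR_ge0//.
  by move: Kc c0; have -> : k * c * 5 = 5 * k * c by [ring]; lra.
move: h; have -> : k * (K + c) `^ (q - 1) * c = k * c * (K + c) `^ (q - 1) by ring.
have -> : k * c * 5 * (K + c) `^ (q - 1) = 5 * (k * c * (K + c) `^ (q - 1)) by ring.
by move: (k * c * _) ((K + c) `^ q) (K `^ q) => u v w; lra.
Qed.

(** The mass of M >= 2K is at most a multiple of exp(-(3/2) K^q), that of the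
    extremiser is at least exp(-(5/4) K^q). *)
Lemma tail_small (eta : R) : 0 < eta -> exists2 K0, 1 <= K0 & forall K, K0 <= K ->
  (wgt [set z | (2 * K <= M z)%R] <= eta%:E * wgt (AK K))%E.
Proof.
move=> eta0; have b0 : 0 < 4^-1 :> R by rewrite invr_gt0.
have b1 : 4^-1 <= 1 :> R by rewrite invf_le1// ler1n.
have [D D0 HD] := @tail_upper R n m gamma q gamma0 q1 _ b0 b1.
have [c c0 Hc] := @mass_lower R n m gamma q hm gamma0 q1.
have [K1 K11 HK1] := powR_translate_le c0.
have [M0 M01 HM0] := expR_eventually_le D b0 eta0.
exists (Num.max K1 M0); first by rewrite le_max K11.
move=> K; rewrite ge_max => /andP[KK1 KM0].
have K1' : 1 <= K by exact: le_trans KK1.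
have K0 : 0 < K by exact: lt_le_trans K1'.
have U0 : K <= K `^ q by rewrite -[leLHS](powRr1 (ltW K0)) ler_powR.
apply: le_trans (HD (2 * K) _) _; first by rewrite mulr_ge0// ltW.
apply: (@le_trans _ _ (eta%:E * (expR (- ((K + c) `^ q)))%:E)%E); last first.
  by apply: lee_wpmul2l; [rewrite lee_fin ltW|exact: Hc (ltW K0)].
rewrite -EFinM lee_fin.
have h1 := HK1 K KK1.
have h2 : 2 * K `^ q <= (2 * K) `^ q.
  rewrite powRM ?(ltW K0)//; apply: ler_wpM2r; first exact: powR_ge0.
  by rewrite -[leLHS](powRr1 (ler0n R 2)) ler_powR// ler1n.
apply: le_trans (_ : D * expR (- (4^-1 * K `^ q)) * expR (- ((K + c) `^ q)) <= _).
  rewrite -mulrA ler_pM2l// -expRD ler_expR.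
  by move: h1 h2; move: ((K + c) `^ q) ((2 * K) `^ q) (K `^ q) => u v w; lra.
by apply: ler_wpM2r; [exact: expR_ge0|apply: HM0; exact: le_trans U0].
Qed.

Lemma piece_bound_weaken eta C C' K (P : set X) : C <= C' -> 1 <= K ->
  piece_bound gamma q eta C K P -> piece_bound gamma q eta C' K P.
Proof.
move=> CC K1 H A eps Delta mA HD e0 eL;
  apply: le_trans (H A eps Delta mA HD e0 eL) _.
apply: leeD2l; rewrite lee_fin; apply: ler_wpM2r; first exact: outer_mass_ge0 HD.
apply: ler_wpM2r; first by rewrite invr_ge0 ltW.
by apply: ler_wpM2r => //; rewrite ltW// xscale_gt0.
Qed.

(** With eta = 1/(2N), where N is the number of pieces, the terms eta (wgt A) add
    up to half of wgt A. *)
Lemma outer_mass_lower : exists C K0, 0 < C /\ forall K, K0 <= K -> 1 <= K /\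
  exists2 e1, 0 < e1 & forall A eps Delta, measurable A -> wgt A = wgt (AK K) ->
    outer_mass_le gamma q A eps Delta -> 0 < eps -> eps <= e1 ->
    (wgt (AK K) <= (C * xscale K / eps * Delta)%:E)%E.
Proof.
pose i0 : 'I_n := Ordinal hn.
pose I := (unit + bool + (('I_n * bool) + (bool * ('I_m * bool))))%type.
pose N : R := #|{: I}|%:R.
have N0 : 0 < N.
  by rewrite /N ltr0n; apply/card_gt0P; exists (inl (inl tt)).
pose eta : R := (2 * N)^-1.
have eta0 : 0 < eta by rewrite invr_gt0 mulr_gt0.
have [D D0 HD] := @mass_upper R n m gamma q gamma0 q1.
have [c1 [C1 [K1 [c10 H1]]]] :=
  @near_origin_piece R n m gamma q gamma0 q1 i0 D eta D0 eta0.
have [C2 [K2 H2]] := @xdom_piece R n m gamma q gamma0 q1 c1 eta c10 eta0.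
have [C3 [K3 H3]] := @ydom_piece R n m gamma q gamma0 q1 c1 eta c10 eta0 hn.
have [K5 K51 H5] := tail_small eta0.
pose C := Num.max (Num.max C1 C2) (Num.max C3 1).
have [CC1 CC2 CC3 C0] : [/\ C1 <= C, C2 <= C, C3 <= C & 1 <= C].
  by split; rewrite /C !le_max lexx ?orbT.
exists (2 * N * C), (Num.max (Num.max K1 K2) (Num.max K3 K5)); split.
  by rewrite mulr_gt0 ?(lt_le_trans ltr01 C0)// mulr_gt0.
move=> K; rewrite !ge_max => /andP[/andP[k1 k2] /andP[k3 k5]].
have Kge1 : 1 <= K by exact: le_trans k5.
split => //; have [_ [e1 e10 {}H1]] := H1 K k1.
have L0 := xscale_gt0 gamma q Kge1.
exists (Num.min e1 (xscale K)); first by rewrite lt_min e10.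
move=> A eps Delta mA AE HDelta e0; rewrite le_min => /andP[ee1 eL].
have [a a0 aE] := wgtE gamma0 q1 A.
have De0 := outer_mass_ge0 HDelta.
pose Z := C * xscale K / eps * Delta.
pose piece (i : I) : set X := match i with
  | inl (inl _) => [set z | 2 * K <= M z]
  | inl (inr b) => near_origin gamma c1 K i0 b
  | inr (inl jb) => xdom gamma c1 K jb
  | inr (inr cjb) => ydom gamma q c1 K cjb end.
have mpiece i : measurable (piece i).
  case: i => [[[]|b]|[jb|cjb]] /=.
  - by apply: measurable_le_set; [exact: measurable_cst|exact: measurable_gaugeM].
  - exact: measurable_near_origin.
  - exact: measurable_xdom.
  - exact: measurable_ydom.
have bound i : (wgt (A `&` piece i) <= (eta * a + Z)%:E)%E.
  rewrite EFinD EFinM -aE; case: i => [[[]|b]|[jb|cjb]].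
  - apply: (@le_trans _ _ (eta%:E * wgt A)%E).
      rewrite AE; apply: le_trans (H5 K k5); apply: le_weight.
        by move=> z; exact: rho_ge0.
      by move=> z [].
    rewrite leeDl// lee_fin mulr_ge0// mulr_ge0 ?invr_ge0 ?(ltW e0)//.
    by rewrite mulr_ge0 ?(ltW L0)// (le_trans ler01).
  - have Asmall := HD K (le_trans ler01 Kge1); rewrite -AE in Asmall.
    apply: le_trans (H1 b A eps Delta mA HDelta e0 ee1 Asmall) _.
    apply: leeD2l; rewrite lee_fin; apply: ler_wpM2r => //.
    apply: ler_wpM2r; first by rewrite invr_ge0 ltW.
    by apply: ler_wpM2r => //; exact: ltW.
  - have [_ h] := H2 K k2 jb.
    exact: (piece_bound_weaken CC2 Kge1 h mA HDelta e0 eL).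
  - have [_ h] := H3 K k3 cjb.
    exact: (piece_bound_weaken CC3 Kge1 h mA HDelta e0 eL).
have cover z : A z -> exists i, piece i z.
  move=> _; case: (leP (2 * K) (M z)) => zK; first by exists (inl (inl tt)).
  case: (leP (M z) (c1 * K)) => zc.
    exists (inl (inr (tnth z.1 i0 < 0))); split => //.
    by case: ltP => h; rewrite ?expr1 ?expr0 ?mul1r ?mulN1r ?oppr_ge0 ?(ltW h).
  case: (leP (ypart gamma z) (xpart gamma z)) => xy.
    have [jb h] := coord_piece_cover z.1 hn; exists (inr (inl jb)).
    by split => //; exact: ltW.
  have [jb h] := coord_piece_cover z.2 hm.
  exists (inr (inr (eucl_norm z.1 <= xscale K, jb))); split => //=.
  - by rewrite !ltW.
  - exact: ltW.
  - by case: leP => // /ltW.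
have tot : (wgt A <= (N * (eta * a + Z))%:E)%E.
  have mr := @measurable_rho R n m gamma q.
  have r0 := @rho_ge0 R n m gamma q.
  apply: le_trans (weight_cover lam mr r0 mA mpiece cover) _.
  apply: (@le_trans _ _ (\sum_(i : I) (eta * a + Z)%:E)%E).
    by apply: lee_sum => i _; exact: bound.
  by rewrite sumEFin sumr_const -[leLHS]/((_ *+ #|{: I}|)%:E) lee_fin /N mulr_natl.
have -> : 2 * N * C * xscale K / eps * Delta = 2 * N * Z.
  by rewrite /Z; move: (eps^-1) => t; ring.
move: tot; rewrite -AE aE !lee_fin.
have : N * eta = 2^-1 by rewrite /eta invfM mulrCA mulfV ?mulr1// gt_eqF.
have -> : N * (eta * a + Z) = N * eta * a + N * Z by ring.
have -> : 2 * N * Z = 2 * (N * Z) by ring.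
by move=> ->; move: (N * Z) => t; lra.
Qed.

End combine.

(** * Perimeters and the profile *)

Section lower_limit.
Context {R : realType}.
Implicit Types (f : R -> \bar R) (c : \bar R).

Let right_small (e0 : R) : 0 < e0 -> \forall x \near (0 : R)^'+, 0 < x /\ x < e0.
Proof.
move=> e00; near=> x; split; near: x; first exact: nbhs_right_gt.
exact: nbhs_right_lt.
Unshelve. all: by end_near. Qed.

Lemma le_limf_einf_right f c (e0 : R) : 0 < e0 ->
  (forall e, 0 < e -> e < e0 -> (c <= f e)%E) -> (c <= limf_einf f 0%R^'+)%E.
Proof.
move=> e00 H; rewrite limf_einfE.
apply: le_ereal_sup_tmp; exists (ereal_inf (f @` [set x | 0 < x /\ x < e0])).
  by exists [set x | 0 < x /\ x < e0] => //; exact: right_small.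
by apply: le_ereal_inf_tmp => _ [x [x0 xe] <-]; exact: H.
Qed.

Lemma limf_einf_right_le f c (e0 : R) : 0 < e0 ->
  (forall e, 0 < e -> e < e0 -> (f e <= c)%E) -> (limf_einf f 0%R^'+ <= c)%E.
Proof.
move=> e00 H; rewrite limf_einfE; apply: ge_ereal_sup => _ [V FV <-].
have [x [[x0 xe] Vx]] := filter_ex (filterI (right_small e00) FV).
by apply: le_trans (H x x0 xe); apply: ereal_inf_lbound; exists x.
Qed.

End lower_limit.

Section measure_of_weight.
Context {R : realType}.
Variables (n m : nat) (gamma p : R).
Hypotheses (hn : (0 < n)%N) (hm : (0 < m)%N) (gamma0 : 0 <=
  gamma) (hp : 1 + gamma <= p).
Notation X := (n.-tuple R * m.-tuple R)%type.
Notation lam := (@lebesgue_tuple R n \x @lebesgue_tuple R m)%E.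
Notation q := (p / (1 + gamma)).
Notation xscale := (@xscale R gamma q).
Notation rho := (@rho R n m gamma q).
Notation wgt := (@wgt R n m gamma q).
Notation AK := (extremiser n m gamma).
Notation mu := (grushin_measure n m gamma p).
Notation Z := (grushin_Z n m gamma p).
Notation mass := (@extremiser_mass R n m gamma q).

Let g1_gt0 : 0 < 1 + gamma. Proof. by rewrite ltr_pwDl. Qed.

Let q1 : 1 <= q. Proof. by rewrite ler_pdivlMr// mul1r. Qed.

Lemma grushin_Z_wgt : wgt setT = Z%:E.
Proof.
have [r _ rE] := wgtE gamma0 q1 [set: X].
rewrite /grushin_Z /Rintegral; under eq_integral do rewrite grushin_densityE.
by rewrite -[X in fine X]/(wgt setT) rE.
Qed.

Lemma grushin_Z_gt0 : 0 < Z.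
Proof.
rewrite -lte_fin -grushin_Z_wgt.
apply: (@lt_le_trans _ _ (wgt (AK 0))).
  by rewrite extremiser_massE// lte_fin extremiser_mass_gt0.
by apply: le_weight => // z; exact: rho_ge0.
Qed.

Lemma grushin_measureE (S : set X) : measurable S -> mu S = ((Z^-1)%:E * wgt S)%E.
Proof.
move=> mS; have H (c : R) : 0 <= c ->
    (\int[lam]_(z in S) (c * rho z)%:E = c%:E * wgt S)%E.
  move=> c0; rewrite /wgt -ge0_integralZl_EFin//.
    by move=> z _; rewrite lee_fin rho_ge0.
  by apply/measurable_EFinP/measurable_funTS; exact: measurable_rho.
rewrite -H; last by rewrite invr_ge0 ltW// grushin_Z_gt0.
by apply: eq_integral => z _; rewrite grushin_densityE.
Qed.

Lemma le_grushin_measure (S S' : set X) : S `<=` S' -> (mu S <= mu S')%E.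
Proof.
have h (z : X) : 0 <= Z^-1 * grushin_density gamma p z :> R.
  by rewrite mulr_ge0 ?expR_ge0// invr_ge0 ltW// grushin_Z_gt0.
by move=> SS; apply: (le_integral_incl lam h h SS) => z _; exact: lexx.
Qed.

Lemma grushin_measure_extremiser K : mu (AK K) = (Z^-1 * mass K)%:E.
Proof. by rewrite grushin_measureE ?extremiser_massE//;
  exact: measurable_extremiser. Qed.

Lemma subset_enlargement (A : set X) eps : 0 < eps ->
  A `<=` enlargement (cc_dist gamma) A eps.
Proof.
move=> e0 [x y] Az; apply: (@enlargement_mem _ _ _ _ A eps (x, y) (x, y) 0) => //.
have := cc_dist_move_x gamma x (zvec n) y; by rewrite affine1_zvec eucl_norm_zvec.
Qed.

Lemma perimeter_extremiser_le : exists2 C, 0 < C & forall K, 2 <= K ->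
  (perimeter mu (cc_dist gamma) (AK K) <= (C * (Z^-1 * mass K) / xscale K)%:E)%E.
Proof.
have [C C0 H] := @wgt_enlargement_le R n m gamma q hm gamma0 q1.
exists C => // K K2; have [e0 e00 {}H] := H K K2.
apply: (limf_einf_right_le e00) => e ep ee.
have [B [mB EB wB]] := H e ep ee.
have muB : (mu (enlargement (cc_dist gamma) (AK K) e) <=
    (Z^-1 * (mass K + C * e / xscale K * mass K))%:E)%E.
  apply: le_trans (le_grushin_measure EB) _; rewrite grushin_measureE//.
  rewrite EFinM; apply: lee_wpmul2l.
    by rewrite lee_fin invr_ge0 ltW// grushin_Z_gt0.
  by apply: le_trans wB _; rewrite extremiser_massE.
rewrite grushin_measure_extremiser inver gt_eqF//.
apply: (@le_trans _ _ (((Z^-1 * (mass K + C * e / xscale K * mass K))%:E -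
    (Z^-1 * mass K)%:E) * (e^-1)%:E)%E).
  apply: lee_wpmul2r; first by rewrite lee_fin invr_ge0 ltW.
  exact: leeB.
rewrite -EFinB -EFinM lee_fin.
have -> : Z^-1 * (mass K + C * e / xscale K * mass K) - Z^-1 * mass K =
   C * (Z^-1 * mass K) / xscale K * e by move: (Z^-1) ((xscale K)^-1) => t t'; ring.
by rewrite mulfK// gt_eqF.
Qed.

(** For Delta take the gain of mass, wgt of the enlargement minus wgt A. *)
Lemma perimeter_ge : exists C K0, 0 < C /\ forall K, K0 <= K -> 1 <= K /\
  forall A, measurable A -> mu A = mu (AK K) ->
  ((Z^-1 * mass K / (C * xscale K))%:E <= perimeter mu (cc_dist gamma) A)%E.
Proof.
have [C [K0 [C0 H]]] := @outer_mass_lower R n m gamma q gamma0 q1 hn hm.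
exists C, K0; split => // K KK; have [K1 [e1 e10 {}H]] := H K KK.
split => // A mA AE; have Z0 := grushin_Z_gt0.
have L0 := xscale_gt0 gamma q K1.
have wE : wgt A = wgt (AK K).
  have := AE; rewrite grushin_measure_extremiser grushin_measureE//
    extremiser_massE//.
  have [a _ ->] := wgtE gamma0 q1 A; rewrite -EFinM => -[] /(mulfI _) -> //.
  by rewrite invr_neq0// gt_eqF.
apply: (le_limf_einf_right e10) => e ep ee.
set E := enlargement _ _ _.
have [b bE] : exists b, mu E = b%:E.
  have h1 : (0 <= mu E)%E.
    apply: integral_ge0 => z _.
    by rewrite lee_fin mulr_ge0 ?expR_ge0// invr_ge0 ltW.
  have h2 : (mu E <= mu setT)%E by exact: le_grushin_measure.
  exists (fine (mu E)); rewrite fineK// ge0_fin_numE//.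
  apply: le_lt_trans h2 _; rewrite grushin_measureE// grushin_Z_wgt -EFinM.
  exact: ltry.
have := H A e (Z * (b - Z^-1 * mass K)) mA wE _ ep (ltW ee).
rewrite AE grushin_measure_extremiser bE inver gt_eqF// -EFinB -EFinM
  extremiser_massE// !lee_fin.
move=> h; rewrite ler_pdivrMr ?mulr_gt0// -(ler_pM2l Z0) mulrA mulfV ?gt_eqF//
  mul1r.
have : mass K <= C * xscale K / e * (Z * (b - Z^-1 * mass K)).
  apply: h => S mS SE SA.
  have AS : (mu (A `|` S) <= mu E)%E.
    apply: le_grushin_measure => z [Az|Sz]; last exact: SE.
    exact: subset_enlargement.
  move: AS; rewrite grushin_measureE; last exact: measurableU.
  rewrite /wgt weightU//; last by rewrite setIC.
  - rewrite -/(wgt _) -/(wgt _) wE extremiser_massE// bE.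
    have [s _ ->] := wgtE gamma0 q1 S.
    rewrite -EFinD -EFinM !lee_fin -(ler_pM2l Z0).
    by rewrite mulrA mulfV ?gt_eqF// mul1r mulrBr mulrA mulfV ?gt_eqF// mul1r
      lerBrDl.
  - exact: measurable_rho.
  - by move=> z; exact: rho_ge0.
move: (b - _) => t.
have -> : C * xscale K / e * (Z * t) = Z * (t / e * (C * xscale K)).
  by move: (e^-1) => t'; ring.
by [].
Qed.

End measure_of_weight.

Theorem theorem1 (R : realType) (n m : nat) (gamma p : R)
    (hn : (1 <= n)%N) (hm : (1 <= m)%N) (hgamma : 0 <= gamma)
    (hp : 1 + gamma <= p) :
  let mu := grushin_measure n m gamma p in
  let A := extremiser n m gamma in
  let perim := perimeter mu (cc_dist gamma) in
  let profile := isoperimetric_profile mu (cc_dist gamma) in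
  exists K0 t0 C : R,
    [/\ 0 < K0, 0 < t0 < 1, 1 < C,
        [set mu (A K) | K in [set K | K0 <= K]] =
          [set t%:E | t in [set t : R | 0 < t <= t0]]
      & forall K : R, K0 <= K ->
          (0 < profile (mu (A K)) < +oo)%E /\
            (perim (A K) / profile (mu (A K)) <= C%:E)%E].
Proof.
move=> mu A perim profile.
have g1 : 0 < 1 + gamma by rewrite ltr_pwDl.
have q1 : 1 <= p / (1 + gamma) by rewrite ler_pdivlMr// mul1r.
have Z0 := grushin_Z_gt0 n hm hgamma hp.
have [C1 C10 H1] := perimeter_extremiser_le n hm hgamma hp.
have [C2 [K2 [C20 H2]]] := perimeter_ge hn hm hgamma hp.
have [D D0 HD] := @mass_upper R n m gamma (p / (1 + gamma)) hgamma q1.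
have h2 : 0 < 2^-1 :> R by rewrite invr_gt0.
have Z2 : 0 < grushin_Z n m gamma p / 2 by rewrite divr_gt0.
have [K3 K31 H3] := expR_eventually_le D h2 Z2.
pose K0 := Num.max 3 (Num.max K2 K3).
have [K03 K02 K0K3] : [/\ 3 <= K0, K2 <= K0 & K3 <= K0].
  by split; rewrite /K0 !le_max lexx ?orbT.
have K00 : 0 < K0 by apply: lt_le_trans K03.
pose ms := @extremiser_mass R n m gamma (p / (1 + gamma)).
pose z := (grushin_Z n m gamma p)^-1.
have z0 : 0 < z by rewrite invr_gt0.
have ms0 K : K0 <= K -> 0 < ms K.
  by move=> KK; apply: extremiser_mass_gt0 => //; apply: le_trans KK; exact: ltW.
have muA K : mu (A K) = (z * ms K)%:E by exact: grushin_measure_extremiser.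
exists K0, (z * ms K0), (C1 * C2 + 1); split => //.
- rewrite mulr_gt0 ?ms0//= mulrC ltr_pdivrMr// mul1r.
  apply: le_lt_trans (_ : grushin_Z n m gamma p / 2 < _); last by move: Z0; lra.
  apply: le_trans (H3 K0 K0K3).
  have := HD K0 (ltW K00); rewrite extremiser_massE// lee_fin => h;
    apply: le_trans h _.
  rewrite ler_pM2l// ler_expR lerN2 mulrC ler_pM2r//.
  rewrite -[leLHS](powRr1 (ltW K00)) ler_powR//.
  by apply: le_trans K03; rewrite ler1n.
- by rewrite ltrDr mulr_gt0.
- have HR := extremiser_mass_range n hm hgamma q1 K03.
  apply/seteqP; split => [_ [K /= KK <-]|_ [t /= /andP[t0 tK] <-]].
    exists (z * ms K); last by rewrite muA.
    apply/andP; split; first exact: (mulr_gt0 z0 (ms0 K KK)).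
    by rewrite (ler_pM2l z0); exact: (extremiser_mass_decr n m hgamma q1 KK).
  have : [set t | 0 < t <= ms K0] (t / z).
    apply/andP; split; first exact: (divr_gt0 t0 z0).
    by rewrite (ler_pdivrMr _ _ z0) mulrC.
  rewrite -HR => -[K /= KK KE]; exists K => //.
  by rewrite muA /ms KE mulrC divfK// gt_eqF.
- move=> K KK; have [K1 {}H2] := H2 K (le_trans K02 KK).
  have L0 := xscale_gt0 gamma (p / (1 + gamma)) K1.
  have {}H1 := H1 K; have K2' : 2 <= K by move: K03 KK; lra.
  have {}H1 := H1 K2'.
  have mK := ms0 K KK.
  set r := (z * ms K / (C2 * xscale gamma (p / (1 + gamma)) K)) in H2.
  have r0 : 0 < r by rewrite divr_gt0// mulr_gt0.
  have low : (r%:E <= profile (mu (A K)))%E.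
    by apply: le_ereal_inf_tmp => _ [B [mB BE] <-]; exact: H2.
  have up : (profile (mu (A K)) <= perim (A K))%E.
    apply: ereal_inf_lbound; exists (A K) => //; split => //.
    exact: measurable_extremiser.
  have pfin : (perim (A K) < +oo)%E by apply: le_lt_trans H1 _; exact: ltry.
  have plow := H2 (A K) (@measurable_extremiser _ _ _ _ _) erefl.
  split.
    apply/andP; split; first by apply: lt_le_trans low; rewrite lte_fin.
    exact: le_lt_trans up pfin.
  move: low up pfin H1 plow; rewrite -/(perim (A K)).
  move: (profile _) (perim _) => u v; case: u => [u||] //; case: v => [v||] //.
  rewrite !lee_fin => ru uv _ vle rv.
  have u0 : 0 < u by exact: lt_le_trans ru.
  rewrite inver gt_eqF// -EFinM lee_fin ler_pdivrMr//.
  apply: le_trans vle _.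
  apply: le_trans (_ : C1 * C2 * r <= _).
    rewrite /r invfM; move: ((xscale _ _ _)^-1) => t.
    have -> : C1 * C2 * (z * ms K * (C2^-1 * t)) = C1 * (z * ms K) * t * (C2 / C2).
      by move: (C2^-1) => t'; ring.
    by rewrite divff ?mulr1// gt_eqF.
  apply: le_trans (_ : C1 * C2 * u <= _).
    by rewrite ler_pM2l// mulr_gt0.
  by rewrite ler_pM2r// lerDl.
Qed.
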